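(* Let $n\ge1$, $m\in\mathbb{Z}_{>0}$ and $q,q_0,q_1\in(-1,1)$. Then for every $f\in\mathbb{P}^{(2m,n)}_{\texttt{b}}$, \[ \frac{1}{(2\pi)^n}\int_{\mathbb{A}^{(n)}_{\texttt{b}}}f(\boldsymbol{\xi})\,|C_{\texttt{b}}(\boldsymbol{\xi};q,q_0)|^{-2}\,\mathrm{d}\boldsymbol{\xi}=\sum_{\lambda\in\Lambda^{(m,n)}_{\texttt{b}}}f(\boldsymbol{\xi}^{(m,n)}_{\texttt{b};\lambda})\,\hat{\Delta}^{(m,n)}_{\texttt{b};\lambda}, \] with Christoffel weights $\hat{\Delta}^{(m,n)}_{\texttt{b};\lambda}=\Bigl(\sum_{\mu\in\Lambda^{(m,n)}_{\texttt{b}}}|P_{\texttt{b};\mu}(\boldsymbol{\xi}^{(m,n)}_{\texttt{b};\lambda};q,q_0)|^2\,\delta^{(m,n)}_{\texttt{b};\mu}(q)\Bigr)^{-1}$.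
   Context: Let $\mathbb{A}^{(n)}_{\texttt{b}}=\{\boldsymbol{\xi}\in\mathbb{R}^n:\pi>\xi_1>\xi_2>\dots>\xi_n>0\}$ with Lebesgue measure $\mathrm{d}\boldsymbol{\xi}=\mathrm{d}\xi_1\cdots\mathrm{d}\xi_n$. For an integer $D\ge0$ let $\Lambda^{(D,n)}_{\texttt{b}}=\{\mu\in\mathbb{Z}^n: D\ge\mu_1\ge\dots\ge\mu_n\ge0\}$. Define $C_{\texttt{b}}(\boldsymbol{\xi};q,q_0)=\prod_{j=1}^n\frac{1-q_0e^{-i\xi_j}}{1-e^{-2i\xi_j}}\prod_{1\le j<k\le n}\frac{1-qe^{-i(\xi_j-\xi_k)}}{1-e^{-i(\xi_j-\xi_k)}}\cdot\frac{1-qe^{-i(\xi_j+\xi_k)}}{1-e^{-i(\xi_j+\xi_k)}}$ and, for $\mu\in\mathbb{Z}^n$, the hyperoctahedral Hall-Littlewood polynomial $P_{\texttt{b};\mu}(\boldsymbol{\xi};q,q_0)=\sum_{\sigma\in S_n}\sum_{\epsilon\in\{1,-1\}^n}C_{\texttt{b}}(\epsilon_1\xi_{\sigma_1},\dots,\epsilon_n\xi_{\sigma_n};q,q_0)\exp(i\epsilon_1\xi_{\sigma_1}\mu_1+\dots+i\epsilon_n\xi_{\sigma_n}\mu_n)$. Let $\delta^{(m,n)}_{\texttt{b};\mu}(q)=\prod_{1\le j<k\le n,\ \mu_j=\mu_k}\frac{1-q^{k-j}}{1-q^{1+k-j}}$. Let $u_q(\theta)=\frac{1-q^2}{1-2q\cos\theta+q^2}$,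 $v_q(\vartheta)=\int_0^\vartheta u_q(\theta)\,\mathrm{d}\theta$ (same definition for $q_0,q_1$), and $\varrho_{\texttt{b};j}=n+1-j$. For $\lambda\in\Lambda^{(m,n)}_{\texttt{b}}$, the node $\boldsymbol{\xi}^{(m,n)}_{\texttt{b};\lambda}\in\mathbb{R}^n$ is the unique global minimizer of the strictly convex function $V(\boldsymbol{\xi})=\sum_{1\le j<k\le n}\Bigl(\int_0^{\xi_j+\xi_k}v_q+\int_0^{\xi_j-\xi_k}v_q\Bigr)+\sum_{j=1}^n\Bigl((m+1)\xi_j^2-2\pi(\varrho_{\texttt{b};j}+\lambda_j)\xi_j+\int_0^{\xi_j}(v_{q_0}+v_{q_1})\Bigr)$, equivalently the unique solution of $2(m+1)\xi_j+v_{q_0}(\xi_j)+v_{q_1}(\xi_j)+\sum_{k\ne j}(v_q(\xi_j+\xi_k)+v_q(\xi_j-\xi_k))=2\pi(\varrho_{\texttt{b};j}+\lambda_j)$, $j=1,\dots,n$ (it lies in $\mathbb{A}^{(n)}_{\texttt{b}}$). For $D\ge0$, $\mathbb{P}^{(D,n)}_{\texttt{b}}$ is the linear span of the functions $M_{\texttt{b};\mu}(\boldsymbol{\xi})=\sum_{\nu}\exp(i\nu_1\xi_1+\dots+i\nu_n\xi_n)$, $\mu\in\Lambda^{(D,n)}_{\texttt{b}}$, where $\nu$ runs over the distinct vectors $(\epsilon_1\mu_{\sigma_1},\dots,\epsilon_n\mu_{\sigma_n})$ with $\sigma\in S_n$, $\epsilon\in\{1,-1\}^n$ (equivalently, the symmetric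 polynomials of degree at most $D$ in each variable $\cos\xi_j$). *)

(* Defs.v *)
From HB Require Import structures.
From mathcomp Require Import all_boot all_order all_algebra all_fingroup.
From mathcomp Require Import all_classical all_reals all_analysis.
From mathcomp Require Import complex.

Set Implicit Arguments.
Unset Strict Implicit.
Unset Printing Implicit Defensive.

Import Order.TTheory GRing.Theory Num.Theory.
Local Open Scope ring_scope.
Local Open Scope classical_set_scope.
Local Open Scope complex_scope.

Section Defs.
Variable R : realType.
Local Notation C := (R[i]).

Definition ei (t : R) : C := Complex (cos t) (sin t).

Definition sqnorm (z : C) : R := (@complex.Re R z) ^+ 2 + (@complex.Im R z) ^+ 2.

Definition oint (a b : R) (g : R -> R) : R :=
  if a <= b then Rintegral (@lebesgue_measure R) `[a, b] g
  else - Rintegral (@lebesgue_measure R) `[b, a] g.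

Definition u_q (q theta : R) : R := (1 - q ^+ 2) / (1 - 2 * q * cos theta + q ^+ 2).
Definition v_q (q vartheta : R) : R := oint 0 vartheta (u_q q).

Definition sgn (b : bool) : R := (-1) ^+ b.

Variable n : nat.

Definition Cb (q q0 : R) (xi : 'I_n -> R) : C :=
  (\prod_(j : 'I_n)
     ((1 - q0%:C * ei (- xi j)) / (1 - ei (- (2 * xi j))))) *
  \prod_(j : 'I_n) \prod_(k : 'I_n | (j < k)%N)
     (((1 - q%:C * ei (- (xi j - xi k))) / (1 - ei (- (xi j - xi k)))) *
      ((1 - q%:C * ei (- (xi j + xi k))) / (1 - ei (- (xi j + xi k))))).

(* Lambda^{(D,n)}_b : partitions D >= mu_1 >= ... >= mu_n >= 0, encoded with
   values in 'I_D.+1 *)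
Definition nonincr (D : nat) (mu : {ffun 'I_n -> 'I_D.+1}) : bool :=
  [forall j : 'I_n, forall k : 'I_n, (j <= k)%N ==> (mu k <= mu j)%N].

Definition Pb (D : nat) (mu : {ffun 'I_n -> 'I_D.+1}) (q q0 : R)
    (xi : 'I_n -> R) : C :=
  \sum_(s : 'S_n) \sum_(e : {ffun 'I_n -> bool})
    Cb q q0 (fun j => sgn (e j) * xi (s j)) *
    ei (\sum_(j : 'I_n) sgn (e j) * xi (s j) * (mu j)%:R).

Definition deltab (D : nat) (mu : {ffun 'I_n -> 'I_D.+1}) (q : R) : R :=
  \prod_(j : 'I_n) \prod_(k : 'I_n | (j < k)%N && (mu j == mu k))
    ((1 - q ^+ (k - j)) / (1 - q ^+ (1 + (k - j)))).

Definition signed_perm (D : nat) (mu : {ffun 'I_n -> 'I_D.+1}) (s : 'S_n)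
    (e : {ffun 'I_n -> bool}) : {ffun 'I_n -> int} :=
  [ffun j => ((-1) ^+ (e j) * ((mu (s j) : nat)%:Z))%R].

Definition Mb (D : nat) (mu : {ffun 'I_n -> 'I_D.+1}) (xi : 'I_n -> R) : C :=
  \sum_(nu <- undup [seq signed_perm mu s e | s <- enum [set: 'S_n],
                                             e <- enum [set: {ffun 'I_n -> bool}]])
    ei (\sum_(j : 'I_n) (nu j)%:~R * xi j).

Definition in_Pb (D : nat) (f : ('I_n -> R) -> C) : Prop :=
  exists c : {ffun 'I_n -> 'I_D.+1} -> C,
    forall xi, f xi = \sum_(mu : {ffun 'I_n -> 'I_D.+1} | nonincr mu) c mu * Mb mu xi.

Definition in_Ab (xi : 'I_n -> R) : Prop :=
  (forall j : 'I_n, (j = 0%N :> nat) -> xi j < pi) /\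
  (forall j k : 'I_n, k = j.+1 :> nat -> xi k < xi j) /\
  (forall j : 'I_n, (j = n.-1 :> nat) -> 0 < xi j).

(* V(xi) for the node lambda, parameters m, q, q0, q1; rho_j = n + 1 - j
   (with 1-based j), i.e. n - j for the 0-based ordinal j *)
Definition Vb (m : nat) (lam : 'I_n -> nat) (q q0 q1 : R) (xi : 'I_n -> R) : R :=
  \sum_(j : 'I_n) \sum_(k : 'I_n | (j < k)%N)
      (oint 0 (xi j + xi k) (v_q q) + oint 0 (xi j - xi k) (v_q q)) +
  \sum_(j : 'I_n)
      ((m.+1)%:R * xi j ^+ 2 - 2 * pi * ((n - j)%N + lam j)%:R * xi j +
       oint 0 (xi j) (fun t => v_q q0 t + v_q q1 t)).

End Defs.

Definition tup (R : realType) (n : nat) (s : seq R) : 'I_n -> R :=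
  fun i => nth 0 s i.

Fixpoint iterint (R : realType) (k : nat) (F : seq R -> R) : R :=
  match k with
  | 0 => F [::]
  | k'.+1 => Rintegral (@lebesgue_measure R) setT
               (fun x : R => iterint k' (fun s => F (x :: s)))
  end.

Definition int_Ab (R : realType) (n : nat) (F : ('I_n -> R) -> R[i]) : R[i] :=
  Complex
    (iterint n (fun s => if `[< in_Ab (@tup R n s) >] then @complex.Re R (F (@tup R n s)) else 0))
    (iterint n (fun s => if `[< in_Ab (@tup R n s) >] then @complex.Im R (F (@tup R n s)) else 0)).

(* Main.v *)
Require Import Defs.
From mathcomp Require Import all_boot all_order all_algebra all_fingroup.
From mathcomp Require Import all_classical all_reals all_analysis.
From mathcomp Require Import measurable_realfun complex.
From mathcomp Require Import ring lra zify.
Import Order.TTheory GRing.Theory Num.Theory.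
Import numFieldNormedType.Exports.
Set Implicit Arguments.
Unset Strict Implicit.
Unset Printing Implicit Defensive.
Local Open Scope ring_scope.
Local Open Scope classical_set_scope.
Local Open Scope complex_scope.

(** Let W be the hyperoctahedral group and C the function [Cb]. If f is W-invariant, then f / |C|^2 is
    the W-symmetrization of a uniform limit g of trigonometric polynomials, and the integral of f / |C|^2
    over the alcove is (2 pi)^n times the constant term of g. Reading off constant terms shows that the
    Hall-Littlewood polynomials P_mu are orthogonal with squared norms 1 / delta_mu.

    Every symmetric polynomial of degree at most m + K in each cos x_j is a combination of the P_mu with
    mu_1 <= m and of products of symmetric polynomials of degree less than K with
    P_nu - q1 P_(nu - e_1), nu_1 = m + 1. For K <= m these products integrate to 0. They also vanish at
    the nodes: the equations of the critical point of V exponentiate to Bethe equations, by which the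
    summands of the W-symmetrization change sign when the sign of the first coordinate is flipped. So a
    quadrature rule at the nodes that is exact on the P_mu, mu_1 <= m, is exact up to degree 2m.

    There are as many nodes as such P_mu, and the P_mu separate them, so the matrix E of the values of
    the P_mu at the nodes is invertible and the weights w exist. Exactness on the products P_mu P_nu
    reads E diag(w) E^T = diag(1 / delta); inverting gives the Christoffel weights. *)

(** * Iterated integrals *)

(** The weight is tractable because 1 / |C|^2 = 1 / (C(x) C(-x)) is W-invariant: in P_k f / |C|^2
    the W-sum of P_k unfolds, the factor C(x) cancels, and the character of k times f / C(-x)
    remains. Both 1 / C(-x) and the quotients C(wx) / C(-x) expand, uniformly, in exponents of a
    pointed cone, so constant terms can be computed factor by factor. In the norm of a dominant P_k
    only the w = -s with s in the stabilizer of k in S_n contribute, each a power of q counting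
    inversions; they add up to the Poincare polynomial of that stabilizer, which is 1 / delta.

    Two obstacles shape the rest. The integral is iterated over the whole line, so each partial
    integral needs its own integrability; uniform limits of tensor sums supply it. And [Cb] has
    poles on the reflection hyperplanes, so identities hold at regular points only, and
    polynomiality shows after multiplication by the Weyl denominator of type C. *)

Section OneDimensional.
Variable R : realType.
Local Notation mu := (@lebesgue_measure R).

Lemma continuous_integrable_itv (g : R -> R) (a b : R) : continuous g ->
  mu.-integrable `[a, b] (EFin \o g).
Proof.
move=> cg; apply: continuous_compact_integrable; first exact: segment_compact.
exact: continuous_subspaceT.
Qed.

Lemma continuous_integrable_oo (g : R -> R) (a b : R) : continuous g ->
  mu.-integrable `]a, b[ (EFin \o g).
Proof.
move=> cg; apply: integrableS (continuous_integrable_itv a b cg) => //.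
by apply: subset_itv; rewrite bnd_simp.
Qed.

(** With a base point to the left of 0 and of [x], both orientations in [oint] obey one formula, so
    the fundamental theorem of calculus applies at every [x], 0 included. *)
Lemma oint_split (g : R -> R) (a x : R) : continuous g -> a <= 0 -> a <= x ->
  oint 0 x g = Rintegral mu `[a, x] g - Rintegral mu `[a, 0] g.
Proof.
move=> cg a0 ax; rewrite /oint; case: leP => x0.
  rewrite (@Rintegral_itvB _ _ (BLeft a) (BRight x) 0) ?bnd_simp //;
    last exact: (continuous_integrable_itv a x cg).
  rewrite Rintegral_itv_obnd_cbnd //.
  by apply: integrableS (continuous_integrable_itv 0 x cg) => //; apply: subset_itvr; rewrite bnd_simp.
rewrite -[RHS]opprB.
rewrite (@Rintegral_itvB _ _ (BLeft a) (BRight 0) x) ?bnd_simp ?(ltW x0) //; last exact: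
  (continuous_integrable_itv a 0 cg).
rewrite Rintegral_itv_obnd_cbnd //.
by apply: integrableS (continuous_integrable_itv x 0 cg) => //; apply: subset_itvr; rewrite bnd_simp.
Qed.

Lemma is_derive_oint (g : R -> R) (x : R) : continuous g ->
  is_derive x 1 (oint 0 ^~ g) (g x).
Proof.
move=> cg; set a := Num.min 0 x - 1.
have a0 : a < 0 by rewrite /a ltrBlDr (@le_lt_trans _ _ 0) ?ltrDl ?ge_min ?lexx.
have ax : a < x by rewrite /a ltrBlDr (@le_lt_trans _ _ x) ?ltrDl ?ge_min ?lexx ?orbT.
have xx : x < x + 1 by rewrite ltrDl.
have [dF F'] := continuous_FTC1_closed xx (continuous_integrable_itv a (x+1) cg) ax (cg x).
apply: (@near_eq_is_derive _ _ _ (fun y => Rintegral mu `[a, y] g - Rintegral mu `[a, 0] g)).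
  near=> y; rewrite (@oint_split _ a) ?ltW //.
  by near: y; exact: lt_nbhsr.
rewrite -[g x]subr0; apply: is_deriveB.
by rewrite -F' derive1E; apply: DeriveDef.
Unshelve. all: by end_near. Qed.

Lemma is_derive_eq_fun (F G : R -> R) (f : R -> R) :
  (forall x : R, is_derive x 1 F (f x)) -> (forall x : R, is_derive x 1 G (f x)) ->
  F 0 = G 0 -> F =1 G.
Proof.
move=> dF dG FG0 x; apply/subr0_eq.
have -> : F x - G x = F 0 - G 0.
  apply: (@is_derive_0_is_cst _ (fun y => F y - G y)) => y.
  by rewrite -[0](subrr (f y)); apply: is_deriveB.
by rewrite FG0 subrr.
Qed.

Lemma oint0 (g : R -> R) : oint 0 0 g = 0.
Proof. by rewrite /oint lexx set_itv1 Rintegral_set1. Qed.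

Lemma continuous_is_derive (F f : R -> R) :
  (forall x : R, is_derive x 1 F (f x)) -> continuous F.
Proof.
by move=> dF x; apply/differentiable_continuous/derivable1_diffP; case: (dF x).
Qed.

Lemma continuous_oint (g : R -> R) : continuous g -> continuous (oint 0 ^~ g).
Proof. by move=> cg; apply: continuous_is_derive => x; exact: is_derive_oint. Qed.

Lemma oint_primitive (F f : R -> R) : continuous f ->
  (forall x : R, is_derive x 1 F (f x)) -> F 0 = 0 -> oint 0 ^~ f =1 F.
Proof.
move=> cf dF F0; apply: (is_derive_eq_fun (f := f)) => //.
  by move=> x; exact: is_derive_oint.
by rewrite oint0.
Qed.

Lemma is_derive_big_sum (I : Type) (r : seq I) (a : I -> R) (F f : I -> R -> R) (x : R) :
  (forall i, is_derive x 1 (F i) (f i x)) ->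
  is_derive x 1 (fun y => \sum_(i <- r) a i * F i y) (\sum_(i <- r) a i * f i x).
Proof.
move=> dF; elim: r => [|i r IH].
  rewrite big_nil; under eq_fun do rewrite big_nil.
  exact: is_derive_cst.
rewrite big_cons; under eq_fun do rewrite big_cons.
apply: is_deriveD.
Qed.

Lemma continuous_big_sum (I : Type) (r : seq I) (a : I -> R) (f : I -> R -> R) :
  (forall i, continuous (f i)) ->
  continuous (fun y => \sum_(i <- r) a i * f i y).
Proof.
move=> cf; elim: r => [|i r IH] x.
  under eq_fun do rewrite big_nil.
  exact: cvg_cst.
under eq_fun do rewrite big_cons.
apply: cvgD; last exact: IH.
by apply: cvgM; [exact: cvg_cst|exact: cf].
Qed.

Lemma oint_sum (I : finType) (a : I -> R) (g : I -> R -> R) (x : R) :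
  (forall i, continuous (g i)) ->
  oint 0 x (fun y => \sum_i a i * g i y) = \sum_i a i * oint 0 x (g i).
Proof.
move=> cg.
apply: (oint_primitive (F := fun x => \sum_i a i * oint 0 x (g i))).
- exact: continuous_big_sum.
- by move=> y; apply: is_derive_big_sum => i; exact: is_derive_oint.
- by apply: big1 => i _; rewrite oint0 mulr0.
Qed.

Lemma is_derive_prod_ord n (F f : 'I_n -> R -> R) (x : R) :
  (forall i, is_derive x 1 (F i) (f i x)) ->
  is_derive x 1 (fun y => \prod_(j < n) F j y)
    (\sum_(i < n) f i x * \prod_(j < n | j != i) F j x).
Proof.
elim: n F f => [|n IH] F f dF.
  rewrite big_ord0; under eq_fun do rewrite big_ord0.
  exact: is_derive_cst.
have dF0 := is_deriveM (dF ord0) (IH _ (fun i => f (lift ord0 i)) (fun i => dF (lift ord0 i))).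
have -> : (fun y => \prod_(j < n.+1) F j y) =
    (F ord0 * (fun y => \prod_(j < n) F (lift ord0 j) y)).
  by apply/funext => y; rewrite big_ord_recl.
apply: is_derive_eq.
rewrite big_ord_recl [RHS]addrC; congr (_ + _).
  rewrite scaler_sumr; apply: eq_bigr => i _.
  rewrite [\prod_(j | j != lift ord0 i) _]big_mkcond big_ord_recl /= -big_mkcond /=.
  rewrite /GRing.scale /= mulrCA; congr (_ * (_ * _)).
rewrite /GRing.scale /= mulrC; congr (_ * _).
by rewrite [RHS]big_mkcond big_ord_recl /= mul1r.
Qed.

(** The integral of \prod_j f_j(x_j) over the ordered simplex b > x_0 > x_1 > ... > 0. *)
Fixpoint iter_oint n : ('I_n -> R -> R) -> R -> R :=
  match n with
  | 0 => fun _ _ => 1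
  | n'.+1 => fun f b => oint 0 b (fun x => f ord0 x * iter_oint (fun j => f (lift ord0 j)) x)
  end.

Lemma continuous_iter_oint n (f : 'I_n -> R -> R) : (forall i, continuous (f i)) -> continuous (iter_oint f).
Proof.
elim: n f => [|n IH] f cf /=; first by move=> x; exact: cvg_cst.
by apply: continuous_oint => x; apply: cvgM; [exact: cf|exact: IH].
Qed.

(** A permutation is the image of 0 together with a permutation of the remaining indices; the
    inductions on S_n rest on it. *)
Lemma lift_perm_bij n :
  bijective (fun p : 'I_n.+1 * 'S_n => lift_perm ord0 p.1 p.2 : 'S_n.+1).
Proof.
apply: inj_card_bij => [[i s] [j t] /permP hst|].
  have := hst ord0; rewrite /= !lift_perm_id => ij; subst j; congr (_, _).
  apply/permP => k; have := hst (lift ord0 k).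
  by rewrite /= !lift_perm_lift => /lift_inj.
by rewrite card_prod card_ord !card_Sn factS.
Qed.

Lemma sum_perm_lift (V : nmodType) n (F : 'S_n.+1 -> V) :
  \sum_(s : 'S_n.+1) F s = \sum_(i < n.+1) \sum_(s : 'S_n) F (lift_perm ord0 i s).
Proof.
rewrite pair_bigA /=; apply: (reindex (fun p : 'I_n.+1 * 'S_n => lift_perm ord0 p.1 p.2)).
exact/onW_bij/lift_perm_bij.
Qed.

(* Summing the iterated integral over all orders of the variables integrates over the whole cube. *)
Lemma shuffle_iter_oint n (f : 'I_n -> R -> R) : (forall i, continuous (f i)) ->
  forall b, \sum_(s : 'S_n) iter_oint (fun j => f (s j)) b = \prod_(j < n) oint 0 b (f j).
Proof.
elim: n f => [|n IH] f cf b.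
  rewrite big_ord0 /= (eq_bigr (fun=> 1)) // sumr_const cardT -cardE card_Sn.
  by rewrite mulr1n.
rewrite sum_perm_lift.
(* Term [i] collects the orders in which [f i] carries the largest variable. [L] and the product of
   integrals have the same derivative by the Leibniz rule, and both vanish at 0. *)
pose L b := \sum_(i < n.+1) 1 * oint 0 b (fun x => f i x * \prod_(j < n) oint 0 x (f (lift i j))).
have cg i : continuous (fun x => f i x * \prod_(j < n) oint 0 x (f (lift i j))).
  move=> x; apply: cvgM; first exact: cf.
  apply: (@continuous_is_derive _ _ (fun y => is_derive_prod_ord (F := fun j y => oint 0 y (f (lift i j))) (f :=
    fun j => f (lift i j)) _)).
  by move=> y j; exact: is_derive_oint.
transitivity (L b).
  apply: eq_bigr => i _; rewrite mul1r /=.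
  transitivity (\sum_(s : 'S_n) 1 * oint 0 b (fun x => f i x * iter_oint (fun j => f (lift i (s j))) x)).
    apply: eq_bigr => s _; rewrite mul1r; congr oint; apply/funext => x.
    rewrite lift_perm_id; congr (_ * iter_oint _ _); apply/funext => j.
    by rewrite lift_perm_lift.
  rewrite -oint_sum; last first.
    by move=> s x; apply: cvgM; [exact: cf|exact: continuous_iter_oint].
  congr oint; apply/funext => x; rewrite -IH // mulr_sumr.
  by apply: eq_bigr => s _; rewrite mul1r.
apply: (is_derive_eq_fun (F := L) (G := fun x => \prod_(j < n.+1) oint 0 x (f j)) (f := fun x => \sum_(i < n.+1) f
  i x * \prod_(j < n.+1 | j != i) oint 0 x (f j))).
- move=> x; rewrite /L.
  have -> : \sum_(i < n.+1) f i x * \prod_(j < n.+1 | j != i) oint 0 x (f j) =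
    \sum_(i < n.+1) 1 * (f i x * \prod_(j < n) oint 0 x (f (lift i j))).
    apply: eq_bigr => i _; rewrite mul1r; congr (_ * _).
    rewrite big_mkcond (bigD1_ord i) //= eqxx mul1r.
    by apply: eq_bigr => j _; rewrite eq_sym neq_lift.
  apply: (@is_derive_big_sum _ _ _ _ (fun i x => f i x * \prod_(j < n) oint 0 x (f (lift i j))) _) => i.
  exact: is_derive_oint.
- by move=> x; apply: is_derive_prod_ord => i; exact: is_derive_oint.
- by rewrite /L big1 ?big_ord_recl ?oint0 ?mul0r // => i _; rewrite oint0 mulr0.
Qed.

End OneDimensional.

(** * Integration over the ordered simplex by tensor approximation *)

Section Simplex.
Variable R : realType.
Local Notation mu := (@lebesgue_measure R).

Lemma oint_cst (c x : R) : oint 0 x (fun=> c) = c * x.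
Proof.
apply: (oint_primitive (F := fun x => c * x)); last by rewrite mulr0.
  by move=> y; exact: cvg_cst.
move=> y; have := is_deriveZ c (is_derive_id y 1).
by rewrite /GRing.scale /= mulr1.
Qed.

(** b > s_0 > s_1 > ... > 0, written as a path so that prepending a variable unfolds by computation;
    for b = pi it is the alcove. *)
Definition chain (b : R) (s : seq R) : bool := path (fun x y => y < x) b (rcons s 0).

Lemma chain_gt0 b s : chain b s -> 0 < b.
Proof.
rewrite /chain; elim: s b => [|x s IH] b /=; first by rewrite andbT.
by move=> /andP[xb /IH x0]; exact: lt_trans xb.
Qed.

Lemma eq_iterint k (F G : seq R -> R) :
  (forall s, size s = k -> F s = G s) -> iterint k F = iterint k G.
Proof.
elim: k F G => [|k IH] F G FG /=; first by apply: FG.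
by congr Rintegral; apply/funext => x; apply: IH => s sk; apply: FG; rewrite /= sk.
Qed.

Lemma iterint0 k : iterint k (fun _ : seq R => 0 : R) = 0.
Proof.
elim: k => [//|k IH] /=.
by under eq_Rintegral do rewrite IH; rewrite Rintegral_cst ?mul0r.
Qed.

Definition simplex_int k (h : seq R -> R) (b : R) := iterint k (fun s => if chain b s then h s else 0).

(** A chain that starts with [x] forces 0 < x < b; for any other [x] the inner integrand is
    identically 0, so the outer integral over the line shrinks to the interval. *)
Lemma simplex_int_rec k h b : simplex_int k.+1 h b = Rintegral mu `]0, b[ (fun x => simplex_int k (fun s => h (x
  :: s)) x).
Proof.
rewrite /simplex_int /= [RHS]Rintegral_mkcond; congr Rintegral; apply/funext => x.
rewrite patchE; case: ifPn.
  rewrite inE /= in_itv /= => /andP[x0 xb].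
  by apply: eq_iterint => s _; rewrite /chain /= xb.
rewrite notin_setE /= in_itv /= => /negP; rewrite negb_and -leNgt => /orP[x0|xb].
  rewrite -[RHS](iterint0 k); apply: eq_iterint => s _; rewrite /chain /=.
  by case: ifPn => // /andP[_ /chain_gt0]; rewrite ltNge x0.
rewrite -[RHS](iterint0 k); apply: eq_iterint => s _; rewrite /chain /=.
by rewrite (negbTE xb).
Qed.

Definition tensor k (f : 'I_k -> R -> R) (s : seq R) := \prod_(j < k) f j (nth 0 s j).

Lemma Rintegral_oo_oint (g h : R -> R) (b : R) : continuous h -> 0 < b ->
  {in `]0, b[, g =1 h} -> Rintegral mu `]0, b[ g = oint 0 b h.
Proof.
move=> ch b0 gh.
have -> : Rintegral mu `]0, b[ g = Rintegral mu `]0, b[ h.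
  by apply: eq_Rintegral => x xb; apply: gh; move: xb; rewrite inE.
rewrite /oint ltW // Rintegral_itv_bndo_bndc; last exact: continuous_integrable_oo.
rewrite Rintegral_itv_obnd_cbnd //.
by apply: integrableS (continuous_integrable_itv 0 b ch) => //; apply: subset_itv; rewrite bnd_simp.
Qed.

Definition tsum (I : finType) k (a : I -> R) (f : I -> 'I_k -> R -> R) (s : seq R) :=
  \sum_i a i * tensor (f i) s.

Lemma tsum_cons (I : finType) k (a : I -> R) (f : I -> 'I_k.+1 -> R -> R) x :
  (fun s => tsum a f (x :: s)) =
  tsum (fun i => a i * f i ord0 x) (fun i j => f i (lift ord0 j)).
Proof.
apply/funext => s; apply: eq_bigr => i _.
by rewrite /tensor big_ord_recl /= mulrA.
Qed.

Lemma simplex_int_tsum (I : finType) k (a : I -> R) (f : I -> 'I_k -> R -> R) (b : R) :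
  (forall i j, continuous (f i j)) -> 0 < b ->
  simplex_int k (tsum a f) b = \sum_i a i * iter_oint (f i) b.
Proof.
elim: k a f b => [|k IH] a f b cf b0.
  rewrite /simplex_int /= /chain /= b0 /=; apply: eq_bigr => i _.
  by rewrite /tensor big_ord0.
rewrite simplex_int_rec /= -oint_sum; last first.
  by move=> i x; apply: cvgM; [exact: cf|exact: continuous_iter_oint].
apply: Rintegral_oo_oint => // [|x].
  apply: continuous_big_sum => i x.
  by apply: cvgM; [exact: cf|exact: continuous_iter_oint].
rewrite inE /= in_itv /= => /andP[x0 _]; rewrite tsum_cons IH //.
by apply: eq_bigr => i _; rewrite mulrA.
Qed.

(* Uniform approximation by sums of products makes the partial integrals measurable; a function on the
   chamber is only known to be such a limit, never directly measurable. *)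
Definition approx k (b : R) (h : seq R -> R) := forall e : R, 0 < e ->
  exists (I : finType) (a : I -> R) (f : I -> 'I_k -> R -> R),
    (forall i j, continuous (f i j)) /\
    forall s, size s = k -> chain b s -> `|h s - tsum a f s| <= e.

Lemma approx_tsum k b (I : finType) (a : I -> R) (f : I -> 'I_k -> R -> R) :
  (forall i j, continuous (f i j)) -> approx k b (tsum a f).
Proof.
move=> cf e e0; exists I, a, f; split=> // s _ _.
by rewrite subrr normr0 ltW.
Qed.

Lemma approx_cons k (b : R) h (x : R) : x < b -> approx k.+1 b h -> approx k x (fun s => h (x :: s)).
Proof.
move=> xb ah e e0; have [I [a [f [cf hf]]]] := ah _ e0.
exists I, (fun i => a i * f i ord0 x), (fun i j => f i (lift ord0 j)); split=> // s sk cs.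
have := hf (x :: s); rewrite /= sk /chain /= xb => /(_ erefl cs).
by rewrite -[tsum a f (x :: s)]/((fun s => tsum a f (x :: s)) s) tsum_cons.
Qed.

(** Induction on [k]. Integrals can be subtracted and compared only once the partial integrals are
    known to be integrable; this also comes from the induction hypothesis, hence the two [approx]
    assumptions. *)
Lemma simplex_int_close k (b : R) h h' (e : R) : 0 <= e -> 0 < b -> approx k b h -> approx k b h' ->
  (forall s, size s = k -> chain b s -> `|h s - h' s| <= e) ->
  `|simplex_int k h b - simplex_int k h' b| <= e * b ^+ k.
Proof.
elim: k b h h' e => [|k IH] b h h' e e0 b0 ah ah' hh'.
  rewrite /simplex_int /= expr0 mulr1 {1 2}/chain /= b0; apply: hh' => //.
  by rewrite /chain /= b0.
pose phi h x := simplex_int k (fun s => h (x :: s)) x.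
(* For a tensor sum the partial integral is continuous. By induction such functions converge to
   [phi g] pointwise on ]0, b[, which gives measurability, and the first of them dominates [phi g]
   up to a constant. *)
have int_phi g : approx k.+1 b g -> mu.-integrable `]0, b[ (EFin \o phi g).
  move=> ag.
  pose e_ N : R := N.+1%:R^-1.
  have e_gt0 N : 0 < e_ N by rewrite invr_gt0.
  have /choice[T HT] : forall N, exists G : R -> R, continuous G /\
      forall x : R, 0 < x < b -> `|phi g x - G x| <= e_ N * b ^+ k.
    move=> N; have [I [a [f [cf hf]]]] := ag _ (e_gt0 N).
    exists (fun x => \sum_i a i * (f i ord0 x * iter_oint (fun j => f i (lift ord0 j)) x)); split.
      apply: continuous_big_sum => i x; apply: cvgM; first exact: cf.
      exact: continuous_iter_oint.
    move=> x /andP[x0 xb].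
    have -> : \sum_i a i * (f i ord0 x * iter_oint (fun j => f i (lift ord0 j)) x) = phi (tsum a f) x.
      rewrite /phi tsum_cons simplex_int_tsum //.
      by apply: eq_bigr => i _; rewrite mulrA.
    apply: le_trans (_ : e_ N * x ^+ k <= _).
      apply: IH => //.
      - exact: ltW.
      - exact: approx_cons ag.
      - by apply: approx_cons xb _; exact: approx_tsum.
      - by move=> s sk cs; apply: hf; rewrite /= ?sk // /chain /= xb.
    apply: ler_wpM2l; first exact: ltW.
    by rewrite lerXn2r ?nnegrE ?ltW.
  have mphi : measurable_fun `]0, b[ (phi g).
    apply: (measurable_fun_cvg (h := T)) => [N|x].
      by apply: measurable_funTS; apply: continuous_measurable_fun; case: (HT N).
    rewrite /= in_itv /= => xb.
    have cv : (fun N => e_ N * b ^+ k) @ \oo --> (0 : R).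
      rewrite -(mul0r (b ^+ k)); apply: cvgM; [exact: cvg_harmonic|exact: cvg_cst].
    apply/cvgrPdist_le => eps eps0.
    have /cvgrPdist_le/(_ _ eps0) := cv.
    apply: filterS => N; rewrite sub0r normrN => He.
    by apply: le_trans He; apply: le_trans (ler_norm _); case: (HT N) => _; apply.
  have [cT0 bT0] := HT 0.
  apply: (@le_integrable _ _ _ mu _ _ _ (fun x => (`|T 0 x| + e_ 0 * b ^+ k)%:E)) => //.
  - exact/measurable_EFinP.
  - move=> x /=; rewrite in_itv /= => /bT0 xb; rewrite lee_fin.
    apply: le_trans (ler_norm _); rewrite -lerBlDl; apply: le_trans xb.
    by rewrite -{1}(subrK (T 0 x) (phi g x)) lerBlDr ler_normD.
  - apply: (continuous_integrable_oo 0 b (g := fun x => `|T 0 x| + e_ 0 * b ^+ k)) => x.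
    apply: cvgD; last exact: cvg_cst.
    by apply: cvg_norm; exact: cT0.
rewrite !simplex_int_rec -RintegralB //; try exact: int_phi.
have ii : mu.-integrable `]0, b[ (EFin \o (fun x => phi h x - phi h' x)).
  have -> : EFin \o (fun x : R => phi h x - phi h' x) = (fun x : R => (phi h x)%:E - (phi h' x)%:E)%E.
    by apply/funext => x; rewrite /= EFinB.
  by refine (integrableB _ (int_phi _ ah) (int_phi _ ah')).
have /(_ (measurable_itv _) ii) := @le_normr_Rintegral _ _ _ mu `]0, b[ (fun x => phi h x - phi h' x).
move=> /le_trans; apply.
have -> : e * b ^+ k.+1 = Rintegral mu `]0, b[ (fun=> e * b ^+ k).
  rewrite (Rintegral_oo_oint (h := fun=> e * b ^+ k)) //; last by move=> x; exact: cvg_cst.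
  by rewrite oint_cst exprSr mulrA.
apply: le_Rintegral => //.
- refine (integrable_norm ii).
- by apply: (continuous_integrable_oo 0 b (g := cst _)) => x; exact: cvg_cst.
move=> x /=; rewrite in_itv /= => /andP[x0 xb].
apply: le_trans (_ : e * x ^+ k <= _).
  apply: IH => //.
  - exact: approx_cons ah.
  - exact: approx_cons ah'.
  - by move=> s sk cs; apply: hh'; rewrite /= ?sk // /chain /= xb.
by apply: ler_wpM2l => //; rewrite lerXn2r ?nnegrE ?ltW.
Qed.

(** All approximants have the same integral [c], so the integral of [h] is within a multiple of
    every [e] of [c], and no limit of values is taken. *)
Lemma simplex_int_val n h c : 
  (forall e : R, 0 < e -> exists (I : finType) (a : I -> R) (f : I -> 'I_n -> R -> R),
    [/\ forall i j, continuous (f i j),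
      forall s, size s = n -> chain pi s -> `|h s - tsum a f s| <= e &
      \sum_i a i * iter_oint (f i) pi = c]) ->
  simplex_int n h pi = c.
Proof.
move=> H; apply/eqP; rewrite -subr_eq0 -normr_le0; apply/ler_addgt0Pr => e e0.
have pin : 0 < pi ^+ n :> R by rewrite exprn_gt0 // pi_gt0.
have [|I [a [f [cf hf <-]]]] := H (e / pi ^+ n); first by rewrite divr_gt0.
rewrite -simplex_int_tsum ?pi_gt0 // add0r -[leRHS](divfK (lt0r_neq0 pin)).
apply: simplex_int_close => //.
- by rewrite divr_ge0 ?ltW.
- exact: pi_gt0.
- by move=> eps /H[I' [a' [f' [? ? _]]]]; exists I', a', f'; split.
- exact: approx_tsum.
Qed.
End Simplex.

(** * Trigonometric polynomials and the hyperoctahedral group *)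

Section Characters.
Variable R : realType.
Local Notation C := (R[i]).

Lemma ei0 : ei (0 : R) = 1.
Proof. by rewrite /ei cos0 sin0. Qed.

Lemma eiD (x y : R) : ei (x + y) = ei x * ei y.
Proof.
by rewrite /ei cosD sinD; apply/eqP; rewrite eq_complex /=; apply/andP; split; apply/eqP; ring.
Qed.

Lemma ei_conj (x : R) : (ei x)^* = ei (- x).
Proof. by rewrite /ei cosN sinN. Qed.

Lemma eiN_mul (x : R) : ei (- x) * ei x = 1.
Proof. by rewrite -eiD addNr ei0. Qed.

Lemma ei_neq0 (x : R) : ei x != 0.
Proof. by apply/eqP => e0; have := eiN_mul x; rewrite e0 mulr0 => /eqP; rewrite eq_sym oner_eq0. Qed.

Lemma eiN (x : R) : ei (- x) = (ei x)^-1.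
Proof. by apply: (mulIf (ei_neq0 x)); rewrite eiN_mul mulVf ?ei_neq0. Qed.

Lemma norm_ei (x : R) : `|ei x| = 1.
Proof. by rewrite normc_def /= cos2Dsin2 sqrtr1. Qed.

Lemma ei_sum (I : Type) (r : seq I) (P : pred I) (f : I -> R) :
  ei (\sum_(i <- r | P i) f i) = \prod_(i <- r | P i) ei (f i).
Proof. by apply: (big_morph (@ei R)); [exact: eiD|exact: ei0]. Qed.

Lemma ei_addN (x : R) : ei x + ei (- x) = (2 * cos x)%:C.
Proof. by apply/eqP; rewrite /ei cosN sinN eq_complex /= subrr eqxx mulr2n mulrDl !mul1r eqxx. Qed.

Variable n : nat.
Local Notation Zn := {ffun 'I_n -> int}.
Local Notation W := ('S_n * {ffun 'I_n -> bool})%type.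
Implicit Types (k : Zn) (x : 'I_n -> R) (w u : W).

Definition chr k x : C := ei (\sum_j (k j)%:~R * x j).

Lemma chrD k l x : chr (k + l) x = chr k x * chr l x.
Proof.
rewrite /chr -eiD -big_split; congr ei; apply: eq_bigr => j _.
by rewrite ffunE intrD mulrDl.
Qed.

Lemma chr0 x : chr 0 x = 1.
Proof. by rewrite /chr big1 ?ei0 // => j _; rewrite ffunE mul0r. Qed.

Lemma chrN k x : chr (- k) x = (chr k x)^-1.
Proof.
rewrite /chr -eiN -sumrN; congr ei; apply: eq_bigr => j _.
by rewrite ffunE intrN mulNr.
Qed.

Lemma norm_chr k x : `|chr k x| = 1. Proof. exact: norm_ei. Qed.

Lemma chrX k x l : chr (k *+ l) x = chr k x ^+ l.
Proof. by elim: l => [|l IH]; rewrite ?mulr0n ?chr0 // mulrS exprS chrD IH. Qed.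

Definition wact w x : 'I_n -> R := fun j => sgn R (w.2 j) * x (w.1 j).

(** The action on weights dual to [wact], see [chr_wact]; it therefore reverses products, see
    [wt_actM]. *)
Definition wt_act w k : Zn :=
  [ffun i => (-1) ^+ (w.2 ((w.1)^-1%g i)) * k ((w.1)^-1%g i)].

Lemma chr_wact k w x : chr k (wact w x) = chr (wt_act w k) x.
Proof.
rewrite /chr [in RHS](reindex_inj (@perm_inj _ w.1)); congr ei; apply: eq_bigr => j _.
by rewrite /wt_act /wact ffunE permK intrM rmorphXn rmorphN1 /sgn /=; ring.
Qed.

Definition wmul w u : W := ((w.1 * u.1)%g, [ffun j => w.2 j (+) u.2 (w.1 j)]).

Lemma wactM w u x : wact w (wact u x) = wact (wmul w u) x.
Proof.
by apply/funext => j; rewrite /wact /= ffunE permM /sgn signr_addb mulrA.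
Qed.

Lemma wmul_injl u : injective (wmul^~ u).
Proof.
move=> [s e] [t f] /= [/mulIg <- /ffunP ef]; congr (_, _); apply/ffunP => j.
by have := ef j; rewrite !ffunE => /addIb.
Qed.

Lemma wmul_injr w : injective (wmul w).
Proof.
move=> [s e] [t f] /= [/mulgI <- /ffunP ef]; congr (_, _); apply/ffunP => j.
by have := ef (w.1^-1%g j); rewrite !ffunE permKV => /addbI.
Qed.

Lemma sum_wactr (V : nmodType) (F : ('I_n -> R) -> V) u x :
  \sum_w F (wact w (wact u x)) = \sum_w F (wact w x).
Proof.
rewrite [RHS](reindex_inj (@wmul_injl u)).
by apply: eq_bigr => w _; rewrite wactM.
Qed.

Definition w1 : W := (1%g, [ffun=> false]).
Definition w0 : W := (1%g, [ffun=> true]).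

Lemma wact0 x : wact w0 x = fun j => - x j.
Proof. by apply/funext => j; rewrite /wact /= ffunE perm1 /sgn expr1 mulN1r. Qed.

(** Determinant of the signed permutation. *)
Definition sgw w : C := (-1) ^+ (odd_perm w.1) * \prod_j (-1) ^+ (w.2 j).

Lemma sgwM w u : sgw (wmul w u) = sgw w * sgw u.
Proof.
rewrite /sgw /= odd_permM signr_addb mulrACA; congr (_ * _).
rewrite [X in _ = _ * X](reindex_inj (@perm_inj _ w.1)) -big_split.
by apply: eq_bigr => j _; rewrite ffunE signr_addb.
Qed.

Lemma sgw_sqr w : sgw w * sgw w = 1.
Proof.
rewrite /sgw mulrACA -signr_addb addbb expr0 mul1r -big_split big1 // => j _.
by rewrite /= -signr_addb addbb.
Qed.

(* A list of (coefficient, exponent) pairs stands for a trigonometric polynomial; exponents may repeat. *)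
Definition trig (T : seq (C * Zn)) x : C := \sum_(p <- T) p.1 * chr p.2 x.
Definition const_coef (T : seq (C * Zn)) : C := \sum_(p <- T | p.2 == 0) p.1.

Definition trigM (S T : seq (C * Zn)) := [seq (p.1 * q.1, p.2 + q.2) | p <- S, q <- T].

Lemma trig_mul S T x : trig (trigM S T) x = trig S x * trig T x.
Proof.
rewrite /trig /trigM big_allpairs_dep mulr_suml; apply: eq_bigr => p _.
by rewrite mulr_sumr; apply: eq_bigr => q _ /=; rewrite chrD; ring.
Qed.

Lemma trig_cat S T x : trig (S ++ T) x = trig S x + trig T x.
Proof. exact: big_cat. Qed.

Lemma const_coef_cat S T : const_coef (S ++ T) = const_coef S + const_coef T.
Proof. exact: big_cat. Qed.

Definition orbit_sum k x : C := \sum_w chr k (wact w x).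

Lemma orbit_sum_wact k u x : orbit_sum k (wact u x) = orbit_sum k x.
Proof. exact: (sum_wactr (chr k)). Qed.

(** Summing over the signs turns exponentials into cosines, so an orbit sum is real and is a sum of
    tensor products, the form that the simplex integral handles. *)
Lemma orbit_sum_sum_perm k x :
  orbit_sum k x = (\sum_(s : 'S_n) \prod_(j < n) (2 * cos ((k ((s^-1)%g j))%:~R * x j)))%:C.
Proof.
rewrite /orbit_sum -(pair_bigA _ (fun s e => chr k (wact (s, e) x))) /= rmorph_sum.
apply: eq_bigr => s _.
rewrite rmorph_prod [RHS](reindex_inj (@perm_inj _ s)) /=.
transitivity (\prod_(j < n) \sum_(b : bool) ei (sgn R b * ((k j)%:~R * x (s j)))).
  rewrite bigA_distr_bigA; apply: eq_bigr => e _.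
  rewrite /chr ei_sum; apply: eq_bigr => j _; congr ei.
  by rewrite /wact /=; ring.
apply: eq_bigr => j _.
by rewrite big_bool /sgn expr1 expr0 permK mulN1r mul1r /= addrC ei_addN.
Qed.

End Characters.

(** * Integration over the alcove by constant terms *)

Section Unfold.
Variable R : realType.
Local Notation C := (R[i]).

Lemma sin_pi_int (k : int) : sin (k%:~R * pi) = 0 :> R.
Proof.
have sn m : sin (m%:R * pi) = 0 :> R.
  elim: m => [|m IH]; first by rewrite mul0r sin0.
  by rewrite -natr1 mulrDl mul1r sinD IH sinpi mul0r mulr0 addr0.
case: k => m; first exact: sn.
by rewrite NegzE rmorphN /= mulNr sinN sn oppr0.
Qed.

Lemma continuous_cosM (a : R) : continuous (fun x : R => 2 * cos (a * x)).
Proof.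
move=> x; apply: cvgM; first exact: cvg_cst.
apply: (continuous_comp (f := fun x : R => a * x)); last exact: continuous_cos.
by apply: cvgM; [exact: cvg_cst|exact: cvg_id].
Qed.

Lemma oint_cos (k : int) : oint 0 pi (fun x : R => 2 * cos (k%:~R * x)) = (2 * pi) *+ (k == 0).
Proof.
have [->|k0] := eqVneq k 0.
  rewrite mulr1n -(oint_cst 2 pi); congr oint; apply/funext => x.
  by rewrite mul0r cos0 mulr1.
have k0' : k%:~R != 0 :> R by rewrite intr_eq0.
transitivity ((fun x : R => (2 / k%:~R) * sin (k%:~R * x)) pi); last by rewrite sin_pi_int mulr0.
apply: (@oint_primitive R (fun x : R => (2 / k%:~R) * sin (k%:~R * x)) (fun x : R => 2 * cos (k%:~R * x))).
- exact: continuous_cosM.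
- move=> x.
  have dk : is_derive x 1 (fun x : R => k%:~R * x) (k%:~R : R).
    by have := is_deriveZ (k%:~R) (is_derive_id x (1 : R)); rewrite /GRing.scale /= mulr1.
  have ds := @is_derive1_comp _ sin (fun x : R => k%:~R * x) x (cos (k%:~R * x)) (k%:~R) (is_derive_sin _) dk.
  have := is_deriveZ (2 / k%:~R) ds.
  rewrite /GRing.scale /=.
  by rewrite (_ : 2 / _ * _ = 2 * cos (k%:~R * x)) //; field.
- by rewrite mulr0 sin0 mulr0.
Qed.

Variable n : nat.
Local Notation Zn := {ffun 'I_n -> int}.
Local Notation W := ('S_n * {ffun 'I_n -> bool})%type.

(** By the shuffle identity the sum is an integral over the cube [0, pi]^n, which factors; one
    nonzero frequency makes a factor vanish. *)
Lemma sum_iter_oint_cos (k : Zn) :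
  \sum_(s : 'S_n) iter_oint (fun j x => 2 * cos ((k ((s^-1)%g j))%:~R * x)) pi =
  (2 * pi) ^+ n *+ (k == 0) :> R.
Proof.
rewrite (reindex_inj invg_inj) /=.
under eq_bigr do rewrite invgK.
rewrite (shuffle_iter_oint (f := fun j x => 2 * cos ((k j)%:~R * x))); last by move=> j; exact: continuous_cosM.
under eq_bigr do rewrite oint_cos.
have [->|k0] := eqVneq k 0.
  under eq_bigr do rewrite ffunE eqxx mulr1n.
  by rewrite prodr_const card_ord.
have /existsP[j kj] : [exists j, k j != 0].
  rewrite -negb_forall; apply: contra k0 => /forallP k0; apply/eqP/ffunP => j.
  by rewrite ffunE; apply/eqP.
by rewrite (bigD1 j) //= (negbTE kj) mulr0n mul0r.
Qed.

Lemma in_Ab_chain (s : seq R) : (0 < n)%N -> size s = n ->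
  `[< in_Ab (@tup R n s) >] = chain pi s.
Proof.
move=> n0 sn; apply/asboolP/idP.
  move=> [h1 [h2 h3]]; apply/(pathP 0) => i; rewrite size_rcons sn ltnS => ilen.
  case: i ilen => [|i] ilen /=.
    rewrite nth_rcons sn n0; exact: (h1 (Ordinal n0)).
  rewrite !nth_rcons sn ilen; case: ltnP => iin.
    exact: (h2 (Ordinal ilen) (Ordinal iin)).
  have -> : i.+1 == n by rewrite eqn_leq ilen iin.
  by apply: (h3 (Ordinal ilen)) => /=; have /eqP <- : i.+1 == n by rewrite eqn_leq ilen iin.
move=> /(pathP 0) h; split; last split.
- move=> j j0; have := h 0%N; rewrite size_rcons /= => /(_ isT).
  by rewrite nth_rcons sn n0 /tup j0.
- move=> j k kj; have := h k; rewrite size_rcons sn ltnS => /(_ (ltnW (ltn_ord k))).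
  rewrite kj /= !nth_rcons sn (ltn_ord j) (_ : (j.+1 < n)%N = true) -?kj ?ltn_ord //.
- move=> j jn; have := h j.+1; rewrite size_rcons sn ltnS jn prednK // leqnn => /(_ isT).
  have -> : (rcons s 0)`_n = 0 by rewrite nth_rcons sn ltnn eqxx.
  have -> : (pi :: rcons s 0)`_n = s`_(n.-1).
    by rewrite -[X in _`_X](prednK n0) /= nth_rcons sn prednK // leqnn.
  by rewrite /tup jn.
Qed.

Lemma iterint_Ab (F : ('I_n -> R) -> R) : (0 < n)%N ->
  iterint n (fun s => if `[< in_Ab (@tup R n s) >] then F (@tup R n s) else 0) =
  simplex_int n (fun s => F (@tup R n s)) pi.
Proof.
by move=> n0; apply: eq_iterint => s sn; rewrite in_Ab_chain.
Qed.

Lemma Re_real_mul (a : C) (b : R) : complex.Re (a * b%:C) = complex.Re a * b.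
Proof. by case: a => x y /=; rewrite mulr0 subr0. Qed.

(** Summing an approximant of [g] over W replaces each character by a real orbit sum, whose alcove
    integral is (2 pi)^n for the zero weight and 0 otherwise: only the constant term survives. *)
Lemma Re_unfold (H g : ('I_n -> R) -> C) (c : C) : (0 < n)%N ->
  (forall e : R, 0 < e -> exists T, const_coef T = c /\
     forall w x, in_Ab x -> `|g (wact w x) - trig T (wact w x)| <= e%:C) ->
  (forall x, in_Ab x -> H x = \sum_w g (wact w x)) ->
  simplex_int n (fun s => complex.Re (H (@tup R n s))) pi = complex.Re c * (2 * pi) ^+ n.
Proof.
move=> n0 gT Hg; apply: simplex_int_val => e e0.
pose N := #|{: W}|.
have N0 : (0 < N)%N by apply/card_gt0P; exists (w1 n).
have [|T [cT hT]] := gT (e / N%:R); first by rewrite divr_gt0 // ltr0n.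
exists ('I_(size T) * 'S_n)%type.
exists (fun p : 'I_(size T) * 'S_n => complex.Re (nth (0, 0) T p.1).1).
exists (fun (p : 'I_(size T) * 'S_n) j x => 2 * cos (((nth (0, 0) T p.1).2 ((p.2^-1)%g j))%:~R * x)).
split.
- by move=> p j; exact: continuous_cosM.
- move=> s sn cs.
  have xA : in_Ab (@tup R n s) by apply/asboolP; rewrite in_Ab_chain.
  set x := tup _ in xA *.
  have -> : tsum (fun p : 'I_(size T) * 'S_n => complex.Re (nth (0, 0) T p.1).1)
     (fun (p : 'I_(size T) * 'S_n) j x => 2 * cos (((nth (0, 0) T p.1).2 ((p.2^-1)%g j))%:~R * x)) s
    = complex.Re (\sum_w trig T (wact w x)).
    rewrite /trig exchange_big /= raddf_sum /= (big_nth (0, 0)) big_mkord.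
    rewrite /tsum -(pair_bigA _ (fun (i : 'I_(size T)) (t : 'S_n) => complex.Re (nth (0, 0) T i).1 *
       tensor (fun j x => 2 * cos (((nth (0, 0) T i).2 ((t^-1)%g j))%:~R * x)) s)) /=.
    apply: eq_bigr => i _; rewrite -!mulr_sumr -[\sum_w chr _ _]/(orbit_sum _ x) orbit_sum_sum_perm.
    by rewrite Re_real_mul.
  rewrite Hg // -raddfB -sumrB /=.
  rewrite -lecR; apply: le_trans (normc_ge_Re _) _.
  apply: le_trans (ler_norm_sum _ _ _) _.
  apply: le_trans (_ : \sum_(w : W) (e / N%:R)%:C <= _).
    by apply: ler_sum => w _; exact: hT.
  rewrite sumr_const -/N -rmorphMn /= -mulr_natr divfK ?lexx //.
  by rewrite pnatr_eq0 -lt0n.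
- rewrite -(pair_bigA _ (fun (i : 'I_(size T)) (t : 'S_n) => complex.Re (nth (0, 0) T i).1 *
       iter_oint (fun j x => 2 * cos (((nth (0, 0) T i).2 ((t^-1)%g j))%:~R * x)) pi)) /=.
  rewrite -cT /const_coef raddf_sum /= mulr_suml (big_nth (0, 0)) big_mkord [RHS]big_mkcond /=.
  apply: eq_bigr => i _; rewrite -mulr_sumr sum_iter_oint_cos.
  by case: eqP; rewrite ?mulr0n ?mulr0 ?mulr1n.
Qed.

Lemma int_Ab_unfold (H g : ('I_n -> R) -> C) (c : C) : (0 < n)%N ->
  (forall e : R, 0 < e -> exists T, const_coef T = c /\
     forall w x, in_Ab x -> `|g (wact w x) - trig T (wact w x)| <= e%:C) ->
  (forall x, in_Ab x -> H x = \sum_w g (wact w x)) ->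
  int_Ab H = ((2 * pi) ^+ n)%:C * c.
Proof.
move=> n0 gT Hg; rewrite /int_Ab.
rewrite (iterint_Ab (fun x => complex.Re (H x))) // (iterint_Ab (fun x => complex.Im (H x))) //.
rewrite (Re_unfold n0 gT Hg).
(* Im z is the real part of -i z, so the imaginary part is the real case applied to -i H. *)
have -> : (fun s => complex.Im (H (@tup R n s))) = (fun s => complex.Re ((- 'i) * H (@tup R n s))).
  by apply/funext => s; case: (H _) => a b /=; rewrite oppr0 mul0r sub0r mulN1r opprK.
rewrite (@Re_unfold (fun x => - 'i * H x) (fun x => - 'i * g x) (- 'i * c)) //.
- case: c {gT} => a b; apply/eqP; rewrite eq_complex /=; apply/andP; split; apply/eqP; ring.
- move=> e /gT[T [cT hT]]; exists [seq (- 'i * p.1, p.2) | p <- T]; split.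
    by rewrite -cT /const_coef big_map mulr_sumr.
  move=> w x xA; have -> : trig [seq (- 'i * p.1, p.2) | p <- T] (wact w x) = - 'i * trig T (wact w x).
    by rewrite /trig big_map mulr_sumr; apply: eq_bigr => p _; rewrite mulrA.
  rewrite -mulrBr normrM.
  have -> : `|- 'i : C| = 1.
    by rewrite normc_def /= oppr0 expr0n /= sqrrN expr1n add0r sqrtr1.
  by rewrite mul1r; exact: hT.
- by move=> x xA; rewrite Hg // mulr_sumr.
Qed.

End Unfold.

(** * Uniform limits with exponents in a pointed cone *)

Section Cone.
Variables (R : realType) (n : nat).
Local Notation C := (R[i]).
Local Notation Zn := {ffun 'I_n -> int}.
Local Notation F := (('I_n -> R) -> C).
Implicit Types (k l : Zn) (x : 'I_n -> R) (S T : seq (C * Zn)) (f g : F) (c d : C).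

(** Pairing with the fundamental weight e_0 + ... + e_j; these functionals cut out the cone spanned
    by the positive roots. *)
Definition psum k (j : 'I_n) : int := \sum_(i < n | (i <= j)%N) k i.

Lemma psumD k l j : psum (k + l) j = psum k j + psum l j.
Proof. by rewrite /psum -big_split; apply: eq_bigr => i _; rewrite ffunE. Qed.

Lemma psumN k j : psum (- k) j = - psum k j.
Proof. by rewrite /psum -sumrN; apply: eq_bigr => i _; rewrite ffunE. Qed.

Lemma psum_eq0 k : (forall j, psum k j = 0) -> k = 0.
Proof.
move=> k0; suff H m (j : 'I_n) : (j < m)%N -> k j = 0.
  by apply/ffunP => j; rewrite ffunE (H n).
elim: m j => // m IH j; rewrite ltnS => jm.
have := k0 j; rewrite /psum (bigD1 j) //= big1 ?addr0 // => i /andP[ij inj].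
by apply: IH; apply: leq_trans jm; rewrite ltn_neqAle inj.
Qed.

(* [k] lies in the dual cone of the dominant chamber. *)
Definition pos k := [forall j, 0 <= psum k j].

Lemma posD k l : pos k -> pos l -> pos (k + l).
Proof.
by move=> /forallP pk /forallP pl; apply/forallP => j; rewrite psumD addr_ge0.
Qed.

Lemma pos0 : pos 0.
Proof. by apply/forallP => j; rewrite /psum big1 // => i _; rewrite ffunE. Qed.

Lemma posMn k m : pos k -> pos (k *+ m).
Proof. by move=> pk; elim: m => [|m IH]; rewrite ?mulr0n ?pos0 // mulrS posD. Qed.

(** The cone is pointed: nonzero exponents cannot cancel. This makes [const_coef] multiplicative on
    it. *)
Lemma pos_addr_eq0 k l : pos k -> pos l -> (k + l == 0) = (k == 0) && (l == 0).
Proof.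
move=> /forallP pk /forallP pl; apply/idP/andP => [/eqP kl0|[/eqP -> /eqP ->]]; last by rewrite addr0.
have H j : psum k j + psum l j = 0.
  by rewrite -psumD kl0 /psum big1 // => i _; rewrite ffunE.
have k0 : k = 0 by apply: psum_eq0 => j; have := H j; have := pk j; have := pl j; lia.
by move: kl0; rewrite k0 add0r => ->.
Qed.

Definition unif f T (e : C) := forall x, `|f x - trig T x| <= e.

(* Among limits with exponents in a pointed cone, taking the constant term is multiplicative. *)
Definition cone f c := forall e : C, 0 < e ->
  exists T, [/\ all (fun p => pos p.2) T, const_coef T = c & unif f T e].

(** Without the cone condition the constant term is still linear but no longer multiplicative. *)
Definition const_lim f c := forall e : C, 0 < e -> exists T, const_coef T = c /\ unif f T e.

Lemma eq_cone f g c : (forall x, f x = g x) -> cone f c -> cone g c.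
Proof. by move=> fg; rewrite (funext fg). Qed.

Lemma cone_cst c : cone (fun=> c) c.
Proof.
move=> e e0; exists [:: (c, 0)]; split => [||x]; first by rewrite /= pos0.
  by rewrite /const_coef big_cons big_nil eqxx addr0.
by rewrite /trig big_seq1 /= chr0 mulr1 subrr normr0 ltW.
Qed.

Lemma cone_lin (a b : C) k : pos k -> k != 0 -> cone (fun x => a + b * chr k x) a.
Proof.
move=> pk k0 e e0; exists [:: (a, 0); (b, k)]; split => [||x]; first by rewrite /= pos0 pk.
  by rewrite /const_coef !big_cons big_nil /= eqxx (negbTE k0) addr0.
by rewrite /trig !big_cons big_nil /= chr0 mulr1 addr0 subrr normr0 ltW.
Qed.

Lemma le_norm_trig T x : `|trig T x| <= \sum_(p <- T) `|p.1|.
Proof.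
apply: le_trans (ler_norm_sum _ _ _) _; apply: ler_sum => p _.
by rewrite normrM norm_chr mulr1.
Qed.

Lemma cone_bounded f c : cone f c -> exists2 M : C, 0 <= M & forall x, `|f x| <= M.
Proof.
move=> /(_ 1 ltr01)[T [_ _ fT]]; exists (1 + \sum_(p <- T) `|p.1|).
  by rewrite addr_ge0 // sumr_ge0.
move=> x; rewrite -(subrK (trig T x) (f x)); apply: le_trans (ler_normD _ _) _.
by apply: lerD; [exact: fT|exact: le_norm_trig].
Qed.

Lemma const_coef_trigM S T : all (fun p => pos p.2) S -> all (fun p => pos p.2) T ->
  const_coef (trigM S T) = const_coef S * const_coef T.
Proof.
move=> pS pT; rewrite [const_coef S]/const_coef [const_coef T]/const_coef [const_coef _]big_mkcond /trigM
  big_allpairs_dep /=.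
rewrite [X in X * _]big_mkcond [X in _ * X]big_mkcond mulr_suml.
apply: eq_big_seq => p pS'; rewrite mulr_sumr.
apply: eq_big_seq => q qT /=.
rewrite pos_addr_eq0; [|exact: (allP pS)|exact: (allP pT)].
by case: (p.2 == 0); case: (q.2 == 0); rewrite /= ?mul0r ?mulr0.
Qed.

Lemma cone_mul f g c d : cone f c -> cone g d -> cone (fun x => f x * g x) (c * d).
Proof.
move=> cf cg e e0; have [M M0 fM] := cone_bounded cf.
have M1 : 0 < M + 1 by rewrite ltr_wpDl.
have [|T [pT cT gT]] := cg (e / 2 / (M + 1)); first by rewrite !divr_gt0.
set N := \sum_(p <- T) `|p.1|.
have N0 : 0 <= N by rewrite sumr_ge0.
have N1 : 0 < N + 1 by rewrite ltr_wpDl.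
(* [S] comes after [T]: its precision depends on the coefficients of [T], while that of [T] depends
   only on the bound [M] of [f]. *)
have [|S [pS cS fS]] := cf (e / 2 / (N + 1)); first by rewrite !divr_gt0.
exists (trigM S T); split.
- apply/allP => _ /allpairsP[[p q] /= [pS' qT ->]] /=.
  by apply: posD; [exact: (allP pS)|exact: (allP pT)].
- by rewrite const_coef_trigM // cS cT.
- move=> x; rewrite trig_mul.
  have -> : f x * g x - trig S x * trig T x = f x * (g x - trig T x) + (f x - trig S x) * trig T x by ring.
  apply: le_trans (ler_normD _ _) _; rewrite !normrM.
  rewrite [leRHS](splitr e); apply: lerD.
    rewrite -[e / 2](divfK (lt0r_neq0 M1)) mulrC ler_pM //.
    by apply: le_trans (fM x) _; rewrite lerDl.
  rewrite -[e / 2](divfK (lt0r_neq0 N1)) ler_pM //.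
  by apply: le_trans (le_norm_trig _ _) _; rewrite lerDl.
Qed.

Lemma cone_prod (I : Type) (r : seq I) (P : pred I) (f : I -> F) (c : I -> C) :
  (forall i, P i -> cone (f i) (c i)) ->
  cone (fun x => \prod_(i <- r | P i) f i x) (\prod_(i <- r | P i) c i).
Proof.
move=> cf; elim: r => [|i r IH].
  by rewrite big_nil; under eq_fun do rewrite big_nil; exact: cone_cst.
rewrite big_cons; under eq_fun do rewrite big_cons.
by case: ifPn => // Pi; apply: cone_mul; [exact: cf|].
Qed.

Lemma one_sub_mul_ei_neq0 (q t : R) : `|q| < 1 -> 1 - q%:C * ei t != 0.
Proof.
move=> q1; rewrite subr_eq0; apply: contraTneq q1 => /(congr1 Num.norm).
rewrite normr1 normrM norm_ei mulr1 normc_def /= expr0n /= addr0 sqrtr_sqr => /complexI <-.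
by rewrite ltxx.
Qed.

Lemma geometric_small (q e : R) : `|q| < 1 -> 0 < e -> exists N, `|q| ^+ N.+1 <= e.
Proof.
move=> q1 e0; have := @cvg_geometric R 1 `|q|.
rewrite normr_id => /(_ q1) /cvgrPdist_le/(_ _ e0)[N _ HN]; exists N.
have := HN N.+1 (leqnSn N); rewrite /= sub0r normrN mul1r.
by apply: le_trans; exact: ler_norm.
Qed.

Lemma norm_realC (q : R) : `|q%:C| = `|q|%:C.
Proof. by rewrite normc_def /= expr0n /= addr0 sqrtr_sqr. Qed.

(** Truncated geometric series; among the exponents l k only l = 0 gives 0, so every truncation has
    constant term 1. *)
Lemma cone_geo (q : R) k : `|q| < 1 -> pos k -> k != 0 ->
  cone (fun x => (1 - q%:C * chr k x)^-1) 1.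
Proof.
move=> q1 pk k0 [e e']; rewrite ltcE /= => /andP[/eqP -> e0].
have q2 : 0 < 1 - `|q| by rewrite subr_gt0.
have [|N hN] := @geometric_small q (e * (1 - `|q|)) q1; first by rewrite mulr_gt0.
exists [seq (q%:C ^+ l, k *+ l) | l : nat <- iota 0 N.+1]; split => [||x].
- by apply/allP => _ /mapP[l _ ->] /=; exact: posMn.
- rewrite /const_coef big_map -[iota 0 N.+1]/(index_iota 0 N.+1) big_mkcond big_mkord big_ord_recl /=.
  rewrite mulr0n eqxx expr0 big1 ?addr0 // => l _.
  rewrite ifF //; apply/negbTE; apply: contra k0 => /eqP/ffunP kl.
  apply/eqP/ffunP => j; have := kl j; rewrite !ffunE /= ffunMnE => /eqP.
  by rewrite mulrn_eq0 /= => /eqP.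
- set z := q%:C * chr k x.
  have -> : trig [seq (q%:C ^+ l, k *+ l) | l : nat <- iota 0 N.+1] x = \sum_(l < N.+1) z ^+ l.
    rewrite /trig big_map -[iota 0 N.+1]/(index_iota 0 N.+1) big_mkord.
    by apply: eq_bigr => l _; rewrite /= chrX exprMn.
  have z1 : 1 - z != 0 by exact: one_sub_mul_ei_neq0.
  have -> : (1 - z)^-1 - \sum_(l < N.+1) z ^+ l = z ^+ N.+1 / (1 - z).
    have := subrX1 z N.+1; set S := \sum_(_ < _) _ => HS.
    have -> : z ^+ N.+1 = 1 - (1 - z) * S by rewrite -[LHS](subrK 1) HS; ring.
    by rewrite mulrBl mul1r mulrAC divff // mul1r.
  rewrite normrM normfV normrX.
  have -> : `|z| = `|q|%:C by rewrite normrM norm_chr mulr1 norm_realC.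
  have hz : (1 - `|q|)%:C <= `|1 - z|.
    have -> : (1 - `|q|)%:C = `|1 : C| - `|z|.
      by rewrite normr1 /z normrM norm_chr mulr1 norm_realC rmorphB.
    exact: lerB_dist.
  have hz0 : 0 < `|1 - z| by rewrite normr_gt0.
  rewrite ler_pdivrMr //; apply: le_trans (_ : e%:C * (1 - `|q|)%:C <= _).
    by rewrite -rmorphM -rmorphXn lecR.
  by apply: ler_wpM2l => //; rewrite ler0c ltW.
Qed.

(** Every exponent becomes [k + p] with [p] in the cone, and its [j]-th partial sum stays positive,
    so 0 is never reached. The exponents may leave the cone, hence [const_lim]. *)
Lemma cone_chr_lim f c k (j : 'I_n) : cone f c -> 0 < psum k j ->
  const_lim (fun x => chr k x * f x) 0.
Proof.
move=> cf kj e /cf[T [pT _ fT]]; exists (trigM [:: (1, k)] T); split.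
  rewrite /const_coef /trigM big_mkcond big_allpairs_dep big_seq1 -big_mkcond /= big_seq_cond big1 // => p
    /andP[pTp /= /eqP/(congr1 (psum^~ j))].
  rewrite psumD; have /allP/(_ _ pTp)/forallP/(_ j) /= := pT.
  have -> : psum 0 j = 0 by rewrite /psum big1 // => i _; rewrite ffunE.
  lia.
move=> x; rewrite trig_mul /trig big_seq1 /= mul1r -mulrBr normrM norm_chr mul1r.
exact: fT.
Qed.

Lemma cone_lim f c : cone f c -> const_lim f c.
Proof. by move=> cf e /cf[T [_ ? ?]]; exists T. Qed.

Lemma const_lim0 : const_lim (fun=> 0) 0.
Proof. exact: cone_lim (cone_cst 0). Qed.

Lemma const_limD f g c d : const_lim f c -> const_lim g d -> const_lim (fun x => f x + g x) (c + d).
Proof.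
move=> lf lg e e0; have e2 : 0 < e / 2 by rewrite divr_gt0.
have [S [cS fS]] := lf _ e2; have [T [cT gT]] := lg _ e2.
exists (S ++ T); split => [|x]; first by rewrite const_coef_cat cS cT.
rewrite trig_cat opprD addrACA; apply: le_trans (ler_normD _ _) _.
by rewrite [leRHS]splitr; apply: lerD; [exact: fS|exact: gT].
Qed.

Lemma const_limZ f c a : const_lim f c -> const_lim (fun x => a * f x) (a * c).
Proof.
move=> lf e e0.
have a0 : 0 < `|a| + 1 by rewrite ltr_wpDl.
have [|T [cT fT]] := lf (e / (`|a| + 1)); first by rewrite divr_gt0.
exists [seq (a * p.1, p.2) | p <- T]; split => [|x].
  by rewrite -cT /const_coef big_map mulr_sumr.
have -> : trig [seq (a * p.1, p.2) | p <- T] x = a * trig T x.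
  by rewrite /trig big_map mulr_sumr; apply: eq_bigr => p _; rewrite mulrA.
rewrite -mulrBr normrM; apply: le_trans (_ : (`|a| + 1) * (e / (`|a| + 1)) <= _).
  by apply: ler_pM => //; rewrite ?lerDl //; exact: fT.
by rewrite mulrC divfK ?lt0r_neq0.
Qed.

Lemma const_lim_sum (I : Type) (r : seq I) (f : I -> F) (c : I -> C) :
  (forall i, const_lim (f i) (c i)) ->
  const_lim (fun x => \sum_(i <- r) f i x) (\sum_(i <- r) c i).
Proof.
move=> cf; elim: r => [|i r IH].
  by rewrite big_nil; under eq_fun do rewrite big_nil; exact: const_lim0.
by rewrite big_cons; under eq_fun do rewrite big_cons; exact: const_limD.
Qed.

End Cone.

(** [s] permutes the unordered pairs; a pair is met in reversed order exactly when [s^-1] inverts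
    it. *)
Lemma prod_pairs_perm (A : comPzSemiRingType) n (s : 'S_n) (F : 'I_n -> 'I_n -> A) :
  \prod_(j < n) \prod_(k < n | (j < k)%N) F (s j) (s k) =
  \prod_(a < n) \prod_(b < n | (a < b)%N)
    (if ((s^-1)%g a < (s^-1)%g b)%N then F a b else F b a).
Proof.
rewrite !pair_big_dep /=.
pose h (p : 'I_n * 'I_n) := ((s^-1)%g p.1, (s^-1)%g p.2).
have hi : injective h by move=> [a b] [c d] [/perm_inj <- /perm_inj <-].
rewrite (reindex_inj hi) /=.
under eq_bigr do rewrite !permKV.
rewrite (bigID (fun p : 'I_n * 'I_n => (p.1 < p.2)%N)) /=.
rewrite [RHS](bigID (fun p : 'I_n * 'I_n => ((s^-1)%g p.1 < (s^-1)%g p.2)%N)) /=.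
congr (_ * _).
  by apply: eq_big => [p|p /andP[-> _] //]; rewrite andbC.
have si : injective (fun p : 'I_n * 'I_n => (p.2, p.1)) by move=> [a b] [c d] [-> ->].
rewrite (reindex_inj si) /=; apply: eq_big => [[a b]|[a b]] /=.
  have [->|ab] := eqVneq a b; first by rewrite !ltnn.
  have ab' : (s^-1)%g a != (s^-1)%g b by rewrite (inj_eq perm_inj).
  by move: ab ab'; rewrite -!val_eqE /=; lia.
by move=> /andP[/ltnW]; rewrite leqNgt => /negbTE ->.
Qed.

(** * The c-function and orthogonality *)

Section CFunction.
Variables (R : realType) (n : nat) (q q0 : R).
Hypotheses (hq : `|q| < 1) (hq0 : `|q0| < 1).
Local Notation C := (R[i]).
Local Notation Zn := {ffun 'I_n -> int}.
Local Notation W := ('S_n * {ffun 'I_n -> bool})%type.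
Local Notation F := (('I_n -> R) -> C).
Implicit Types (k l : Zn) (x : 'I_n -> R) (w u : W).

(* Factors of [Cb] for the long and the short roots. [r_long] and [r_short] below are the ratios
   c(t) / c(-t). *)
Definition c_long (t : R) : C := (1 - q%:C * ei (- t)) / (1 - ei (- t)).
Definition c_short (t : R) : C := (1 - q0%:C * ei (- t)) / (1 - ei (- (2 * t))).

Lemma CbE x : Cb q q0 x = (\prod_j c_short (x j)) *
  \prod_(j < n) \prod_(k < n | (j < k)%N) (c_long (x j - x k) * c_long (x j + x k)).
Proof. by []. Qed.

(* The complement of the reflection hyperplanes, where no denominator of [Cb] vanishes. *)
Definition reg x : Prop := (forall j : 'I_n, ei (2 * x j) != 1) /\
  (forall j k : 'I_n, j != k -> ei (x j - x k) != 1 /\ ei (x j + x k) != 1).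

Lemma ei_eq1N (t : R) : (ei (- t) == 1) = (ei t == 1).
Proof. by rewrite eiN invr_eq1. Qed.

Lemma reg_wact w x : reg x -> reg (wact w x).
Proof.
case: w => s e [h1 h2]; split=> [j|j k jk]; rewrite /wact /sgn /=.
  by case: (e j); rewrite ?expr1 ?expr0 ?mulN1r ?mul1r ?mulrN ?ei_eq1N.
have [|h3 h4] := h2 (s j) (s k); first by rewrite (inj_eq perm_inj).
case: (e j); case: (e k); rewrite ?expr1 ?expr0 ?mulN1r ?mul1r ?opprK.
- have -> : - x (s j) + x (s k) = - (x (s j) - x (s k)) by rewrite opprB addrC.
  have -> : - x (s j) - x (s k) = - (x (s j) + x (s k)) by rewrite opprD.
  by rewrite !ei_eq1N.
- have -> : - x (s j) + x (s k) = - (x (s j) - x (s k)) by rewrite opprB addrC.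
  have -> : - x (s j) - x (s k) = - (x (s j) + x (s k)) by rewrite opprD.
  by rewrite !ei_eq1N.
- by split.
- by split.
Qed.

Lemma reg_opp x : reg x -> reg (fun j => - x j).
Proof. by move=> rx; rewrite -wact0; exact: reg_wact. Qed.

Lemma ei_neq1 (t : R) : 0 < t < 2 * pi -> ei t != 1.
Proof.
clear hq hq0.
move=> /andP[t0 t2]; rewrite eq_complex /= negb_and; apply/orP; left.
have -> : t = (t / 2) *+ 2 by rewrite mulr2n -splitr.
rewrite cos_mulr2n cos2sin2; apply/eqP => h.
have : 0 < sin (t / 2).
  by apply: sin_gt0_pi; rewrite divr_gt0 //= ltr_pdivrMr // mulrC.
move: h; set y := sin _ => h y0; have : 0 < y ^+ 2 by rewrite exprn_gt0.
rewrite mulr2n in h; lra.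
Qed.

Lemma in_Ab_bounds x : in_Ab x -> (forall j, 0 < x j < pi) /\
  (forall j k : 'I_n, (j < k)%N -> x k < x j).
Proof.
clear hq hq0.
move=> [h1 [h2 h3]].
have dec (j k : 'I_n) : (j < k)%N -> x k < x j.
  move jk : (k - j)%N => d; elim: d j k jk => [|d IH] j k jk lt_jk; first by lia.
  have hj1 : (j.+1 < n)%N by apply: leq_ltn_trans (ltn_ord k).
  have [d0|d0] := posnP d; first by apply: h2; lia.
  apply: lt_trans (h2 j (Ordinal hj1) erefl); apply: IH => /=; lia.
split=> // j; apply/andP; split.
  have hl : (n.-1 < n)%N by rewrite prednK // (leq_ltn_trans _ (ltn_ord j)).
  have [jl|jl] := ltnP j n.-1; last by apply: h3; have := ltn_ord j; lia.
  by apply: lt_trans (dec j (Ordinal hl) jl); apply: h3.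
have hz : (0 < n)%N by rewrite (leq_ltn_trans _ (ltn_ord j)).
have [j0|j0] := posnP j; first exact: h1.
by apply: lt_trans (dec (Ordinal hz) j j0) _; apply: h1.
Qed.

Lemma in_Ab_reg x : in_Ab x -> reg x.
Proof.
clear hq hq0.
move=> /in_Ab_bounds[hb hd].
have dif (j k : 'I_n) : (j < k)%N -> ei (x j - x k) != 1.
  move=> jk; apply: ei_neq1.
  have := hd _ _ jk; have := hb j; have := hb k; have := pi_gt0 R.
  by move=> ? /andP[? ?] /andP[? ?] ?; apply/andP; split; lra.
split=> [j|j k jk].
  by apply: ei_neq1; have /andP[? ?] := hb j; apply/andP; split; lra.
split; last first.
  apply: ei_neq1; have /andP[? ?] := hb j; have /andP[? ?] := hb k.
  by apply/andP; split; lra.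
have [|kj|/val_inj jk'] := ltngtP j k; first exact: dif.
  by rewrite -opprB ei_eq1N dif.
by rewrite jk' eqxx in jk.
Qed.

Lemma one_sub_ei_neq0 (t : R) : ei t != 1 -> 1 - ei t != 0.
Proof. by rewrite subr_eq0 eq_sym. Qed.

Definition r_long (t : R) : C := (q%:C - ei t) / (1 - q%:C * ei t).
Definition r_short (t : R) : C := - ei t * (ei t - q0%:C) / (1 - q0%:C * ei t).

Lemma c_long_r_long (t : R) : ei t != 1 -> c_long t = r_long t * c_long (- t).
Proof.
move=> t1; have e0 := ei_neq0 t; have h1 := one_sub_ei_neq0 t1.
have h2 := one_sub_mul_ei_neq0 t hq.
rewrite /c_long /r_long opprK eiN; field.
by rewrite e0 h1 h2 -oppr_eq0 opprB h1.
Qed.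

Lemma c_short_r_short (t : R) : ei (2 * t) != 1 -> c_short t = r_short t * c_short (- t).
Proof.
rewrite mulr_natl mulr2n eiD => t1; have e0 := ei_neq0 t.
have h1 : 1 - ei t * ei t != 0 by rewrite subr_eq0 eq_sym.
have h2 := one_sub_mul_ei_neq0 t hq0.
rewrite /c_short /r_short mulrN !opprK eiN !mulr_natl !mulr2n [ei (- _)]eiN !eiD; field.
by rewrite e0 h1 h2 -oppr_eq0 opprB h1.
Qed.

Lemma c_long_neq0 (t : R) : ei t != 1 -> c_long t != 0.
Proof.
move=> t1; rewrite mulf_neq0 ?one_sub_mul_ei_neq0 // invr_eq0 one_sub_ei_neq0 //.
by rewrite ei_eq1N.
Qed.

Lemma c_short_neq0 (t : R) : ei (2 * t) != 1 -> c_short t != 0.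
Proof.
move=> t1; rewrite mulf_neq0 ?one_sub_mul_ei_neq0 // invr_eq0 one_sub_ei_neq0 //.
by rewrite ei_eq1N.
Qed.

Lemma Cb_neq0 x : reg x -> Cb q q0 x != 0.
Proof.
move=> [h1 h2]; rewrite CbE mulf_neq0 //; first by apply/prodf_neq0 => j _; exact: c_short_neq0.
apply/prodf_neq0 => j _; apply/prodf_neq0 => k jk.
have [|h3 h4] := h2 j k; first by apply: contraTneq jk => ->; rewrite ltnn.
by rewrite mulf_neq0 ?c_long_neq0.
Qed.

Definition opp x : 'I_n -> R := fun j => - x j.

Definition cconj (z : C) : C := conjc z.

Lemma cconjM a b : cconj (a * b) = cconj a * cconj b. Proof. by rewrite /cconj rmorphM. Qed.
Lemma cconjV a : cconj (a^-1) = (cconj a)^-1. Proof. by rewrite /cconj fmorphV. Qed.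
Lemma cconj1_sub (a t : R) : cconj (1 - a%:C * ei t) = 1 - a%:C * ei (- t).
Proof.
by apply/eqP; rewrite eq_complex /= cosN sinN; apply/andP; split; apply/eqP; ring.
Qed.
Lemma cconj_prod (I : Type) (r : seq I) (P : pred I) (f : I -> C) :
  cconj (\prod_(i <- r | P i) f i) = \prod_(i <- r | P i) cconj (f i).
Proof. by rewrite /cconj rmorph_prod. Qed.

Lemma Cb_conj x : cconj (Cb q q0 x) = Cb q q0 (opp x).
Proof.
have c2 (t : R) : cconj (1 - ei t) = 1 - ei (- t) by have := cconj1_sub 1 t; rewrite !mul1r.
have ccl t : cconj (c_long t) = c_long (- t) by rewrite /c_long cconjM cconjV cconj1_sub c2.
have ccs t : cconj (c_short t) = c_short (- t) by rewrite /c_short cconjM cconjV cconj1_sub c2 mulrN.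
rewrite !CbE cconjM !cconj_prod; congr (_ * _); first by apply: eq_bigr => j _; exact: ccs.
apply: eq_bigr => j _; rewrite cconj_prod; apply: eq_bigr => k _.
rewrite cconjM !ccl /opp; congr (c_long _ * c_long _); first by rewrite opprB opprK addrC.
by rewrite opprD.
Qed.

Definition C_sq x := Cb q q0 x * Cb q q0 (opp x).

Lemma C_sq_sqnorm x : C_sq x = (sqnorm (Cb q q0 x))%:C.
Proof. by rewrite /C_sq -Cb_conj /sqnorm add_Re2_Im2 sqr_normc. Qed.

Definition c_pair (a b : R) := c_long (a - b) * c_long (a + b).
Definition c_pair_sq (a b : R) := c_pair a b * c_pair (- a) (- b).

Lemma C_sqE x : C_sq x = (\prod_j (c_short (x j) * c_short (- x j))) *
  \prod_(j < n) \prod_(k < n | (j < k)%N) c_pair_sq (x j) (x k).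
Proof.
rewrite /C_sq !CbE mulrACA; congr (_ * _); first by rewrite -big_split.
rewrite -big_split; by apply: eq_bigr => j _; rewrite -big_split.
Qed.

(** Changing the sign of the second argument only swaps the two factors, so only the first sign
    matters. *)
Lemma c_pair_sgn (b b' : bool) (s t : R) : c_pair (sgn R b * s) (sgn R b' * t) =
  if b then c_pair (- s) (- t) else c_pair s t.
Proof.
by rewrite /c_pair /sgn; case: b; case: b'; rewrite ?expr1 ?expr0 ?mulN1r ?mul1r ?opprK // mulrC.
Qed.

Lemma c_pair_sq_sgn (b b' : bool) (s t : R) : c_pair_sq (sgn R b * s) (sgn R b' * t) = c_pair_sq s t.
Proof.
rewrite /c_pair_sq -!mulrN !c_pair_sgn; case: b; last by [].
by rewrite !opprK mulrC.
Qed.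

Lemma KKC (s t : R) : c_pair_sq s t = c_pair_sq t s.
Proof.
rewrite /c_pair_sq /c_pair !opprK.
have -> : - s + t = t - s by rewrite addrC.
have -> : - t + s = s - t by rewrite addrC.
have -> : - s - t = - t - s by rewrite addrC.
by rewrite [t + s]addrC; ring.
Qed.

(** The vector [wact w x] indexed by the coordinates of [x] instead of its own, the form in which
    [prod_pairs_perm] applies. *)
Definition wact_inv w x : 'I_n -> R := fun a => sgn R (w.2 ((w.1^-1)%g a)) * x a.

Lemma wactE w x j : wact w x j = wact_inv w x (w.1 j).
Proof. by rewrite /wact /wact_inv permK. Qed.

(** [C_sq] runs over all roots, each together with its negative, and W permutes these pairs. *)
Lemma C_sq_wact w x : C_sq (wact w x) = C_sq x.
Proof.
rewrite !C_sqE; congr (_ * _).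
  rewrite [RHS](reindex_inj (@perm_inj _ w.1)); apply: eq_bigr => j _.
  rewrite /wact /sgn; case: (w.2 j); last by rewrite expr0 mul1r.
  by rewrite expr1 mulN1r opprK mulrC.
transitivity (\prod_(j < n) \prod_(k < n | (j < k)%N)
    (fun a b => c_pair_sq (wact_inv w x a) (wact_inv w x b)) (w.1 j) (w.1 k)).
  by apply: eq_bigr => j _; apply: eq_bigr => k _; rewrite !wactE.
rewrite (prod_pairs_perm _ (fun a b => c_pair_sq (wact_inv w x a) (wact_inv w x b))).
apply: eq_bigr => a _; apply: eq_bigr => b _.
by rewrite /wact_inv !c_pair_sq_sgn [c_pair_sq (x b) _]KKC if_same.
Qed.

Lemma C_sq_neq0 x : reg x -> C_sq x != 0.
Proof. by move=> rx; rewrite mulf_neq0 ?Cb_neq0 //; exact: reg_opp. Qed.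

Definition shortr w x (a : 'I_n) : C := if w.2 ((w.1^-1)%g a) then 1 else r_short (x a).
Definition longr w x (a b : 'I_n) : C :=
  if ((w.1^-1)%g a < (w.1^-1)%g b)%N then
    (if w.2 ((w.1^-1)%g a) then 1 else r_long (x a - x b) * r_long (x a + x b))
  else (if w.2 ((w.1^-1)%g b) then r_long (x a - x b) else r_long (x a + x b)).

Definition C_ratio w x : C := (\prod_a shortr w x a) *
  \prod_(a < n) \prod_(b < n | (a < b)%N) longr w x a b.

(** C(wx) and C(-x) have one factor for each root up to sign. Where the signs agree the factors
    cancel; elsewhere the quotient is c(t) / c(-t) at a positive root. Comparing with -x rather than
    x makes these quotients expand in positive exponents. *)
Lemma Cb_ratio w x : reg x -> Cb q q0 (wact w x) = C_ratio w x * Cb q q0 (opp x).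
Proof.
move=> [h1 h2]; rewrite !CbE /C_ratio mulrACA; congr (_ * _).
  rewrite -big_split [RHS](reindex_inj (@perm_inj _ w.1)); apply: eq_bigr => j _.
  rewrite /shortr /wact permK /sgn /opp /=; case: (w.2 j).
    by rewrite expr1 mulN1r mul1r.
  by rewrite expr0 mul1r -c_short_r_short.
rewrite -big_split.
transitivity (\prod_(j < n) \prod_(k < n | (j < k)%N)
    (fun a b => c_pair (wact_inv w x a) (wact_inv w x b)) (w.1 j) (w.1 k)).
  by apply: eq_bigr => j _; apply: eq_bigr => k _; rewrite !wactE.
rewrite (prod_pairs_perm _ (fun a b => c_pair (wact_inv w x a) (wact_inv w x b))).
apply: eq_bigr => a _; rewrite -big_split; apply: eq_bigr => b ab.
have [|h3 h4] := h2 a b; first by apply: contraTneq ab => ->; rewrite ltnn.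
have -> : c_long (opp x a - opp x b) * c_long (opp x a + opp x b) = c_long (- (x a - x b)) * c_long (- (x a + x b)).
  by rewrite /opp; congr (c_long _ * c_long _); rewrite ?opprD // opprK.
rewrite /wact_inv /longr !c_pair_sgn /=; case: ifP => _; case: ifP => _.
- by rewrite /= mul1r /c_pair; congr (c_long _ * c_long _); rewrite ?opprD // opprK.
- by rewrite mulrACA -!c_long_r_long.
- rewrite /= mulrA -c_long_r_long // /c_pair; congr (c_long _ * c_long _); first by rewrite opprK addrC.
  by rewrite opprD addrC.
- rewrite /= mulrCA -c_long_r_long // /c_pair; congr (c_long _ * c_long _); first by rewrite opprB.
  by rewrite addrC.
Qed.

End CFunction.

(** * Means against 1 / |C|^2 *)

Section Functional.
Variables (R : realType) (n : nat) (q q0 : R).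
Hypotheses (hq : `|q| < 1) (hq0 : `|q0| < 1).
Local Notation C := (R[i]).
Local Notation Zn := {ffun 'I_n -> int}.
Local Notation W := ('S_n * {ffun 'I_n -> bool})%type.
Local Notation F := (('I_n -> R) -> C).
Implicit Types (k l : Zn) (x : 'I_n -> R) (w u : W) (f g : F).

Definition unit_wt (a : 'I_n) : Zn := [ffun j => (j == a)%:R].

Lemma chr_unit_wt a x : chr (unit_wt a) x = ei (x a).
Proof.
rewrite /chr (bigD1 a) //= big1 ?addr0 => [|j /negbTE ja]; rewrite ffunE ?ja ?mul0r //.
by rewrite eqxx mul1r.
Qed.

Lemma psum_unit_wt a j : psum (unit_wt a) j = (a <= j)%N%:R.
Proof.
rewrite /psum; case: leqP => aj.
  rewrite (bigD1 a) //= big1 ?addr0 => [|i /andP[_ /negbTE ia]]; rewrite ffunE ?ia //.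
  by rewrite eqxx.
rewrite big1 // => i ij; rewrite ffunE; case: eqP => // ia.
by move: aj; rewrite -ia ltnNge ij.
Qed.

Lemma pos_unit_wt a : pos (unit_wt a).
Proof. by apply/forallP => j; rewrite psum_unit_wt. Qed.

Lemma pos_unit_wtB (a b : 'I_n) : (a < b)%N -> pos (unit_wt a - unit_wt b).
Proof.
move=> ab; apply/forallP => j; rewrite psumD psumN !psum_unit_wt subr_ge0.
by case: (leqP b j) => // bj; rewrite (leq_trans (ltnW ab) bj).
Qed.

Lemma unit_wt_neq0 a : unit_wt a != 0.
Proof. by apply/eqP => /ffunP/(_ a); rewrite !ffunE eqxx. Qed.

Lemma unit_wtB_neq0 (a b : 'I_n) : (a < b)%N -> unit_wt a - unit_wt b != 0.
Proof.
move=> ab; apply/eqP => /ffunP/(_ a); rewrite !ffunE eqxx.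
by case: eqP => // h; move: ab; rewrite h ltnn.
Qed.

Lemma unit_wtD_neq0 a b : unit_wt a + unit_wt b != 0.
Proof. by rewrite pos_addr_eq0 ?pos_unit_wt // (negbTE (unit_wt_neq0 a)). Qed.

Lemma chr_unit_wtB a b x : chr (unit_wt a - unit_wt b) x = ei (x a - x b).
Proof. by rewrite chrD chrN !chr_unit_wt eiD eiN. Qed.

Lemma chr_unit_wtD a b x : chr (unit_wt a + unit_wt b) x = ei (x a + x b).
Proof. by rewrite chrD !chr_unit_wt eiD. Qed.

Lemma cone_r_long k (t : ('I_n -> R) -> R) : pos k -> k != 0 -> (forall x, chr k x = ei (t x)) ->
  cone (fun x => r_long q (t x)) q%:C.
Proof.
move=> pk k0 kt; rewrite -[q%:C]mulr1.
apply: (@eq_cone _ _ (fun x => (q%:C + (-1) * chr k x) * (1 - q%:C * chr k x)^-1)).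
  by move=> x; rewrite kt mulN1r.
by apply: cone_mul; [exact: cone_lin|exact: cone_geo].
Qed.

Lemma cone_clinv k (t : ('I_n -> R) -> R) : pos k -> k != 0 -> (forall x, chr k x = ei (t x)) ->
  cone (fun x => (1 - ei (t x)) / (1 - q%:C * ei (t x))) 1.
Proof.
move=> pk k0 kt; have := cone_mul (cone_lin 1 (-1) pk k0) (cone_geo hq pk k0); rewrite mulr1.
by apply: eq_cone => x; rewrite kt mulN1r.
Qed.

Definition ratio_lim w : C := (\prod_a (if w.2 ((w.1^-1)%g a) then 1 else 0)) *
  \prod_(a < n) \prod_(b < n | (a < b)%N)
  if ((w.1^-1)%g a < (w.1^-1)%g b)%N then
    (if w.2 ((w.1^-1)%g a) then 1 else q%:C * q%:C) else q%:C.

(** At e^(it) = 0 the quotient [r_long] equals q, while [r_short] has a factor e^(it); so the limit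
    vanishes unless [w] flips every sign. *)
Lemma cone_C_ratio w : cone (C_ratio q q0 w) (ratio_lim w).
Proof.
apply: cone_mul; apply: cone_prod => a _.
  rewrite /shortr; case: ifP => _; first exact: cone_cst.
  rewrite -[0](mul0r (- q0%:C)) -[_ * _](mulr1).
  apply: (@eq_cone _ _ (fun x => (0 + (-1) * chr (unit_wt a) x) * (- q0%:C + 1 * chr (unit_wt a) x) *
    (1 - q0%:C * chr (unit_wt a) x)^-1)).
    by move=> x; rewrite chr_unit_wt add0r mulN1r mul1r [- q0%:C + _]addrC.
  apply: cone_mul; last by apply: cone_geo; rewrite ?pos_unit_wt ?unit_wt_neq0.
  by apply: cone_mul; apply: cone_lin; rewrite ?pos_unit_wt ?unit_wt_neq0.
apply: cone_prod => b ab.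
have cB : cone (fun x => r_long q (x a - x b)) q%:C.
  by apply: (cone_r_long (pos_unit_wtB ab) (unit_wtB_neq0 ab)) => x; rewrite chr_unit_wtB.
have cD : cone (fun x => r_long q (x a + x b)) q%:C.
  apply: (cone_r_long (k := unit_wt a + unit_wt b)); [|exact: unit_wtD_neq0|by move=> x; rewrite chr_unit_wtD].
  by rewrite posD ?pos_unit_wt.
rewrite /longr; case: (ltnP ((w.1^-1)%g a) _) => _; last first.
  by case: (w.2 ((w.1^-1)%g b)).
by case: (w.2 ((w.1^-1)%g a)); [exact: cone_cst|exact: cone_mul].
Qed.

(** The reciprocal of C(-x), inverted factor by factor: it has no poles at real points, so its
    expansion holds everywhere and not only on [reg]. *)
Definition C_opp_inv x : C :=
  (\prod_j ((1 - ei (2 * x j)) / (1 - q0%:C * ei (x j)))) *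
  \prod_(a < n) \prod_(b < n | (a < b)%N)
    (((1 - ei (x a - x b)) / (1 - q%:C * ei (x a - x b))) *
     ((1 - ei (x a + x b)) / (1 - q%:C * ei (x a + x b)))).

Lemma cone_C_opp_inv : cone C_opp_inv 1.
Proof.
have -> : 1 = (\prod_(j < n) 1) * \prod_(a < n) \prod_(b < n | (a < b)%N) (1 * 1) :> C.
  by rewrite big1 // mul1r big1 // => a _; rewrite big1 // => b _; rewrite mul1r.
apply: cone_mul; apply: cone_prod => a _.
  have pD : pos (unit_wt a + unit_wt a) by rewrite posD ?pos_unit_wt.
  have := cone_mul (cone_lin 1 (-1) pD (unit_wtD_neq0 a a)) (cone_geo hq0 (pos_unit_wt a) (unit_wt_neq0 a)).
  rewrite mulr1; apply: eq_cone => x.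
  by rewrite chr_unit_wtD chr_unit_wt mulN1r mulr_natl mulr2n.
apply: cone_prod => b ab; apply: cone_mul.
  by apply: (cone_clinv (pos_unit_wtB ab) (unit_wtB_neq0 ab)) => x; rewrite chr_unit_wtB.
apply: (cone_clinv (k := unit_wt a + unit_wt b)); [|exact: unit_wtD_neq0|by move=> x; rewrite chr_unit_wtD].
by rewrite posD ?pos_unit_wt.
Qed.

Lemma C_opp_inv_mul x : reg x -> C_opp_inv x * Cb q q0 (opp x) = 1.
Proof.
move=> [h1 h2]; rewrite CbE /C_opp_inv mulrACA.
have clK (t : R) : ei t != 1 -> (1 - ei t) / (1 - q%:C * ei t) * c_long q (- t) = 1.
  move=> t1; rewrite /c_long opprK mulrC mulf_div [X in X / _]mulrC divff //.
  by rewrite mulf_neq0 ?one_sub_ei_neq0 ?one_sub_mul_ei_neq0.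
rewrite -big_split big1 ?mul1r => [|j _]; last first.
  rewrite /= /c_short /opp mulrN !opprK mulrC mulf_div [X in X / _]mulrC divff //.
  by rewrite mulf_neq0 ?one_sub_ei_neq0 ?one_sub_mul_ei_neq0.
rewrite -big_split big1 // => a _; rewrite -big_split big1 // => b ab /=.
have [|h3 h4] := h2 a b; first by apply: contraTneq ab => ->; rewrite ltnn.
have -> : c_long q (opp x a - opp x b) = c_long q (- (x a - x b)) by rewrite /opp opprD opprK.
have -> : c_long q (opp x a + opp x b) = c_long q (- (x a + x b)) by rewrite /opp opprD.
by rewrite mulrACA !clK // mulr1.
Qed.

(* [c] is the mean (2 pi)^-n \int f / |Cb|^2 over the alcove, see [has_mean_int]; the unfolding over W is
   part of the definition so that constant terms suffice. *)
Definition has_mean f (c : C) := exists2 g, const_lim g c &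
  forall x, reg x -> f x / C_sq q q0 x = \sum_w g (wact w x).

Lemma has_mean_ext f f' c : (forall x, reg x -> f x = f' x) -> has_mean f c -> has_mean f' c.
Proof. by move=> ff [g lg gE]; exists g => // x rx; rewrite -ff // gE. Qed.

Lemma has_mean0 : has_mean (fun=> 0) 0.
Proof.
by exists (fun=> 0) => [|x _]; [exact: const_lim0|rewrite mul0r big1].
Qed.

Lemma has_meanD f f' c c' : has_mean f c -> has_mean f' c' -> has_mean (fun x => f x + f' x) (c + c').
Proof.
move=> [g lg gE] [g' lg' gE']; exists (fun x => g x + g' x); first exact: const_limD.
by move=> x rx; rewrite mulrDl gE // gE' // big_split.
Qed.

Lemma has_meanZ a f c : has_mean f c -> has_mean (fun x => a * f x) (a * c).
Proof.
move=> [g lg gE]; exists (fun x => a * g x); first exact: const_limZ.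
by move=> x rx; rewrite -mulrA gE // mulr_sumr.
Qed.

Lemma has_mean_sum (I : Type) (r : seq I) (P : pred I) (f : I -> F) (c : I -> C) :
  (forall i, P i -> has_mean (f i) (c i)) ->
  has_mean (fun x => \sum_(i <- r | P i) f i x) (\sum_(i <- r | P i) c i).
Proof.
move=> cf; elim: r => [|i r IH].
  by rewrite big_nil; under eq_fun do rewrite big_nil; exact: has_mean0.
rewrite big_cons; under eq_fun do rewrite big_cons.
by case: ifPn => // Pi; apply: has_meanD; [exact: cf|].
Qed.

Lemma has_mean_int f c : (0 < n)%N -> has_mean f c ->
  int_Ab (fun x => f x * ((sqnorm (Cb q q0 x))^-1)%:C) = ((2 * pi) ^+ n)%:C * c.
Proof.
move=> n0 [g lg gE]; apply: (int_Ab_unfold (g := g)) => // [e e0|x /in_Ab_reg rx].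
  by have [|T [cT hT]] := lg e%:C; [rewrite ltcR|exists T].
by rewrite -gE // C_sq_sqnorm fmorphV.
Qed.

(** The unfolding [g] is not unique, but the constant is, being determined by the integral. *)
Lemma has_mean_uniq f c d : (0 < n)%N -> has_mean f c -> has_mean f d -> c = d.
Proof.
move=> n0 /(has_mean_int n0) h1 /(has_mean_int n0); rewrite h1; apply: mulfI.
have := exprn_gt0 n (mulr_gt0 (ltr0n _ 2) (pi_gt0 R)).
by rewrite -ltcR => /lt0r_neq0.
Qed.

(* The polynomial P_k for an arbitrary integral weight [k], not only for partitions. *)
Definition HL k x : C := \sum_w Cb q q0 (wact w x) * chr k (wact w x).

Lemma HL_wact k u x : HL k (wact u x) = HL k x.
Proof. exact: (sum_wactr (fun y => Cb q q0 y * chr k y)). Qed.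

(* On the W-orbit of a regular point, Cb / C_sq is the reciprocal of the conjugate of Cb *)
Lemma has_mean_sumW (h g : F) c : const_lim (fun x => h x) c ->
  (forall x, reg x -> g x = h x * Cb q q0 (opp x)) ->
  has_mean (fun x => \sum_w Cb q q0 (wact w x) * g (wact w x)) c.
Proof.
move=> lh gh; exists h => // x rx; rewrite mulr_suml; apply: eq_bigr => w _.
have rwx := reg_wact w rx.
rewrite -(C_sq_wact q q0 w x) gh // mulrCA -/(C_sq q q0 _) mulfK //.
exact: C_sq_neq0.
Qed.

(** P_k / |C|^2 unfolds to the character of [k] over C(-x), whose reciprocal expands in the cone.
    Here [k] is any integral weight, since products with orbit sums produce such weights. *)
Lemma has_mean_HL k (j : 'I_n) : 0 < psum k j -> has_mean (HL k) 0.
Proof.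
move=> kj; apply: (has_mean_sumW (h := fun x => chr k x * C_opp_inv x)).
  exact: (cone_chr_lim cone_C_opp_inv kj).
by move=> x rx; rewrite -mulrA C_opp_inv_mul // mulr1.
Qed.

(** Only P_k is unfolded; P_l / C(-x) is then a sum over [u] of [C_ratio u] times the character of u
    l. Each [u] must either move all exponents off 0 or satisfy k + u l = 0; [t] records its
    contribution. *)
Lemma has_mean_HL_HL k l (t : W -> C) :
  (forall u, (exists j, 0 < psum (k + wt_act u l) j) /\ t u = 0 \/
     k + wt_act u l = 0 /\ t u = ratio_lim u) ->
  has_mean (fun x => HL k x * HL l x) (\sum_u t u).
Proof.
move=> H.
apply: (@has_mean_ext (fun x => \sum_w Cb q q0 (wact w x) * (chr k (wact w x) * HL l (wact w x)))).
  move=> x rx; rewrite [HL k x]/HL mulr_suml; apply: eq_bigr => w _.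
  by rewrite HL_wact mulrA.
apply: (@has_mean_sumW (fun x => \sum_u chr (k + wt_act u l) x * C_ratio q q0 u x) (fun x => chr k x * HL l x)).
  apply: const_lim_sum => u; case: (H u) => -[h1 ->].
    by case: h1 => j hj; apply: cone_chr_lim (cone_C_ratio u) hj.
  rewrite h1; apply: cone_lim; apply: eq_cone (cone_C_ratio u) => x.
  by rewrite chr0 mul1r.
move=> x rx; rewrite /HL mulr_sumr mulr_suml; apply: eq_bigr => u _.
by rewrite Cb_ratio // chrD chr_wact; ring.
Qed.

End Functional.

(** * Counting inversions in a stabilizer *)

Section Inversions.
Variable (K : fieldType) (q : K).
Hypothesis q_nontorsion : forall m, 1 - q ^+ m.+1 != 0.

(** Both sides are the q-analogue of the number of selected indices; the telescoping product has the
    shape of the factors of [HL_norm]. *)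
Lemma sum_prefix_expr (P : pred nat) N : P 0%N -> (forall i j, (i <= j)%N -> P j -> P i) ->
  \sum_(i < N.+1 | P i) q ^+ i =
  \prod_(i < N | P i.+1) ((1 - q ^+ i.+2) / (1 - q ^+ i.+1)).
Proof.
move=> P0 Pd; elim: N => [|N IH].
  by rewrite big_ord0 big_mkcond big_ord_recl big_ord0 /= P0 expr0 addr0.
rewrite big_mkcond big_ord_recr /= -big_mkcond /= [RHS]big_mkcond big_ord_recr /= -big_mkcond /= -IH.
case PN: (P N.+1); last by rewrite addr0 mulr1.
have -> : \sum_(i < N.+1 | P i) q ^+ i = \sum_(i < N.+1) q ^+ i.
  apply: eq_bigl => i; apply: Pd PN; exact: ltnW.
set S := \sum_(i < _) _.
have HS : 1 - q ^+ N.+1 = (1 - q) * S by rewrite -opprB subrX1 -mulNr opprB.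
have n1 := q_nontorsion N.
apply: (mulIf n1); rewrite mulrA divfK //.
have -> : q ^+ N.+2 = q * q ^+ N.+1 by rewrite exprS.
have E : 1 - q * q ^+ N.+1 = (1 - q) * S + q ^+ N.+1 * (1 - q) by rewrite -HS; ring.
rewrite E HS; ring.
Qed.

Definition inv_weight n (s : 'S_n) : K :=
  \prod_(a < n) \prod_(b < n | (a < b)%N) (if (s a < s b)%N then 1 else q).

Lemma prod_ltn_expr n (i : 'I_n.+1) (s : 'S_n) :
  \prod_(j < n) (if (i < lift i (s j))%N then 1 else q) = q ^+ i.
Proof.
rewrite -(reindex_inj (@perm_inj _ s) (P := predT) (F := fun j => if (i < lift i j)%N then 1 else q)) /=.
rewrite (bigID (fun j : 'I_n => (j < i)%N)) /= [X in _ * X]big1 ?mulr1 => [|j]; last first.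
  by rewrite -leqNgt /bump => ij; rewrite ij add1n ltnS ij.
rewrite (eq_bigr (fun=> q)) => [|j ji]; last first.
  by rewrite (_ : bump i j = j :> nat); [rewrite ltnNge ltnW|rewrite /bump leqNgt ji].
have iN : (i <= n)%N by rewrite -ltnS.
by rewrite -(big_ord_widen n (fun=> q) iN) prodr_const card_ord.
Qed.

Lemma inv_weight_lift n (i : 'I_n.+1) (s : 'S_n) :
  inv_weight (lift_perm ord0 i s) = q ^+ i * inv_weight s.
Proof.
rewrite /inv_weight big_ord_recl big_mkcond big_ord_recl /= mul1r; congr (_ * _).
  rewrite -(prod_ltn_expr i s); apply: eq_bigr => j _ /=.
  by rewrite lift_perm_id lift_perm_lift.
apply: eq_bigr => a _; rewrite big_mkcond big_ord_recl /= mul1r [RHS]big_mkcond.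
apply: eq_bigr => b _; rewrite !lift_perm_lift /= /bump !leq0n !add1n ltnS.
case: ifP => // _.
have -> // : ((i <= s a) + s a < (i <= s b) + s b)%N = (s a < s b)%N.
by case: (leqP i (s a)); case: (leqP i (s b)); lia.
Qed.

Definition convex_fibers n (T : eqType) (f : 'I_n -> T) :=
  forall a b c : 'I_n, (a <= b <= c)%N -> f a = f c -> f b = f a.

(** Poincare polynomial of the subgroup of S_n preserving [f]. Sort by the image of 0, which ranges
    over an initial interval and costs q^i; what is left is the same problem for [f] without its
    first entry. *)
Lemma sum_inv_weight n (T : eqType) (f : 'I_n -> T) : convex_fibers f ->
  \sum_(s : 'S_n | [forall i, f (s i) == f i]) inv_weight s =
  \prod_(a < n) \prod_(b < n | (a < b)%N && (f a == f b))
     ((1 - q ^+ (1 + (b - a))) / (1 - q ^+ (b - a))).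
Proof.
elim: n f => [|n IH] f cf.
  rewrite big_ord0 (eq_bigl predT) => [|s]; last by apply/forallP => -[].
  rewrite (eq_bigr (fun=> 1)) => [|s _]; last by rewrite /inv_weight big_ord0.
  by rewrite sumr_const cardT -cardE card_Sn mulr1n.
rewrite big_mkcond sum_perm_lift big_ord_recl /=.
have cf' : convex_fibers (fun j => f (lift ord0 j)).
  by move=> a b c abc; apply: cf; rewrite /= /bump !leq0n !add1n !ltnS.
(* Deleting any index of the fibre through 0 leaves the same sequence, since that fibre is an
   initial interval. *)
have liftE (i : 'I_n.+1) : f i = f ord0 -> forall j, f (lift i j) = f (lift ord0 j).
  move=> fi j; case: (leqP i j) => ij.
    by congr f; apply: val_inj; rewrite /= /bump ij.
  have h1 : f (lift i j) = f ord0.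
    by apply: (cf ord0 _ i) => //=; rewrite (_ : bump i j = j :> nat); [exact: ltnW|rewrite /bump leqNgt ij].
  have h2 : f (lift ord0 j) = f ord0.
    by apply: (cf ord0 _ i) => //=; rewrite /bump leq0n add1n.
  by rewrite h1 h2.
transitivity (\sum_(i < n.+1 | f i == f ord0) q ^+ i *
   \sum_(s : 'S_n | [forall j, f (lift ord0 (s j)) == f (lift ord0 j)]) inv_weight s).
  rewrite [RHS]big_mkcond; apply: eq_bigr => i _.
  case: eqP => fi; last first.
    apply: big1 => s _; case: ifP => // /forallP/(_ ord0).
    by rewrite lift_perm_id => /eqP.
  rewrite mulr_sumr [RHS]big_mkcond; apply: eq_bigr => s _; rewrite inv_weight_lift.
  congr (if _ then _ else _); apply/forallP/forallP => H j.
    by have := H (lift ord0 j); rewrite lift_perm_lift (liftE i fi).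
  case: (unliftP ord0 j) => [j' ->|->]; last by rewrite lift_perm_id fi.
  by rewrite lift_perm_lift (liftE i fi).
rewrite -mulr_suml (IH _ cf'); congr (_ * _).
  pose P := fun m : nat => [exists i : 'I_n.+1, (nat_of_ord i == m) && (f i == f ord0)].
  have PE (i : 'I_n.+1) : P i = (f i == f ord0).
    apply/existsP/idP => [[j /andP[/eqP/val_inj -> ]] //|fi].
    by exists i; rewrite eqxx.
  rewrite [X in X = _](eq_bigl (fun i : 'I_n.+1 => P i)); last by move=> i; rewrite PE.
  rewrite sum_prefix_expr; first last.
  - move=> i j ij /existsP[a /andP[/eqP aj /eqP fa]].
    have iN : (i < n.+1)%N by apply: leq_ltn_trans (ltn_ord a); rewrite aj.
    apply/existsP; exists (Ordinal iN); rewrite eqxx /=; apply/eqP.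
    by apply: (cf ord0 _ a) => //=; rewrite aj.
  - by apply/existsP; exists ord0; rewrite !eqxx.
  rewrite [RHS]big_mkcond big_ord_recl /= mul1r [LHS]big_mkcond; apply: eq_bigr => i _.
  rewrite -[i.+1]/(nat_of_ord (lift ord0 i)) PE eq_sym /= /bump leq0n add1n.
  by rewrite subn0 add1n.
apply: eq_bigr => a _; rewrite [RHS]big_mkcond big_ord_recl /= mul1r [LHS]big_mkcond.
by apply: eq_bigr => b _; rewrite /= /bump !leq0n !add1n ltnS subSS.
Qed.

End Inversions.

(** * Orthogonality and norms for dominant weights *)

Section Dominant.
Variables (R : realType) (n : nat).
Local Notation C := (R[i]).
Local Notation Zn := {ffun 'I_n -> int}.
Local Notation W := ('S_n * {ffun 'I_n -> bool})%type.
Implicit Types (k l : Zn) (w u : W).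

Definition dominant k := forall i j : 'I_n, (i <= j)%N -> 0 <= k j <= k i.

(** Among all choices of j + 1 signed entries of a dominant weight, the first j + 1 entries have the
    largest sum. *)
Lemma psum_wt_act_le k w j : dominant k -> - psum k j <= psum (wt_act w k) j <= psum k j.
Proof.
move=> dk; pose t := (w.1^-1)%g.
have kge i : 0 <= k i by have /andP[] := dk i i (leqnn i).
suff H : \sum_(i < n | (i <= j)%N) k (t i) <= psum k j.
  have wzb i : - k (t i) <= wt_act w k i <= k (t i).
    rewrite ffunE -/t; have := kge (t i); case: (w.2 (t i)); rewrite ?expr1 ?expr0; lia.
  apply/andP; split; last first.
    by apply: le_trans H; apply: ler_sum => i _; have /andP[] := wzb i.
  rewrite lerNl; apply: le_trans H; rewrite /psum -sumrN; apply: ler_sum => i _.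
  by have /andP[] := wzb i; rewrite lerNl.
(* After subtraction of [k j] the entries are nonnegative up to [j] and nonpositive after it, so any
   other choice of indices loses termwise. *)
have H0 : \sum_(i < n | (i <= j)%N) (k (t i) - k j) <= \sum_(i < n | (i <= j)%N) (k i - k j).
  rewrite (reindex_inj (@perm_inj _ t^-1%g)) /= big_mkcond [leRHS]big_mkcond /=.
  apply: ler_sum => i _; rewrite permKV.
  case: (leqP i j) => ij; first by have /andP[] := dk _ _ ij; case: ifP; lia.
  by have /andP[] := dk _ _ (ltnW ij); case: ifP; lia.
by move: H0; rewrite !big_split /= lerD2r.
Qed.

Lemma psum_gt_or_eq0 k u : dominant k ->
  (exists j, 0 < psum (k + wt_act u k) j) \/ k + wt_act u k = 0.
Proof.
move=> dk; have [/existsP[j hj]|] := boolP [exists j, 0 < psum (k + wt_act u k) j]; first by left; exists j.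
rewrite negb_exists => /forallP h; right; apply: psum_eq0 => j; apply/eqP.
rewrite eq_le leNgt h /= psumD; have /andP[] := psum_wt_act_le u j dk; lia.
Qed.

Lemma dominant_neq_psum k l : k != l -> exists j, psum k j != psum l j.
Proof.
move=> kl; apply/existsP; apply: contraNT kl; rewrite negb_exists => /forallP h.
rewrite -subr_eq0; apply/eqP; apply: psum_eq0 => j.
by rewrite psumD psumN; have := h j; rewrite negbK => /eqP ->; rewrite subrr.
Qed.

Variables (q q0 : R).
Hypotheses (hq : `|q| < 1) (hq0 : `|q0| < 1).

(** At an index where the partial sums differ, the weight with the larger one outweighs every
    W-image of the other; commutativity of the product lets it be [k]. *)
Lemma has_mean_orth k l : dominant k -> dominant l -> k != l ->
  has_mean q q0 (fun x => HL q q0 k x * HL q q0 l x) 0.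
Proof.
move=> dk dl /dominant_neq_psum[j]; rewrite neq_lt => kl.
wlog {kl} kl : k l dk dl / psum l j < psum k j.
  move=> H; case/orP: kl => kl; last exact: H.
  by apply: has_mean_ext (H _ _ dl dk kl) => x _; rewrite mulrC.
rewrite -[0](_ : \sum_(u : W) 0 = 0); last by rewrite big1.
apply: has_mean_HL_HL => // u; left; split=> //; exists j; rewrite psumD.
have /andP[] := psum_wt_act_le u j dl; lia.
Qed.

Lemma one_sub_expr_neq0 m : 1 - q ^+ m.+1 != 0.
Proof.
rewrite subr_eq0; apply: contraTneq hq => /(congr1 Num.norm).
rewrite normr1 normrX => h; rewrite -leNgt -(expr_ge1 (ltn0Sn m)) // -h.
by [].
Qed.

Definition HL_norm k : R := \prod_(a < n) \prod_(b < n | (a < b)%N && (k a == k b))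
  ((1 - q ^+ (1 + (b - a))) / (1 - q ^+ (b - a))).

(** The contributing [u] change all signs and permute within the stabilizer of [k]; their limits are
    q to the number of inversions, summed by [sum_inv_weight]. *)
Lemma has_mean_norm k : dominant k -> has_mean q q0 (fun x => HL q q0 k x * HL q q0 k x) (HL_norm k)%:C.
Proof.
move=> dk.
have -> : (HL_norm k)%:C = \sum_(u : W) (if k + wt_act u k == 0 then ratio_lim q u else 0).
  have cf : convex_fibers k.
    move=> a b c /andP[ab bc] kac.
    by apply/eqP; rewrite eq_le; have /andP[_ ->] := dk _ _ ab; rewrite kac; have /andP[_ ->] := dk _ _ bc.
  rewrite /HL_norm -(sum_inv_weight one_sub_expr_neq0 cf) rmorph_sum /=.
  rewrite -(pair_bigA _ (fun s e => if k + wt_act (s, e) k == 0 then ratio_lim q (s, e) else 0)) /=.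
  rewrite (reindex_inj invg_inj) /= [LHS]big_mkcond; apply: eq_bigr => s _.
  rewrite (bigD1 [ffun=> true]) //= big1 ?addr0 => [|e /eqP eT].
    have -> : (k + wt_act (s, [ffun=> true]) k == 0) = [forall i, k ((s^-1)%g i) == k i].
      apply/eqP/forallP => [/ffunP h i|h].
        by have := h i; rewrite !ffunE /= => /eqP; rewrite expr1 mulN1r subr_eq0 eq_sym.
      by apply/ffunP => i; rewrite !ffunE /= expr1 mulN1r (eqP (h i)) subrr.
    case: ifP => // _; rewrite /ratio_lim big1 ?mul1r => [|a _]; last by rewrite ffunE.
    rewrite rmorph_prod; apply: eq_bigr => a _; rewrite rmorph_prod; apply: eq_bigr => b _ /=.
    by rewrite ffunE; case: ifP.
  case: ifP => // _; rewrite /ratio_lim.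
  have /existsP[i ei] : [exists i, ~~ e i].
    rewrite -negb_forall; apply: contra_notN eT => /forallP h; apply/ffunP => i.
    by rewrite ffunE; apply: h.
  by rewrite (bigD1 (s i)) //= permK (negbTE ei) mul0r mul0r.
apply: has_mean_HL_HL => // u; have [h|h] := psum_gt_or_eq0 u dk.
  left; split=> //; case: ifP => // /eqP h'; case: h => j; rewrite h'.
  by rewrite /psum big1 // => i _; rewrite ffunE.
by right; rewrite h eqxx.
Qed.

Lemma HL_norm_neq0 k : HL_norm k != 0.
Proof.
apply/prodf_neq0 => a _; apply/prodf_neq0 => b /andP[ab _].
rewrite mulf_neq0 ?invr_eq0 ?add1n ?one_sub_expr_neq0 //.
by rewrite -(prednK (_ : (0 < b - a)%N)) ?subn_gt0 // one_sub_expr_neq0.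
Qed.

End Dominant.

(** * Symmetric and alternating polynomials *)

Section Alternating.
Variables (R : realType) (n : nat).
Local Notation C := (R[i]).
Local Notation Zn := {ffun 'I_n -> int}.
Local Notation W := ('S_n * {ffun 'I_n -> bool})%type.
Local Notation F := (('I_n -> R) -> C).
Implicit Types (k l : Zn) (x : 'I_n -> R) (w u : W) (f g h : F).

(* Linear span, up to equality at regular points. *)
Inductive Span (X : F -> Prop) : F -> Prop :=
| Span_nil f : (forall x, reg x -> f x = 0) -> Span X f
| Span_cons c g h f : X g -> Span X h ->
    (forall x, reg x -> f x = c * g x + h x) -> Span X f.

Lemma Span_ext X f f' : (forall x, reg x -> f x = f' x) -> Span X f -> Span X f'.
Proof.
move=> ff sf; elim: sf f' ff => {f}[g g0|c g h g' Xg Xh _ gE] f' ff.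
  by apply: Span_nil => x rx; rewrite -ff // g0.
by apply: (@Span_cons X c g _ _ Xg Xh) => x rx; rewrite -ff // gE.
Qed.

Lemma Span0 X : Span X (fun=> 0).
Proof. exact: Span_nil. Qed.

Lemma SpanD X f g : Span X f -> Span X g -> Span X (fun x => f x + g x).
Proof.
move=> Xf Xg; elim: Xf => {f}[f f0|c f h f' Xf _ IH fE].
  by apply: Span_ext Xg => x rx; rewrite f0 // add0r.
by apply: (@Span_cons X c f _ _ Xf IH) => x rx; rewrite fE // addrA.
Qed.

Lemma SpanZ X a f : Span X f -> Span X (fun x => a * f x).
Proof.
elim=> {f}[f f0|c f h f' Xf _ IH fE].
  by apply: Span_nil => x rx; rewrite f0 // mulr0.
by apply: (@Span_cons X (a * c) f _ _ Xf IH) => x rx; rewrite fE // mulrDr mulrA.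
Qed.

Lemma Span_mem X f : X f -> Span X f.
Proof.
move=> Xf; apply: (@Span_cons X 1 f _ _ Xf (Span0 X)) => x _.
by rewrite mul1r addr0.
Qed.

Lemma Span_sum X (I : Type) (r : seq I) (P : pred I) (f : I -> F) :
  (forall i, P i -> Span X (f i)) -> Span X (fun x => \sum_(i <- r | P i) f i x).
Proof.
move=> Xf; elim: r => [|i r IH].
  by under eq_fun do rewrite big_nil; exact: Span0.
under eq_fun do rewrite big_cons.
by case Pi: (P i) => //; apply: SpanD; [exact: Xf|].
Qed.

Lemma Span_trans X Y f : (forall g, X g -> Span Y g) -> Span X f -> Span Y f.
Proof.
move=> XY; elim=> {f}[f f0|c f h f' Xf _ IH fE]; first exact: Span_nil.
by apply: (@Span_ext _ (fun x => c * f x + h x)) => [x rx|]; rewrite ?fE //; apply: SpanD => //; apply/SpanZ/XY.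
Qed.

Lemma Span_mul X Y f g : (forall h, X h -> Span Y (fun x => h x * g x)) -> Span X f ->
  Span Y (fun x => f x * g x).
Proof.
move=> XY; elim=> {f}[f f0|c f h f' Xf _ IH fE].
  by apply: Span_nil => x rx; rewrite f0 // mul0r.
apply: (@Span_ext _ (fun x => c * (f x * g x) + h x * g x)) => [x rx|].
  by rewrite fE // mulrDl mulrA.
by apply: SpanD => //; apply/SpanZ/XY.
Qed.

Lemma Span_fin (T : finType) (a : T -> F) f :
  Span (fun g => exists t, g = a t) f ->
  exists c : T -> C, forall x, reg x -> f x = \sum_t c t * a t x.
Proof.
elim=> {f}[f f0|c _ h f' [t ->] _ [d hd] fE].
  by exists (fun=> 0) => x rx; rewrite f0 // big1 // => t _; rewrite mul0r.
exists (fun s => (if s == t then c else 0) + d s) => x rx.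
rewrite fE // hd //; under [RHS]eq_bigr do rewrite mulrDl.
rewrite big_split; congr (_ + _); rewrite (bigD1 t) //= eqxx big1 ?addr0 // => s /negbTE ->.
by rewrite mul0r.
Qed.

Definition alt_sum k x : C := \sum_w sgw R w * chr k (wact w x).

Lemma alt_sum_orbit_sum k l x : alt_sum k x * orbit_sum l x = \sum_u alt_sum (k + wt_act u l) x.
Proof.
rewrite /alt_sum mulr_suml exchange_big; apply: eq_bigr => w _ /=.
rewrite -(orbit_sum_wact l w x) /orbit_sum mulr_sumr; apply: eq_bigr => u _.
by rewrite chrD -mulrA -[in RHS]chr_wact.
Qed.

Lemma alt_sum_wt_act k w x : alt_sum (wt_act w k) x = sgw R w * alt_sum k x.
Proof.
rewrite /alt_sum [in RHS](reindex_inj (@wmul_injr _ w)) mulr_sumr.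
apply: eq_bigr => u _; rewrite -chr_wact wactM sgwM mulrA [sgw R w * (_ * _)]mulrA sgw_sqr.
by rewrite mul1r.
Qed.

Lemma alt_sum_eq0 k w x : wt_act w k = k -> sgw R w = -1 -> alt_sum k x = 0.
Proof.
move=> wk sw; have := alt_sum_wt_act k w x; rewrite wk sw mulN1r => /eqP.
by rewrite -addr_eq0 -mulr2n mulrn_eq0 /= => /eqP.
Qed.

Definition flip (i : 'I_n) : W := (1%g, [ffun j => j == i]).
Definition transp (i j : 'I_n) : W := (tperm i j, [ffun=> false]).

Lemma wt_act_flip k i : wt_act (flip i) k = [ffun j => if j == i then - k j else k j].
Proof.
apply/ffunP => j; rewrite !ffunE /= invg1 perm1.
by case: eqP => _; rewrite ?expr1 ?expr0 ?mulN1r ?mul1r.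
Qed.

Lemma wt_act_transp k i j : wt_act (transp i j) k = [ffun a => k (tperm i j a)].
Proof. by apply/ffunP => a; rewrite !ffunE /= tpermV mul1r. Qed.

Lemma sgw_flip i : sgw R (flip i) = -1.
Proof.
rewrite /sgw /= odd_perm1 mul1r (bigD1 i) //= ffunE eqxx expr1 big1 ?mulr1 // => j /negbTE ji.
by rewrite ffunE ji.
Qed.

Lemma sgw_transp i j : i != j -> sgw R (transp i j) = -1.
Proof.
by move=> ij; rewrite /sgw /= odd_tperm ij big1 ?mulr1 // => a _; rewrite ffunE.
Qed.

Lemma alt_sum_zero_entry k i x : k i = 0 -> alt_sum k x = 0.
Proof.
move=> ki; apply: alt_sum_eq0 (sgw_flip i); apply/ffunP => j; rewrite wt_act_flip ffunE.
by case: eqP => // ->; rewrite ki oppr0.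
Qed.

Lemma alt_sum_eq_entries k i j x : i != j -> k i = k j -> alt_sum k x = 0.
Proof.
move=> ij kij; apply: alt_sum_eq0 (sgw_transp ij); apply/ffunP => a; rewrite wt_act_transp ffunE.
by case: tpermP => // ->.
Qed.

Lemma wt_actM w u k : wt_act w (wt_act u k) = wt_act (wmul u w) k.
Proof.
apply/ffunP => i; rewrite !ffunE /= invMg permM permKV signr_addb.
by rewrite mulrA; congr (_ * _); exact: mulrC.
Qed.

(** (n, ..., 1), half the sum of the positive roots of type C. *)
Definition rho : Zn := [ffun i : 'I_n => (n - i)%:Z].

(** Maximize the pairing with [rho] over the orbit: a sign change would improve a negative entry,
    and a transposition an ascent. *)
Lemma exists_dominant k : exists w, dominant (wt_act w k).
Proof.
pose Phi w := \sum_i rho i * wt_act w k i.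
case: (@Order.TotalTheory.arg_maxP _ _ _ (w1 n) predT Phi isT) => w _ wmax.
exists w; set l := wt_act w k.
have H u : \sum_i rho i * wt_act u l i <= \sum_i rho i * l i.
  by rewrite /l wt_actM; exact: wmax.
clearbody l; clear Phi wmax.
have rho0 i : 0 < rho i by rewrite ffunE ltz_nat subn_gt0.
have l0 i : 0 <= l i.
  have := H (flip i); rewrite (bigD1 i) //= [leRHS](bigD1 i) //= wt_act_flip [X in rho i * X]ffunE eqxx.
  rewrite (eq_bigr (fun j => rho j * l j)) => [|j /negbTE ji]; last by rewrite [X in _ * X]ffunE ji.
  rewrite lerD2r ler_pM2l //; lia.
move=> i j; rewrite leq_eqVlt => /orP[/eqP/val_inj <-|ij]; first by rewrite l0 lexx.
rewrite l0 /=.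
have ji : j != i by apply: contraTneq ij => ->; rewrite ltnn.
have := H (transp i j); rewrite wt_act_transp (bigD1 i) //= [leRHS](bigD1 i) //= (bigD1 j) //= [X in _ <= _ +
  X](bigD1 j) //=.
rewrite (eq_bigr (fun a => rho a * l a)) => [|a /andP[ai aj]]; last first.
  by rewrite [X in _ * X]ffunE tpermD // eq_sym.
rewrite !addrA lerD2r !ffunE tpermL tpermR.
have -> : (n - i)%:Z = (n - j)%:Z + (j - i)%:Z by have := ltn_ord j; lia.
have : 0 < (j - i)%:Z by lia.
set a := (_ - _)%:Z; set b := (_ - _)%:Z => b0 hle.
have : a * (l j - l i) <= 0 by move: hle; rewrite -subr_le0; apply: le_trans; rewrite le_eqVlt; apply/orP; left;
  apply/eqP; ring.
by rewrite pmulr_rle0 // subr_le0.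
Qed.

Definition toZ D (mu : {ffun 'I_n -> 'I_D.+1}) : Zn := [ffun j => (mu j : nat)%:Z].

Lemma nonincrP D (mu : {ffun 'I_n -> 'I_D.+1}) : nonincr mu ->
  forall i j : 'I_n, (i <= j)%N -> (mu j <= mu i)%N.
Proof. by move=> /forallP h i j ij; have /forallP/(_ j)/implyP := h i; apply. Qed.

Lemma dominant_toZ D (mu : {ffun 'I_n -> 'I_D.+1}) : nonincr mu -> dominant (toZ mu).
Proof. by move=> /nonincrP h i j ij; rewrite !ffunE lez_nat h. Qed.

Definition wt_bnd (D : nat) k := forall i, (`|k i| <= D)%N.

Lemma wt_bnd_wt_act D k w : wt_bnd D k -> wt_bnd D (wt_act w k).
Proof.
by move=> bk i; rewrite ffunE; case: (w.2 _); rewrite ?expr1 ?expr0 ?mulN1r ?mul1r ?abszN.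
Qed.

(** If a reflection fixes the dominant representative, the sum vanishes. Otherwise its entries are
    positive and strictly decreasing, so at least those of [rho]; the difference is a partition,
    with first part at most [D] since the first entry is at most D + n. *)
Lemma alt_sum_canon D k : wt_bnd (D + n) k -> (forall x, alt_sum k x = 0) \/
  exists w (mu : {ffun 'I_n -> 'I_D.+1}), nonincr mu /\ wt_act w k = rho + toZ mu.
Proof.
move=> bk; have [w dw] := exists_dominant k; set l := wt_act w k in dw.
have bl : wt_bnd (D + n) l by exact: wt_bnd_wt_act.
have red : (forall x, alt_sum l x = 0) -> forall x, alt_sum k x = 0.
  move=> h x; have := h x; rewrite alt_sum_wt_act => /eqP; rewrite mulf_eq0 => /orP[/eqP s0|/eqP //].
  by have := sgw_sqr R w; rewrite s0 mul0r => /eqP; rewrite eq_sym oner_eq0.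
have [/existsP[i /eqP li]|] := boolP [exists i, l i == 0].
  by left; apply: red => x; exact: alt_sum_zero_entry li.
rewrite negb_exists => /forallP ln0.
have [/existsP[i /existsP[j /andP[ij /eqP lij]]]|] := boolP [exists i, exists j, (i != j) && (l i == l j)].
  by left; apply: red => x; exact: alt_sum_eq_entries ij lij.
rewrite negb_exists => /forallP linj; right.
have lpos i : 0 < l i by rewrite lt_neqAle eq_sym ln0; have /andP[] := dw i i (leqnn i).
have ldec (i j : 'I_n) : (i < j)%N -> l j < l i.
  move=> ij; rewrite lt_neqAle; have /andP[_ ->] := dw _ _ (ltnW ij); rewrite andbT.
  have := linj j; rewrite negb_exists => /forallP/(_ i); rewrite negb_and negbK.
  by case: eqP => // ji; move: ij; rewrite ji ltnn.
have gap d (i j : 'I_n) : (j = i + d :> nat)%N -> l j + d%:Z <= l i.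
  elim: d j => [|d IH] j jd; first by rewrite addr0 (_ : j = i) ?lexx //; apply: val_inj; rewrite /= jd addn0.
  have hj : (i + d < n)%N by have := ltn_ord j; lia.
  have := IH (Ordinal hj) erefl; have := @ldec (Ordinal hj) j; rewrite /= jd addnS ltnSn => /(_ isT).
  lia.
have lo (i : 'I_n) : (n - i)%:Z <= l i.
  have hl : (n.-1 < n)%N by have := ltn_ord i; lia.
  have := gap (n.-1 - i)%N i (Ordinal hl); have := lpos (Ordinal hl); have := ltn_ord i => /=; lia.
have up (i : 'I_n) : l i <= (D + n - i)%:Z.
  have hl : (0 < n)%N by have := ltn_ord i; lia.
  have := gap i (Ordinal hl) i; have := bl (Ordinal hl); have := ltn_ord i => /=; lia.
have mub (i : 'I_n) : (`|l i - (n - i)%:Z| < D.+1)%N.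
  by have := lo i; have := up i; have := ltn_ord i; lia.
exists w, [ffun i => Ordinal (mub i)]; split.
  apply/forallP => i; apply/forallP => j; apply/implyP => ij.
  rewrite ffunE [X in (_ <= nat_of_ord X)%N]ffunE /=.
  have := @gap (j - i)%N i j; have := lo i; have := lo j; have := ltn_ord i; have := ltn_ord j; lia.
apply/ffunP => i; rewrite -/l; move: (lo i) (mub i); clearbody l => loi mi.
have E : toZ [ffun i => Ordinal (mub i)] i = (`|l i - (n - i)%:Z|%N)%:Z.
  by rewrite ffunE; congr Posz; rewrite ffunE.
have E2 : rho i = (n - i)%:Z by rewrite ffunE.
by rewrite [RHS]ffunE E E2 gez0_abs ?subr_ge0 // subrKC.
Qed.

End Alternating.

Lemma inv_weight_N1 (K : fieldType) n (s : 'S_n) : inv_weight (-1 : K) s = (-1) ^+ odd_perm s.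
Proof.
elim: n s => [|n IH] s.
  have -> : s = 1%g by apply/permP => -[].
  by rewrite odd_perm1 expr0 /inv_weight big_ord0.
have [g _ hg] := lift_perm_bij n; rewrite -(hg s) /=.
by rewrite inv_weight_lift IH odd_lift_perm /= signr_addb signr_odd.
Qed.

Lemma absz_add_le (a b : int) (d e : nat) :
  (`|a| <= d)%N -> (`|b| <= e)%N -> (`|(a + b)%R| <= d + e)%N.
Proof. lia. Qed.

(** * Trigonometric degree and the Weyl denominator *)

Section TrigDegree.
Variables (R : realType) (n : nat).
Local Notation C := (R[i]).
Local Notation Zn := {ffun 'I_n -> int}.
Local Notation W := ('S_n * {ffun 'I_n -> bool})%type.
Local Notation F := (('I_n -> R) -> C).
Implicit Types (k l : Zn) (x : 'I_n -> R) (w u : W) (f g h : F) (d e : 'I_n -> nat).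

Definition trig_deg d f := exists T : seq (C * Zn),
  (forall p, p \in T -> forall i, (`|p.2 i| <= d i)%N) /\ forall x, f x = trig T x.

Lemma trig_deg_chr c k d : (forall i, (`|k i| <= d i)%N) -> trig_deg d (fun x => c * chr k x).
Proof.
move=> kd; exists [:: (c, k)]; split=> [p|x]; last by rewrite /trig big_seq1.
by rewrite inE => /eqP ->.
Qed.

Lemma trig_deg_ext d f g : (forall x, f x = g x) -> trig_deg d f -> trig_deg d g.
Proof. by move=> fg [T [h1 h2]]; exists T; split=> // x; rewrite -fg. Qed.

Lemma trig_degD d f g : trig_deg d f -> trig_deg d g -> trig_deg d (fun x => f x + g x).
Proof.
move=> [S [h1 h2]] [T [h3 h4]]; exists (S ++ T); split=> [p|x]; last by rewrite trig_cat h2 h4.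
by rewrite mem_cat => /orP[/h1|/h3].
Qed.

Lemma trig_degM d e f g : trig_deg d f -> trig_deg e g -> trig_deg (fun i => d i + e i)%N (fun x => f x * g x).
Proof.
move=> [S [h1 h2]] [T [h3 h4]]; exists (trigM S T); split=> [p|x]; last by rewrite trig_mul h2 h4.
move=> /allpairsP[[a b] /= [/h1 ha /h3 hb ->]] i /=; rewrite ffunE.
exact: absz_add_le (ha i) (hb i).
Qed.

Lemma trig_deg_prod (I : Type) (r : seq I) (P : pred I) (f : I -> F) (d : I -> 'I_n -> nat) :
  (forall i, P i -> trig_deg (d i) (f i)) ->
  trig_deg (fun j => \sum_(i <- r | P i) d i j)%N (fun x => \prod_(i <- r | P i) f i x).
Proof.
move=> hf; elim: r => [|i r IH].
  have : trig_deg (fun=> 0%N) (fun x => 1 * chr 0 x) by apply: trig_deg_chr => i; rewrite ffunE.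
  move=> [T [h1 h2]]; exists T; split=> [p pT i|x]; first by rewrite big_nil h1.
  by rewrite big_nil -h2 chr0 mulr1.
case Pi: (P i); last first.
  case: IH => T [h1 h2]; exists T; split=> [p pT j|x]; first by rewrite big_cons Pi h1.
  by rewrite big_cons Pi.
have [T [h1 h2]] := trig_degM (hf i Pi) IH; exists T; split=> [p pT j|x]; first by rewrite big_cons Pi h1.
by rewrite big_cons Pi.
Qed.

Lemma trig_deg_weak d e f : (forall i, (d i <= e i)%N) -> trig_deg d f -> trig_deg e f.
Proof.
by move=> de [T [h1 h2]]; exists T; split=> // p /h1 h i; apply: leq_trans (h i) (de i).
Qed.

(** Each coordinate lies in one single factor and in n - 1 pairs; the shift by [n] in the degree
    bounds comes from here. *)
Lemma sum_pair_degree (i : 'I_n) :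
  (\sum_(j < n) (i == j) + \sum_(a < n) \sum_(b < n | (a < b)%N) ((i == a) + (i == b)) = n)%N.
Proof.
have -> : (\sum_(a < n) \sum_(b < n | (a < b)%N) ((i == a) + (i == b)) =
          \sum_(j < n) ((i < j) + (j < i)))%N.
  under eq_bigr do rewrite big_split /=.
  rewrite big_split [RHS]big_split /=; congr (_ + _)%N.
    rewrite (bigD1 i) //= [X in (_ + X)%N]big1 ?addn0 => [|a ai]; last first.
      by rewrite big1 // => b _; rewrite eq_sym (negbTE ai).
    by rewrite big_mkcond; apply: eq_bigr => b _; rewrite eqxx; case: ifP.
  apply: eq_bigr => a _; rewrite big_mkcond (bigD1 i) //= big1 ?addn0 ?eqxx => [|b bi].
    by case: ifP.
  by rewrite eq_sym (negbTE bi); case: ifP.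
rewrite -big_split /= (eq_bigr (fun=> 1%N)) ?sum1_card ?card_ord // => j _.
by rewrite -val_eqE /=; case: ltngtP.
Qed.

Definition prodfun (f1 : R -> C) (f2 : R -> R -> C) x :=
  (\prod_j f1 (x j)) * \prod_(a < n) \prod_(b < n | (a < b)%N) f2 (x a) (x b).

Lemma trig_deg_prodfun (f1 : R -> C) (f2 : R -> R -> C) :
  (forall j, trig_deg (fun i => (i == j) : nat) (fun x => f1 (x j))) ->
  (forall a b : 'I_n, trig_deg (fun i => (i == a) + (i == b))%N (fun x => f2 (x a) (x b))) ->
  trig_deg (fun=> n) (prodfun f1 f2).
Proof.
move=> h1 h2; have H1 := trig_deg_prod (index_enum 'I_n) (P := predT) (fun j _ => h1 j).
have H2 := trig_deg_prod (index_enum 'I_n) (P := predT) (fun a _ =>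
  trig_deg_prod (index_enum 'I_n) (P := fun b : 'I_n => (a < b)%N) (fun b _ => h2 a b)).
by apply: trig_deg_weak (trig_degM H1 H2) => i; rewrite sum_pair_degree.
Qed.

Lemma trig_deg_unit_wt c (a : 'I_n) d : (0 < d a)%N -> trig_deg d (fun x => c * ei (x a)).
Proof.
move=> da; apply: trig_deg_ext (trig_deg_chr c (k := unit_wt a) _) => [x|i]; first by rewrite chr_unit_wt.
by rewrite ffunE; case: eqP => // ->.
Qed.

Lemma trig_deg_unit_wtN c (a : 'I_n) d : (0 < d a)%N -> trig_deg d (fun x => c * ei (- x a)).
Proof.
move=> da; apply: trig_deg_ext (trig_deg_chr c (k := - unit_wt a) _) => [x|i]; first by rewrite chrN chr_unit_wt eiN.
by rewrite !ffunE; case: eqP => // ->.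
Qed.

Lemma trig_deg_cst c d : trig_deg d (fun=> c).
Proof.
by apply: trig_deg_ext (trig_deg_chr c (k := 0) _) => [x|i]; rewrite ?chr0 ?mulr1 // ffunE.
Qed.

Definition cos2 (t : R) : C := ei t + ei (- t).

(* Weyl denominator of type C: [f] is a symmetric polynomial of degree at most [D] exactly when
   [f * weyl_den] is an alternating sum with exponents bounded by [D + n]. *)
Definition weyl_den x : C := prodfun (fun t => ei t - ei (- t)) (fun s t => cos2 s - cos2 t) x.

Lemma trig_deg_weyl_den : trig_deg (fun=> n) weyl_den.
Proof.
apply: trig_deg_prodfun => [j|a b].
  apply: (@trig_deg_ext _ (fun x => 1 * ei (x j) + (-1) * ei (- x j))) => [x|].
    by rewrite mul1r mulN1r.
  by apply: trig_degD; [apply: trig_deg_unit_wt|apply: trig_deg_unit_wtN]; rewrite eqxx.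
apply: (@trig_deg_ext _ (fun x => (1 * ei (x a) + 1 * ei (- x a)) + ((-1) * ei (x b) + (-1) * ei (- x b)))) => [x|].
  by rewrite /cos2 !mul1r !mulN1r opprD.
by apply: trig_degD; apply: trig_degD; (apply: trig_deg_unit_wt || apply: trig_deg_unit_wtN); rewrite eqxx ?addn1.
Qed.

Lemma cos2_sgn b (t : R) : cos2 (sgn R b * t) = cos2 t.
Proof.
by rewrite /cos2 /sgn; case: b; rewrite ?expr1 ?expr0 ?mulN1r ?mul1r // opprK addrC.
Qed.

Lemma weyl_den_wact w x : weyl_den (wact w x) = sgw R w * weyl_den x.
Proof.
rewrite /weyl_den /prodfun /sgw [(-1) ^+ _ * _]mulrC mulrACA; congr (_ * _).
  rewrite [X in _ = _ * X](reindex_inj (@perm_inj _ w.1)) -big_split; apply: eq_bigr => j _.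
  rewrite /wact /sgn /=; case: (w.2 j); rewrite ?expr1 ?expr0 ?mulN1r ?mul1r //.
  by rewrite opprK opprB.
transitivity (\prod_(j < n) \prod_(k < n | (j < k)%N)
    (fun a b => cos2 (wact_inv w x a) - cos2 (wact_inv w x b)) (w.1 j) (w.1 k)).
  by apply: eq_bigr => j _; apply: eq_bigr => k _; rewrite !wactE.
rewrite (prod_pairs_perm _ (fun a b => cos2 (wact_inv w x a) - cos2 (wact_inv w x b))).
rewrite -odd_permV -(@inv_weight_N1 C) /inv_weight -big_split; apply: eq_bigr => a _.
rewrite -big_split; apply: eq_bigr => b _.
rewrite /wact_inv !cos2_sgn /=; case: ifP => _; first by rewrite mul1r.
by rewrite mulN1r opprB.
Qed.

Lemma cos2_sub (s t : R) : cos2 s - cos2 t = ei s * ((1 - ei (- (s - t))) * (1 - ei (- (s + t)))).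
Proof.
rewrite /cos2 !eiN !eiD !eiN; have := ei_neq0 s; have := ei_neq0 t => t0 s0; field.
by rewrite s0 t0.
Qed.

Lemma ei_sub (s : R) : ei s - ei (- s) = ei s * (1 - ei (- (2 * s))).
Proof.
rewrite mulr_natl mulr2n opprD eiD mulrBr mulr1 mulrA [ei s * ei (- s)]mulrC.
by rewrite eiN_mul mul1r.
Qed.

Lemma weyl_den_neq0 x : reg x -> weyl_den x != 0.
Proof.
move=> [h1 h2]; rewrite mulf_neq0 //.
  apply/prodf_neq0 => j _; rewrite ei_sub mulf_neq0 ?ei_neq0 //.
  by rewrite one_sub_ei_neq0 // ei_eq1N.
apply/prodf_neq0 => a _; apply/prodf_neq0 => b ab.
have [|h3 h4] := h2 a b; first by apply: contraTneq ab => ->; rewrite ltnn.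
by rewrite cos2_sub !mulf_neq0 ?ei_neq0 // one_sub_ei_neq0 // ei_eq1N.
Qed.

Definition alt_bnd (D : nat) : F -> Prop := fun g => exists2 l, wt_bnd D l & g = @alt_sum R n l.

Lemma alt_bnd_sum (D : nat) (T : seq (C * Zn)) : (forall p, p \in T -> wt_bnd D p.2) ->
  Span (alt_bnd D) (fun x => \sum_w sgw R w * trig T (wact w x)).
Proof.
move=> hT; apply: (@Span_ext _ _ _ (fun x => \sum_(p <- T | p \in T) p.1 * alt_sum p.2 x)) => [x _|].
  rewrite -big_seq /trig /alt_sum; under [LHS]eq_bigr do rewrite mulr_sumr.
  rewrite exchange_big; apply: eq_bigr => w _; rewrite mulr_sumr; apply: eq_bigr => p _.
  by rewrite mulrCA.
apply: Span_sum => p pT; apply: SpanZ; apply: Span_mem; exists p.2 => //; exact: hT.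
Qed.

Lemma card_W_neq0 : #|{: W}|%:R != 0 :> C.
Proof. by rewrite pnatr_eq0 -lt0n; apply/card_gt0P; exists (w1 n). Qed.

(** Antisymmetrizing an expansion of [weyl_den] gives |W| times [weyl_den], which is already
    alternating. *)
Lemma weyl_den_Span : Span (alt_bnd n) weyl_den.
Proof.
have [T [h1 h2]] := trig_deg_weyl_den.
apply: (@Span_ext _ _ _ (fun x => #|{: W}|%:R^-1 * \sum_w sgw R w * trig T (wact w x))) => [x _|].
  under eq_bigr do rewrite -h2 weyl_den_wact mulrA sgw_sqr mul1r.
  by rewrite sumr_const -[weyl_den x *+ _]mulr_natl mulrA mulVf ?card_W_neq0 // mul1r.
by apply/SpanZ/alt_bnd_sum => p pT; exact: h1.
Qed.

Lemma weyl_den_orbit_sum_Span D k : wt_bnd D k -> Span (alt_bnd (D + n)) (fun x => weyl_den x * orbit_sum k x).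
Proof.
move=> bk; apply: Span_mul weyl_den_Span => _ [l bl ->].
apply: (@Span_ext _ _ _ (fun x => \sum_u alt_sum (l + wt_act u k) x)) => [x _|].
  by rewrite alt_sum_orbit_sum.
apply: Span_sum => u _; apply: Span_mem; exists (l + wt_act u k) => // i.
by rewrite ffunE addnC; exact: absz_add_le (bl i) (wt_bnd_wt_act u bk i).
Qed.

End TrigDegree.

Lemma left_inverse_family (K : fieldType) (T : finType) (B : T -> T -> K) :
  (forall u : T -> K, (forall t, \sum_s u s * B s t = 0) -> forall s, u s = 0) ->
  exists B' : T -> T -> K, forall s t, \sum_r B' s r * B r t = (s == t)%:R.
Proof.
move=> inj; pose M : 'M[K]_#|T| := \matrix_(i, j) B (enum_val i) (enum_val j).
have Mu : M \in unitmx.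
  rewrite -row_free_unit -kermx_eq0; apply/eqP/row_matrixP => i; rewrite row0.
  set u := row i (kermx M).
  have uM : u *m M = 0 by rewrite -row_mul mulmx_ker row0.
  apply/rowP => j; rewrite [RHS]mxE -[j]enum_valK.
  apply: (inj (fun s => u 0 (enum_rank s))) => t.
  have /rowP/(_ (enum_rank t)) := uM; rewrite !mxE => uMt; rewrite -[RHS]uMt.
  rewrite [RHS](reindex (@enum_rank T)) /=; last exact/onW_bij/enum_rank_bij.
  by apply: eq_bigr => s _; rewrite [M _ _]mxE !enum_rankK.
exists (fun s r => invmx M (enum_rank s) (enum_rank r)) => s t.
have /matrixP/(_ (enum_rank s) (enum_rank t)) := mulVmx Mu; rewrite !mxE (inj_eq enum_rank_inj) => <-.
rewrite [RHS](reindex (@enum_rank T)) /=; last exact/onW_bij/enum_rank_bij.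
by apply: eq_bigr => r _; rewrite [M _ _]mxE !enum_rankK.
Qed.

(** * Bases of Hall-Littlewood polynomials *)

Section Bases.
Variables (R : realType) (n : nat) (q q0 : R).
Hypotheses (hq : `|q| < 1) (hq0 : `|q0| < 1) (n_gt0 : (0 < n)%N).
Local Notation C := (R[i]).
Local Notation Zn := {ffun 'I_n -> int}.
Local Notation W := ('S_n * {ffun 'I_n -> bool})%type.
Local Notation F := (('I_n -> R) -> C).
Local Notation HL := (HL q q0).
Local Notation has_mean := (has_mean q q0).
Implicit Types (k l : Zn) (x : 'I_n -> R) (w u : W) (f g h : F).

Lemma c_long_mul (s t : R) : ei (s - t) != 1 -> ei (s + t) != 1 ->
  c_long q (s - t) * c_long q (s + t) * (cos2 s - cos2 t) =
  (1 * ei s + (q%:C ^+ 2) * ei (- s)) + ((- q%:C) * ei t + (- q%:C) * ei (- t)).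
Proof.
move=> h1 h2; rewrite cos2_sub /c_long.
have {}h1 : 1 - ei (- (s - t)) != 0 by rewrite one_sub_ei_neq0 // ei_eq1N.
have {}h2 : 1 - ei (- (s + t)) != 0 by rewrite one_sub_ei_neq0 // ei_eq1N.
have -> : (1 - q%:C * ei (- (s - t))) / (1 - ei (- (s - t))) *
  ((1 - q%:C * ei (- (s + t))) / (1 - ei (- (s + t)))) *
  (ei s * ((1 - ei (- (s - t))) * (1 - ei (- (s + t))))) =
  (1 - q%:C * ei (- (s - t))) * (1 - q%:C * ei (- (s + t))) * ei s.
  by field; rewrite h1 h2.
rewrite opprB !opprD !eiD !eiN; have := ei_neq0 s; have := ei_neq0 t => t0 s0; field.
by rewrite s0 t0.
Qed.

Lemma c_short_mul (s : R) : ei (2 * s) != 1 -> c_short q0 s * (ei s - ei (- s)) = 1 * ei s + (- q0%:C).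
Proof.
move=> h; rewrite ei_sub /c_short.
have {}h : 1 - ei (- (2 * s)) != 0 by rewrite one_sub_ei_neq0 // ei_eq1N.
rewrite mulrACA -mulrA mulrCA mulrA.
have -> : (1 - ei (- (2 * s))) ^-1 * (1 - ei (- (2 * s))) = 1 by rewrite mulVf.
have s0 := ei_neq0 s.
by rewrite !mulr1 eiN mulrBr mulr1 mul1r mulrCA divff // mulr1.
Qed.

(* [Cb * weyl_den], a trigonometric polynomial: the denominators of [Cb] cancel. *)
Definition C_num x : C := prodfun (fun t => 1 * ei t + (- q0%:C))
  (fun s t => (1 * ei s + (q%:C ^+ 2) * ei (- s)) + ((- q%:C) * ei t + (- q%:C) * ei (- t))) x.

Lemma Cb_weyl_den x : reg x -> Cb q q0 x * weyl_den x = C_num x.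
Proof.
move=> [h1 h2]; rewrite CbE /weyl_den /prodfun mulrACA; congr (_ * _).
  by rewrite -big_split; apply: eq_bigr => j _; rewrite /= c_short_mul.
rewrite -big_split; apply: eq_bigr => a _; rewrite -big_split; apply: eq_bigr => b ab /=.
have [|h3 h4] := h2 a b; first by apply: contraTneq ab => ->; rewrite ltnn.
by rewrite c_long_mul.
Qed.

Lemma trig_deg_C_num : trig_deg (fun=> n) C_num.
Proof.
apply: trig_deg_prodfun => [j|a b].
  by apply: trig_degD; [apply: trig_deg_unit_wt; rewrite eqxx|exact: trig_deg_cst].
by apply: trig_degD; apply: trig_degD; (apply: trig_deg_unit_wt || apply: trig_deg_unit_wtN); rewrite eqxx ?addn1.
Qed.

(** [weyl_den] is alternating, so it can be moved inside the sum over W, where it clears the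
    denominators of [Cb]. *)
Lemma HL_weyl_den_Span D k : wt_bnd D k -> Span (alt_bnd (D + n)) (fun x => HL k x * weyl_den x).
Proof.
move=> bk; have [T [h1 h2]] := trig_deg_C_num.
apply: (@Span_ext _ _ _ (fun x => \sum_w sgw R w * trig (trigM T [:: (1, k)]) (wact w x))) => [x rx|].
  rewrite mulr_suml; apply: eq_bigr => w _.
  have -> : weyl_den x = sgw R w * weyl_den (wact w x) by rewrite weyl_den_wact mulrA sgw_sqr mul1r.
  rewrite trig_mul -h2 -(Cb_weyl_den (reg_wact w rx)) /trig big_seq1 /= mul1r; ring.
apply: alt_bnd_sum => p /allpairsP[[a b] /= [/h1 ha]]; rewrite inE => /eqP -> -> i /=.
by rewrite ffunE addnC; exact: absz_add_le (ha i) (bk i).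
Qed.

Definition partn D := {mu : {ffun 'I_n -> 'I_D.+1} | nonincr mu}.
Definition part_wt D (t : partn D) : Zn := toZ (val t).

Lemma dominant_part_wt D (t : partn D) : dominant (part_wt t).
Proof. exact: dominant_toZ (valP t). Qed.

Lemma part_wt_inj D : injective (@part_wt D).
Proof.
move=> s t /ffunP st; apply/val_inj/ffunP => i; apply/val_inj.
by have := st i; rewrite !ffunE => -[].
Qed.

Lemma wt_bnd_part_wt D (t : partn D) : wt_bnd D (part_wt t).
Proof. by move=> i; rewrite ffunE absz_nat -ltnS. Qed.

Lemma alt_bnd_rho D f : Span (alt_bnd (D + n)) f ->
  Span (fun g => exists t : partn D, g = @alt_sum R n (rho n + part_wt t)) f.
Proof.
apply: Span_trans => _ [l bl ->]; have [l0|[w [mu [nmu wl]]]] := alt_sum_canon R bl.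
  by apply: Span_nil => x _.
apply: (@Span_ext _ _ _ (fun x => sgw R w * alt_sum (rho n + toZ mu) x)) => [x _|].
  by rewrite -wl alt_sum_wt_act mulrA sgw_sqr mul1r.
by apply: SpanZ; apply: Span_mem; exists (exist _ mu nmu).
Qed.

Definition HL_fam D : F -> Prop := fun g => exists t : partn D, g = HL (part_wt t).

Lemma has_mean_orthonormal D (s t : partn D) :
  has_mean (fun x => HL (part_wt s) x * HL (part_wt t) x) (if s == t then (HL_norm q (part_wt t))%:C else 0).
Proof.
case: eqVneq => [->|st]; first exact: has_mean_norm (dominant_part_wt t).
by apply: has_mean_orth; rewrite ?(inj_eq (@part_wt_inj D)) //; exact: dominant_part_wt.
Qed.

Lemma HL_normC_neq0 k : (HL_norm q k)%:C != 0.
Proof. by rewrite -(rmorph0 (real_complex R)) (inj_eq (@complexI R)) HL_norm_neq0. Qed.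

Lemma HL_fam_coef D (u : partn D -> C) f s : (forall x, reg x -> f x = \sum_t u t * HL (part_wt t) x) ->
  has_mean (fun x => f x * HL (part_wt s) x) (u s * (HL_norm q (part_wt s))%:C).
Proof.
move=> fE.
apply: (@has_mean_ext _ _ _ _ (fun x => \sum_t u t * (HL (part_wt t) x * HL (part_wt s) x))) => [x rx|].
  by rewrite fE // mulr_suml; apply: eq_bigr => t _; rewrite mulrA.
have -> : u s * (HL_norm q (part_wt s))%:C = \sum_t u t * (if t == s then (HL_norm q (part_wt s))%:C else 0).
  by rewrite (bigD1 s) //= eqxx big1 ?addr0 // => t /negbTE ->; rewrite mulr0.
by apply: has_mean_sum => t _; apply: has_meanZ; exact: has_mean_orthonormal.
Qed.

Lemma HL_fam_free D (u : partn D -> C) : (forall x, reg x -> \sum_t u t * HL (part_wt t) x = 0) ->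
  forall s, u s = 0.
Proof.
move=> u0 s; have /(has_mean_uniq n_gt0) := @HL_fam_coef D u (fun=> 0) s (fun x rx => esym (u0 x rx)).
have L0 : has_mean (fun x => 0 * HL (part_wt s) x) 0.
  by apply: has_mean_ext (@has_mean0 _ n q q0) => x _; rewrite mul0r.
by move=> /(_ _ L0)/eqP; rewrite mulf_eq0 (negbTE (HL_normC_neq0 _)) orbF => /eqP.
Qed.

(* The [HL] times [weyl_den] with [mu] in [partn D] lie in the span of as many alternating sums, and they
   are independent by orthogonality, so they form a basis of it. *)
Lemma alt_sum_HL_fam D l : wt_bnd (D + n) l ->
  Span (fun g => exists t : partn D, g = (fun x => HL (part_wt t) x * weyl_den x)) (@alt_sum R n l).
Proof.
move=> bl.
have /choice[B HB] (t : partn D) : exists c : partn D -> C, forall x, reg x ->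
    HL (part_wt t) x * weyl_den x = \sum_s c s * alt_sum (rho n + part_wt s) x.
  exact/Span_fin/alt_bnd_rho/HL_weyl_den_Span/wt_bnd_part_wt.
have [|B' HB'] := @left_inverse_family _ _ B.
  move=> u uB; apply: HL_fam_free => x rx; apply: (mulIf (weyl_den_neq0 rx)).
  rewrite mul0r mulr_suml; under eq_bigr do rewrite -mulrA HB // mulr_sumr.
  rewrite exchange_big big1 // => s _ /=; under eq_bigr do rewrite mulrA.
  by rewrite -mulr_suml uB mul0r.
have [c hc] := Span_fin (alt_bnd_rho (Span_mem (ex_intro2 _ _ l bl erefl))).
apply: (@Span_ext _ _ _ (fun x => \sum_s c s * \sum_r B' s r * (HL (part_wt r) x * weyl_den x))) => [x rx|].
  rewrite hc //; apply: eq_bigr => s _; congr (_ * _).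
  under eq_bigr do rewrite HB // mulr_sumr.
  rewrite exchange_big (bigD1 s) //= [X in _ + X]big1 ?addr0 => [|t ts].
    by under eq_bigr do rewrite mulrA; rewrite -mulr_suml HB' eqxx mul1r.
  by under eq_bigr do rewrite mulrA; rewrite -mulr_suml HB' eq_sym (negbTE ts) mul0r.
apply: Span_sum => s _; apply: SpanZ; apply: Span_sum => r _; apply: SpanZ.
by apply: Span_mem; exists r.
Qed.

Lemma Span_div_weyl_den (X : F -> Prop) f :
  Span (fun g => exists2 h, X h & g = (fun x => h x * weyl_den x)) (fun x => f x * weyl_den x) -> Span X f.
Proof.
move=> S; apply: (@Span_ext _ _ _ (fun x => f x * weyl_den x * (weyl_den x)^-1)) => [x rx|].
  by rewrite mulfK // weyl_den_neq0.
apply: (Span_mul (f := fun x => f x * weyl_den x)) S => _ [h Xh ->].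
apply: (@Span_ext _ _ _ h) => [x rx|]; last exact: Span_mem.
by rewrite mulfK // weyl_den_neq0.
Qed.

Lemma Sym_HL_fam D f : Span (alt_bnd (D + n)) (fun x => f x * weyl_den x) -> Span (HL_fam D) f.
Proof.
move=> S; apply: Span_div_weyl_den; apply: Span_trans S => _ [l bl ->].
apply: Span_trans (alt_sum_HL_fam bl) => _ [t ->]; apply: Span_mem.
by exists (HL (part_wt t)) => //; exists t.
Qed.

End Bases.

(** * Reduction of the degree *)

Section Reduction.
Variables (R : realType) (n : nat) (q q0 : R).
Hypotheses (hq : `|q| < 1) (hq0 : `|q0| < 1) (n_gt0 : (0 < n)%N).
Local Notation C := (R[i]).
Local Notation Zn := {ffun 'I_n -> int}.
Local Notation W := ('S_n * {ffun 'I_n -> bool})%type.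
Local Notation F := (('I_n -> R) -> C).
Local Notation HL := (HL q q0).
Local Notation has_mean := (has_mean q q0).
Local Notation partn := (partn n).
Implicit Types (k l b p : Zn) (x : 'I_n -> R) (w u : W) (f g h : F).

(** Abel summation: the pairing is the sum of (p_j - p_(j+1)) psum k j. Extending [p] by 0 makes the
    last difference the last entry, so all of them are positive. *)
Lemma abel_pos p k : (forall i j : 'I_n, (i < j)%N -> p j < p i) -> (forall i, 0 < p i) ->
  (forall j, 0 <= psum k j) -> k != 0 -> 0 < \sum_i p i * k i.
Proof.
move=> pdec ppos kpos k0.
pose pn (m : nat) : int := if insub m is Some i then p i else 0.
have pnE (i : 'I_n) : pn i = p i by rewrite /pn valK.
pose d (j : 'I_n) := pn j - pn j.+1.
have dpos j : 0 < d j.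
  rewrite /d pnE subr_gt0 /pn; case: insubP => [i _ /= ij|_]; last exact: ppos.
  by apply: pdec; rewrite ij.
have pE i : p i = \sum_(j < n | (i <= j)%N) d j.
  have := @telescope_sumr _ i n (fun m => - pn m) (ltnW (ltn_ord i)).
  rewrite opprK [pn n]/pn insubN ?ltnn // oppr0 add0r pnE => <-.
  rewrite big_geq_mkord; apply: eq_bigr => j _.
  by rewrite /d opprK addrC.
have -> : \sum_i p i * k i = \sum_j d j * psum k j.
  under eq_bigr do rewrite pE mulr_suml.
  rewrite (exchange_big_dep predT) //=; apply: eq_bigr => j _.
  by rewrite /psum mulr_sumr.
have /existsP[j kj] : [exists j, psum k j != 0].
  apply: contraNT k0; rewrite negb_exists => /forallP h; apply/eqP/psum_eq0 => j.
  by apply/eqP; have := h j; rewrite negbK.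
rewrite (bigD1 j) //= ltr_wpDr //.
  by apply: sumr_ge0 => i _; rewrite mulr_ge0 // ltW.
by rewrite mulr_gt0 // lt_neqAle eq_sym kj kpos.
Qed.

Definition nsq k : int := \sum_i k i * k i.

Lemma nsq_wt_act w k : nsq (wt_act w k) = nsq k.
Proof.
rewrite /nsq [LHS](reindex_inj (@perm_inj _ w.1)); apply: eq_bigr => i _.
by rewrite ffunE permK; case: (w.2 i); rewrite ?expr1 ?expr0 ?mulN1r ?mul1r ?mulrNN.
Qed.

Lemma nsqD k l : nsq (k + l) = nsq k + nsq l + 2 * \sum_i k i * l i.
Proof.
rewrite /nsq mulr_sumr -!big_split /=; apply: eq_bigr => i _; rewrite ffunE; ring.
Qed.

(** The norms of p + b and p + u b differ only through the pairing of [p] with b - u b, which has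
    nonnegative partial sums. *)
Lemma nsq_wt_act_lt p b u : (forall i j : 'I_n, (i < j)%N -> p j < p i) -> (forall i, 0 < p i) ->
  dominant b -> wt_act u b != b -> nsq (p + wt_act u b) < nsq (p + b).
Proof.
move=> pdec ppos db ub; rewrite !nsqD nsq_wt_act ltrD2l ltr_pM2l // -subr_gt0 -sumrB.
have -> : \sum_i (p i * b i - p i * wt_act u b i) = \sum_i p i * (b - wt_act u b) i.
  by apply: eq_bigr => i _; rewrite -mulrBr !ffunE.
apply: abel_pos => // [j|]; last by rewrite subr_eq0 eq_sym.
by rewrite psumD psumN subr_ge0; have /andP[] := psum_wt_act_le u j db.
Qed.

Definition alt_orbit (D K : nat) : F -> Prop := fun g => exists b p,
  [/\ wt_bnd K b, wt_bnd (D + n) p & g = (fun x => alt_sum p x * orbit_sum b x)].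

(* In [alt_sum p * orbit_sum b] the exponent [p + b] has the largest norm, by strict rearrangement;
   induction on the norm removes the other terms. *)
Lemma alt_sum_factor (D K : nat) l : wt_bnd (D + K + n) l -> Span (alt_orbit D K) (@alt_sum R n l).
Proof.
have nsq_ge0 a : 0 <= nsq a by apply: sumr_ge0 => i _; rewrite -expr2 sqr_ge0.
move: {2}(`|nsq l|.+1)%N (ltnSn `|nsq l|%N) => N; elim: N l => // N IH l lN bl.
have [l0|[w [mu [nmu wl]]]] := alt_sum_canon R bl; first by apply: Span_nil => x _.
(* Cut every part of [mu] at [D]: [b] is the excess, at most [K], and [p] is [rho] plus the
   truncated partition, strictly decreasing as the rearrangement needs. *)
pose b : Zn := [ffun i => ((mu i : nat) - D)%N%:Z].
pose p : Zn := [ffun i : 'I_n => ((n - i) + minn (mu i) D)%N%:Z].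
have pb : p + b = wt_act w l.
  rewrite wl; apply/ffunP => i; rewrite !ffunE -!PoszD -addnA; congr (Posz (_ + _)).
  lia.
have pdec (i j : 'I_n) : (i < j)%N -> p j < p i.
  move=> ij; rewrite !ffunE ltz_nat; have := nonincrP nmu (ltnW ij); have := ltn_ord j; lia.
have ppos i : 0 < p i by rewrite ffunE ltz_nat; have := ltn_ord i; lia.
have db : dominant b.
  by move=> i j ij; rewrite !ffunE !lez_nat /=; have := nonincrP nmu ij; lia.
have bb : wt_bnd K b by move=> i; rewrite ffunE absz_nat; have := ltn_ord (mu i); lia.
have bp : wt_bnd (D + n) p by move=> i; rewrite ffunE absz_nat; have := ltn_ord i; lia.
(* The stabilizer of [b] produces the leading term several times; [c] counts these. *)
pose c : C := (\sum_(u : W | wt_act u b == b) 1).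
have c0 : c != 0.
  rewrite /c sumr_const pnatr_eq0 -lt0n; apply/card_gt0P; exists (w1 n).
  rewrite -[_ \in _]/(wt_act (w1 n) b == b); apply/eqP/ffunP => i.
  by rewrite !ffunE /= invg1 perm1 mul1r.
apply: (@Span_ext _ _ _ (fun x => sgw R w * (c^-1 * (alt_sum p x * orbit_sum b x +
   (-1) * \sum_(u : W | wt_act u b != b) alt_sum (p + wt_act u b) x)))) => [x _|].
  rewrite alt_sum_orbit_sum (bigID (fun u : W => wt_act u b == b)) /= mulN1r addrK.
  rewrite (eq_bigr (fun u : W => 1 * alt_sum (p + b) x)) => [|u /eqP ->]; last by rewrite mul1r.
  by rewrite -mulr_suml mulKf // pb alt_sum_wt_act mulrA sgw_sqr mul1r.
apply: SpanZ; apply: SpanZ; apply: SpanD.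
  by apply: Span_mem; exists b, p.
apply: SpanZ; apply: Span_sum => u ub; apply: IH.
  have : nsq (p + wt_act u b) < nsq l by rewrite -(nsq_wt_act w l) -pb; exact: nsq_wt_act_lt.
  have := nsq_ge0 (p + wt_act u b); have := nsq_ge0 l; move: lN.
  move: (nsq _) (nsq _) => s t; lia.
move=> i; rewrite ffunE.
rewrite -addnA [(K + n)%N]addnC addnA; exact: absz_add_le (bp i) (wt_bnd_wt_act u bb i).
Qed.

Lemma orbit_sum_HL b k x : HL k x * orbit_sum b x = \sum_u HL (k + wt_act u b) x.
Proof.
rewrite /HL mulr_suml exchange_big; apply: eq_bigr => w _ /=.
rewrite -(orbit_sum_wact b w x) /orbit_sum mulr_sumr; apply: eq_bigr => u _.
by rewrite chrD -mulrA -[in RHS]chr_wact.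
Qed.

Lemma HL_orbit_sum_weyl_den_Span (D K : nat) b k : wt_bnd D k -> wt_bnd K b ->
  Span (alt_bnd (D + K + n)) (fun x => HL k x * orbit_sum b x * weyl_den x).
Proof.
move=> bk bb.
apply: (@Span_ext _ _ _ (fun x => \sum_u HL (k + wt_act u b) x * weyl_den x)) => [x _|].
  by rewrite orbit_sum_HL mulr_suml.
apply: Span_sum => u _; apply: HL_weyl_den_Span => // i.
by rewrite ffunE; exact: absz_add_le (bk i) (wt_bnd_wt_act u bb i).
Qed.

Variables (m : nat) (q1 : R).

Definition first_ord : 'I_n := Ordinal n_gt0.

Definition top (t : partn m.+1) := part_wt t first_ord == m.+1%:Z.

(* The combinations that vanish at the nodes and integrate to 0. *)
Definition bethe_comb (t : partn m.+1) x : C := HL (part_wt t) x - q1%:C * HL (part_wt t - unit_wt first_ord) x.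

Definition size_wt k : int := \sum_i k i.

Lemma psum_last k : exists j, psum k j = size_wt k /\ forall l, psum l j = size_wt l.
Proof.
have hl : (n.-1 < n)%N by rewrite prednK.
have H l : psum l (Ordinal hl) = size_wt l.
  by apply: eq_bigl => i /=; have := ltn_ord i; lia.
by exists (Ordinal hl).
Qed.

Lemma has_mean_size k l : (forall i, 0 <= l i) -> size_wt l < size_wt k ->
  has_mean (fun x => HL k x * HL l x) 0.
Proof.
move=> l0 lk; rewrite -[0](_ : \sum_(u : W) 0 = 0); last by rewrite big1.
apply: has_mean_HL_HL => // u; left; split=> //.
have [j [_ jE]] := psum_last k; exists j; rewrite psumD !jE.
have : - size_wt l <= size_wt (wt_act u l).
  rewrite /size_wt -sumrN [X in X <= _](reindex_inj (@perm_inj _ u.1^-1%g)).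
  apply: ler_sum => i _; rewrite ffunE; have := l0 (u.1^-1%g i).
  by case: (u.2 _); rewrite ?expr1 ?expr0; lia.
lia.
Qed.

Definition HL_or_bethe : F -> Prop := fun g => HL_fam q q0 m g \/ exists2 t, top t & g = bethe_comb t.

Lemma part_wt_ge0 D (t : partn D) i : 0 <= part_wt t i.
Proof. by rewrite ffunE. Qed.

Lemma part_wt_le_first D (t : partn D) i : part_wt t i <= part_wt t first_ord.
Proof. by have /andP[] := @dominant_part_wt n D t first_ord i (leq0n i). Qed.

(* Replacing [P_(nu - e_1)] costs only weights of smaller size, whence the induction. *)
Lemma top_reduce (t : partn m.+1) : Span HL_or_bethe (HL (part_wt t)).
Proof.
have size_ge0 s : 0 <= size_wt (part_wt s) by apply: sumr_ge0 => i _; exact: part_wt_ge0.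
move: {2}(`|size_wt (part_wt t)|.+1)%N (ltnSn `|size_wt (part_wt t)|%N) => N.
elim: N t => // N IH t tN.
have [tt|ntt] := boolP (top t); last first.
  apply: Span_mem; left.
  have tm i : (val t i < m.+1)%N.
    move: ntt (part_wt_le_first t i) (ltn_ord (val t first_ord)); rewrite /top !ffunE eqz_nat lez_nat; lia.
  pose mu : {ffun 'I_n -> 'I_m.+1} := [ffun i => Ordinal (tm i)].
  have nmu : nonincr mu.
    apply/forallP => i; apply/forallP => j; apply/implyP => ij.
    by rewrite ffunE [X in (_ <= nat_of_ord X)%N]ffunE; exact: nonincrP (valP t) i j ij.
  exists (exist _ mu nmu); congr (HL _); apply/ffunP => i.
  by rewrite !ffunE.
(* When the largest part is repeated, [nu] is not a partition, so [HL nu] has to be expanded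
   again. *)
set nu := part_wt t - unit_wt first_ord.
have nu_ge0 i : 0 <= nu i.
  rewrite !ffunE /=; case: eqP => [->|_]; last by rewrite subr0.
  by move: tt; rewrite /top ffunE => /eqP ->.
have bnu : wt_bnd m.+1 nu.
  move=> i; have := nu_ge0 i; have : nu i <= part_wt t i by rewrite !ffunE; case: eqP => _; lia.
  have := wt_bnd_part_wt t i; move: (nu i) (part_wt t i) => a b; lia.
have size_nu : size_wt nu = size_wt (part_wt t) - 1.
  rewrite /size_wt -[1](_ : \sum_i (unit_wt first_ord) i = 1).
    by rewrite -sumrB; apply: eq_bigr => i _; rewrite !ffunE.
  have [j [_ jE]] := psum_last (unit_wt first_ord); rewrite -/(size_wt _) -jE psum_unit_wt.
  by [].
have [c hc] := Span_fin (Sym_HL_fam hq hq0 n_gt0 (HL_weyl_den_Span q q0 bnu)).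
(* Triangularity from orthogonality: no partition of size above that of [nu], which is one less than
   that of [t], occurs. *)
have c0 s : size_wt nu < size_wt (part_wt s) -> c s = 0.
  move=> hs; have h1 := HL_fam_coef hq hq0 s hc.
  have h2 := has_mean_size nu_ge0 hs.
  have {}h2 : has_mean (fun x => HL nu x * HL (part_wt s) x) 0.
    by apply: has_mean_ext h2 => x _; rewrite mulrC.
  have := has_mean_uniq n_gt0 h1 h2 => /eqP.
  by rewrite mulf_eq0 (negbTE (HL_normC_neq0 hq _)) orbF => /eqP.
apply: (@Span_ext _ _ _ (fun x => bethe_comb t x + q1%:C * \sum_s c s * HL (part_wt s) x)) => [x rx|].
  by rewrite -hc // /bethe_comb subrK.
apply: SpanD; first by apply: Span_mem; right; exists t.
apply: SpanZ; apply: Span_sum => s _.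
have [hs|hs] := ltP (size_wt nu) (size_wt (part_wt s)).
  by apply: Span_nil => x _; rewrite c0 // mul0r.
apply: SpanZ; apply: IH.
have := size_ge0 _ s; have := size_ge0 _ t; move: hs tN; rewrite size_nu.
move: (size_wt _) (size_wt _) => a b; lia.
Qed.

Definition bethe_ideal (K : nat) : F -> Prop := fun g => exists b t,
  [/\ forall i, (`|b i| < K)%N, top t & g = (fun x => bethe_comb t x * orbit_sum b x)].

Lemma bethe_ideal_mono K K' g : (K <= K')%N -> bethe_ideal K g -> bethe_ideal K' g.
Proof. by move=> c_pair_sq [b [t [h1 h2 h3]]]; exists b, t; split=> // i; apply: leq_trans c_pair_sq. Qed.

(** One step lowers [K] by one: factor through degree m + 1 times degree K, then rewrite the first
    factor by [top_reduce]. The P_mu with mu_1 <= m give products of total degree only m + K. *)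
Lemma chain_reduce K f : Span (alt_bnd (m + K + n)) (fun x => f x * weyl_den x) ->
  Span (fun g => HL_fam q q0 m g \/ bethe_ideal K g) f.
Proof.
elim: K f => [|K IH] f.
  rewrite addn0 => /(Sym_HL_fam hq hq0 n_gt0); apply: Span_trans => g pg.
  by apply: Span_mem; left.
move=> Sf.
have S1 : Span (fun g => exists (t : partn m.+1) b, wt_bnd K b /\ g = (fun x => HL (part_wt t) x * orbit_sum b x)) f.
  apply: Span_div_weyl_den; apply: Span_trans Sf => _ [l bl ->].
  have bl' : wt_bnd (m.+1 + K + n) l by rewrite addSn -addnS.
  apply: Span_trans (alt_sum_factor bl') => _ [b [p [bb bp ->]]].
  apply: Span_mul (alt_sum_HL_fam hq hq0 n_gt0 bp) => _ [t ->].
  apply: Span_mem; exists (fun x => HL (part_wt t) x * orbit_sum b x); first by exists t, b.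
  by apply/funext => x; rewrite mulrAC.
apply: Span_trans S1 => _ [t [b [bb ->]]].
apply: Span_mul (top_reduce t) => _ [[s ->]|[s ts ->]]; last first.
  by apply: Span_mem; right; exists b, s; split.
have : Span (fun g => HL_fam q q0 m g \/ bethe_ideal K g) (fun x => HL (part_wt s) x * orbit_sum b x).
  by apply: IH; apply: HL_orbit_sum_weyl_den_Span => //; exact: wt_bnd_part_wt.
apply: Span_trans => g [pg|hg]; apply: Span_mem; first by left.
by right; apply: bethe_ideal_mono hg.
Qed.

(** The product expands into P_k whose first entry is m + 1 or m plus an integer of absolute value
    below m, hence positive. This is where the degree 2m comes from. *)
Lemma has_mean_bethe_ideal g : bethe_ideal m g -> has_mean g 0.
Proof.
move=> [b [t [hb /eqP tt ->]]].
apply: (@has_mean_ext _ _ _ _ (fun x => \sum_u HL (part_wt t + wt_act u b) x + (- q1%:C) * \sum_u HL (part_wt t -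
  unit_wt first_ord + wt_act u b) x)) => [x _|].
  by rewrite /bethe_comb mulrBl orbit_sum_HL -mulrA orbit_sum_HL mulNr.
have psum0 k : psum k first_ord = k first_ord.
  rewrite /psum (bigD1 first_ord) //= big1 ?addr0 // => i /andP[]; rewrite leqn0 => /eqP h.
  by case/eqP; apply: val_inj.
have b0 u : (`|wt_act u b first_ord| < m)%N.
  have [m0|] := posnP m; first by have := hb first_ord; rewrite m0.
  move=> m0; have bb : wt_bnd m.-1 b by move=> i; have := hb i; lia.
  by have := wt_bnd_wt_act u bb first_ord; lia.
have E : \sum_(u : W) 0 + (- q1%:C) * \sum_(u : W) 0 = 0 :> C by rewrite !big1 // mulr0 addr0.
rewrite -[X in has_mean _ X]E {E}.
apply: has_meanD; last apply: has_meanZ; apply: has_mean_sum => u _; apply: (@has_mean_HL _ _ _ _ hq hq0 _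
  first_ord); rewrite psum0.
  by rewrite ffunE tt; have := b0 u; move: (wt_act u b first_ord) => a; lia.
rewrite ffunE [X in X + _]ffunE tt !ffunE eqxx.
have := b0 u; rewrite ffunE; move: (_ ^+ _ * _) => a; lia.
Qed.

End Reduction.

(** * Nodes and Bethe equations *)

Section PhaseFunction.
Variables (R : realType) (q : R).
Hypothesis hq : `|q| < 1.

Lemma phase_den_gt0 (t : R) : 0 < 1 - q * cos t.
Proof.
rewrite subr_gt0; apply: le_lt_trans (ler_norm _) _; rewrite normrM.
apply: le_lt_trans hq; rewrite -[leRHS]mulr1 ler_wpM2l //.
by rewrite ler_norml cos_geN1 cos_le1.
Qed.

Lemma u_den_gt0 (t : R) : 0 < 1 - 2 * q * cos t + q ^+ 2.
Proof.
have := phase_den_gt0 t; have := cos2Dsin2 t; have := sqr_ge0 (q * sin t).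
set c := cos t; set s := sin t => h1 h2 h3.
have -> : 1 - 2 * q * c + q ^+ 2 = (1 - q * c) ^+ 2 + (q * s) ^+ 2.
  by transitivity (1 - 2 * q * c + q ^+ 2 * (c ^+ 2 + s ^+ 2)); [rewrite h2 mulr1|ring].
by rewrite ltr_wpDr // exprn_gt0.
Qed.

(* Antiderivative of [u_q]: the argument of [(z - q) / (1 - q z)] on the unit circle *)
Definition phase (t : R) : R := t + 2 * atan (q * sin t / (1 - q * cos t)).

Lemma is_derive_phase (t : R) : is_derive t 1 phase (u_q q t).
Proof.
have d0 := lt0r_neq0 (phase_den_gt0 t).
have ds : is_derive t 1 (fun t => q * sin t) (q * cos t).
  by have := is_deriveZ q (is_derive_sin t); rewrite /GRing.scale.
have dc : is_derive t 1 (fun t => 1 - q * cos t) (q * sin t).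
  have := is_deriveB (is_derive_cst (1 : R) t (1 : R)) (is_deriveZ q (is_derive_cos t)).
  by rewrite /GRing.scale /= mulrN sub0r opprK.
have dy : is_derive t 1 (fun t => q * sin t / (1 - q * cos t))
   ((q * cos t - q ^+ 2) / (1 - q * cos t) ^+ 2).
  have := is_deriveM ds (@is_deriveV _ (fun t => 1 - q * cos t) t (q * sin t) 1 d0 dc); rewrite /GRing.scale /=.
  set D := (X in is_derive _ _ _ X); have -> // : D = (q * cos t - q ^+ 2) / (1 - q * cos t) ^+ 2.
  rewrite /D; have -> : q ^+ 2 = q ^+ 2 * (cos t ^+ 2 + sin t ^+ 2) by rewrite cos2Dsin2 mulr1.
  by field.
have da := @is_derive1_comp _ atan _ t _ _ (is_derive1_atan _) dy.
have := is_deriveD (is_derive_id t (1 : R)) (is_deriveZ 2 da); rewrite /GRing.scale /=.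
set D := (X in is_derive _ _ _ X); have -> // : D = u_q q t.
rewrite /D /u_q.
have h : 1 + (q * sin t / (1 - q * cos t)) ^+ 2 = (1 - 2 * q * cos t + q ^+ 2) / (1 - q * cos t) ^+ 2.
  have -> : q ^+ 2 = q ^+ 2 * (cos t ^+ 2 + sin t ^+ 2) by rewrite cos2Dsin2 mulr1.
  by field.
have u0 := lt0r_neq0 (u_den_gt0 t).
by rewrite h; field; rewrite d0 u0.
Qed.

Lemma continuous_u_q : continuous (u_q q).
Proof.
move=> t; apply: cvgM; first exact: cvg_cst.
apply: cvgV; first exact: lt0r_neq0 (u_den_gt0 t).
apply: cvgD; last exact: cvg_cst.
apply: cvgB; first exact: cvg_cst.
by apply: cvgM; [exact: cvg_cst|exact: continuous_cos].
Qed.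

Lemma v_qE : v_q q =1 phase.
Proof.
move=> t; rewrite /v_q; apply: (oint_primitive continuous_u_q is_derive_phase).
by rewrite /phase sin0 mulr0 mul0r atan0 mulr0 addr0.
Qed.

Lemma continuous_v_q : continuous (v_q q).
Proof.
by rewrite (funext v_qE); exact: (@continuous_is_derive _ phase (u_q q) is_derive_phase).
Qed.

Lemma v_qN t : v_q q (- t) = - v_q q t.
Proof. by rewrite !v_qE /phase sinN cosN mulrN mulNr atanN mulrN opprD. Qed.

Lemma v_q0 : v_q q 0 = 0.
Proof. by rewrite v_qE /phase sin0 mulr0 mul0r atan0 mulr0 addr0. Qed.

Lemma v_q_pi : v_q q pi = pi.
Proof. by rewrite v_qE /phase sinpi mulr0 mul0r atan0 mulr0 addr0. Qed.

Lemma v_q_piD t : v_q q (pi + t) + v_q q (pi - t) = 2 * pi.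
Proof.
rewrite !v_qE /phase sinD cosD sinB cosB sinpi cospi !mul0r !mulN1r !add0r subr0 addr0 opprK.
rewrite mulrN mulNr atanN; ring.
Qed.

Lemma le_v_q s t : s <= t -> v_q q s <= v_q q t.
Proof.
move=> st; rewrite !v_qE.
have [|c _ h] := @MVT_segment _ phase (u_q q) s t st (fun x _ => is_derive_phase x).
  by apply: continuous_subspaceT; exact: (@continuous_is_derive _ phase (u_q q) is_derive_phase).
rewrite -subr_ge0 h mulr_ge0 ?subr_ge0 //.
have q2 : q ^+ 2 <= 1 by rewrite -real_normK ?num_real // expr_le1 // ltW.
by rewrite /u_q divr_ge0 ?subr_ge0 // ltW // u_den_gt0.
Qed.

Definition blaschke (t : R) : R[i] := (ei t - q%:C) / (1 - q%:C * ei t).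

Lemma ei_v_q t : ei (v_q q t) = blaschke t.
Proof.
rewrite v_qE /phase; set a := atan _.
have d0 := phase_den_gt0 t.
have ha : sin a * (1 - q * cos t) = cos a * (q * sin t).
  have ca : cos a != 0.
    by rewrite /a cos_atan invr_eq0 lt0r_neq0 // sqrtr_gt0 ltr_wpDr // sqr_ge0.
  have : tan a = q * sin t / (1 - q * cos t) by rewrite /a atanK.
  rewrite /tan => /eqP; rewrite eqr_div // ?lt0r_neq0 // => /eqP ->.
  by rewrite mulrC.
have e0 := ei_neq0 a.
have z0 := one_sub_mul_ei_neq0 t hq.
apply: (mulIf z0); rewrite /blaschke divfK // mulr_natl mulr2n !eiD.
(* [a] is the argument of 1 - q e^(-it), so e^(ia) (1 - q e^(it)) is real and equals its
   conjugate. *)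
have sym : ei a * (1 - q%:C * ei t) = ei (- a) * (1 - q%:C * ei (- t)).
  apply/eqP; rewrite eq_complex /= !cosN !sinN; apply/andP; split; apply/eqP; last by lra.
  ring.
have -> : ei t * (ei a * ei a) * (1 - q%:C * ei t) = ei t * ei a * (ei a * (1 - q%:C * ei t)) by ring.
rewrite sym !eiN; have t0 := ei_neq0 t; field.
by rewrite e0 t0.
Qed.

End PhaseFunction.

Section Gradient.
Variables (R : realType) (n m : nat) (lam : 'I_n -> nat) (q q0 q1 : R).
Hypotheses (hq : `|q| < 1) (hq0 : `|q0| < 1) (hq1 : `|q1| < 1).
Implicit Types (x : 'I_n -> R).

Lemma is_derive_sum_cond (I : Type) (r : seq I) (P : pred I) (F : I -> R -> R) (f : I -> R) (t : R) :
  (forall i, is_derive t 1 (F i) (f i)) ->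
  is_derive t 1 (fun y => \sum_(i <- r | P i) F i y) (\sum_(i <- r | P i) f i).
Proof.
move=> dF; elim: r => [|i r IH].
  by rewrite big_nil; under eq_fun do rewrite big_nil; exact: is_derive_cst.
rewrite big_cons; under eq_fun do rewrite big_cons.
by case: ifP => // _; apply: is_deriveD.
Qed.

Definition upd x (j : 'I_n) (t : R) : 'I_n -> R := fun i => if i == j then t else x i.

Lemma is_derive_upd x (j i : 'I_n) (t : R) : is_derive t 1 (fun t => upd x j t i) (i == j)%:R.
Proof.
by rewrite /upd; case: eqP => _; [exact: is_derive_id|exact: is_derive_cst].
Qed.

Lemma is_derive_oint_comp (g a : R -> R) (t da : R) : continuous g -> is_derive t 1 a da ->
  is_derive t 1 (fun t => oint 0 (a t) g) (g (a t) * da).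
Proof.
move=> cg ha; have h := is_derive_oint (a t) cg.
by have := @is_derive1_comp _ (fun y : R => oint 0 y g) a t (g (a t)) da h ha.
Qed.

Definition pair_force x (j : 'I_n) (k : 'I_n) := v_q q (x j + x k) + v_q q (x j - x k).

(* Left-hand side of the critical point equations. *)
Definition force x (j : 'I_n) : R :=
  2 * m.+1%:R * x j + v_q q0 (x j) + v_q q1 (x j) + \sum_(k < n | k != j) pair_force x j k.

Lemma is_derive_Vb x j : is_derive (x j) 1 (fun t => Vb m lam q q0 q1 (upd x j t))
  (force x j - 2 * pi * ((n - j)%N + lam j)%:R).
Proof.
have cq := continuous_v_q hq.
have c01 : continuous (fun t => v_q q0 t + v_q q1 t).
  by move=> t; apply: cvgD; exact: continuous_v_q.
pose d (i : 'I_n) : R := (i == j)%:R.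
have E : upd x j (x j) = x by apply/funext => i; rewrite /upd; case: eqP => // ->.
pose p1 (i k : 'I_n) : R := v_q q (x i + x k) * (d i + d k) + v_q q (x i - x k) * (d i - d k).
pose p2 (i : 'I_n) : R := m.+1%:R * (2 * x i * d i) - 2 * pi * ((n - i)%N + lam i)%:R * d i
   + (v_q q0 (x i) + v_q q1 (x i)) * d i.
have D : is_derive (x j) 1 (fun t => Vb m lam q q0 q1 (upd x j t))
    (\sum_(i < n) \sum_(k < n | (i < k)%N) p1 i k + \sum_(i < n) p2 i).
  apply: is_deriveD.
    apply: is_derive_sum_cond => i; apply: is_derive_sum_cond => k.
    have h1 : is_derive (x j) 1 (fun t => upd x j t i + upd x j t k) (d i + d k).
      exact: is_deriveD (is_derive_upd x j i (x j)) (is_derive_upd x j k (x j)).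
    have h2 : is_derive (x j) 1 (fun t => upd x j t i - upd x j t k) (d i - d k).
      exact: is_deriveB (is_derive_upd x j i (x j)) (is_derive_upd x j k (x j)).
    have := is_deriveD (is_derive_oint_comp cq h1) (is_derive_oint_comp cq h2).
    by rewrite /= E.
  apply: is_derive_sum_cond => i; have unit_wt := is_derive_upd x j i (x j).
  have h1 := is_deriveZ (m.+1%:R) (is_deriveX 2 unit_wt).
  have h2 := is_deriveZ (2 * pi * ((n - i)%N + lam i)%:R) unit_wt.
  have h3 := is_deriveD (is_deriveB h1 h2) (is_derive_oint_comp c01 unit_wt).
  move: h3; by rewrite /= E /GRing.scale /= expr1.
apply: is_derive_eq D _.
have dsum (X : 'I_n -> R) : \sum_i d i * X i = X j.
  by rewrite (bigD1 j) //= /d eqxx mul1r big1 ?addr0 // => i /negbTE ->; rewrite mul0r.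
have -> : \sum_i p2 i = 2 * m.+1%:R * x j + v_q q0 (x j) + v_q q1 (x j) - 2 * pi * ((n - j)%N + lam j)%:R.
  rewrite -[RHS](dsum (fun j => 2 * m.+1%:R * x j + v_q q0 (x j) + v_q q1 (x j) - 2 * pi * ((n - j)%N + lam j)%:R)).
  by apply: eq_bigr => i _; rewrite /p2; ring.
have -> : \sum_(i < n) \sum_(k < n | (i < k)%N) p1 i k = \sum_(k < n | k != j) pair_force x j k.
  rewrite -[RHS](dsum (fun j => \sum_(k < n | k != j) pair_force x j k)).
  (* As [v_q] is odd, the derivative of the (i, k) term in its second coordinate is the force of [i]
     on [k]. *)
  transitivity (\sum_(i < n) \sum_(k < n | (i < k)%N) d i * pair_force x i k +
                \sum_(i < n) \sum_(k < n | (i < k)%N) d k * pair_force x k i).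
    rewrite -big_split; apply: eq_bigr => i _; rewrite -big_split; apply: eq_bigr => k _.
    rewrite /= /p1 /pair_force [x k + x i]addrC -[x k - x i]opprB (v_qN hq); ring.
  rewrite [X in _ + X](exchange_big_dep predT) //= -big_split; apply: eq_bigr => i _ /=.
  rewrite -!mulr_sumr -mulrDr; congr (_ * _).
  rewrite [RHS](bigID (fun k : 'I_n => (i < k)%N)) /=; congr (_ + _); apply: eq_bigl => k; rewrite -val_eqE /=; lia.
by rewrite /force; ring.
Qed.

Lemma gradient_eq x : (forall y, Vb m lam q q0 q1 x <= Vb m lam q q0 q1 y) ->
  forall j, force x j = 2 * pi * ((n - j)%N + lam j)%:R.
Proof.
move=> xmin j; apply/eqP; rewrite -subr_eq0; apply/eqP.
pose g t := Vb m lam q q0 q1 (upd x j t).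
have dg t : derivable g t 1.
  have := is_derive_Vb (upd x j t) j; rewrite [X in is_derive X](_ : _ = t); last by rewrite /upd eqxx.
  have -> : (fun t0 => Vb m lam q q0 q1 (upd (upd x j t) j t0)) = g.
    have U s : upd (upd x j t) j s = upd x j s by apply/funext => i; rewrite /upd; case: ifP => // ->.
    by apply/funext => s; rewrite U.
  by case.
have E : upd x j (x j) = x by apply/funext => i; rewrite /upd; case: eqP => // ->.
have h0 : is_derive (x j) 1 g 0.
  apply: (@derive1_at_min _ g (x j - 1) (x j + 1)).
  - by rewrite lerD2l; lra.
  - by move=> t _; exact: dg.
  - by rewrite in_itv /=; apply/andP; split; lra.
  - by move=> t _; rewrite /g E; exact: xmin.
have [_ <-] := is_derive_Vb x j; have [_ <-] := h0.
by [].
Qed.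

End Gradient.

Section NodeLocation.
Variables (R : realType) (n m : nat) (q q0 q1 : R).
Hypotheses (hq : `|q| < 1) (hq0 : `|q0| < 1) (hq1 : `|q1| < 1).
Variables (lam : 'I_n -> nat) (x : 'I_n -> R).
Hypotheses (lam_nonincr : forall i j : 'I_n, (i <= j)%N -> (lam j <= lam i)%N)
  (lam_le : forall i, (lam i <= m)%N)
  (x_crit : forall j, force m q q0 q1 x j = 2 * pi * ((n - j)%N + lam j)%:R).

(** If x_i <= x_j, monotonicity of [v_q] orders the forces the same way, but the right-hand sides
    strictly decrease in the index. *)
Lemma crit_decr (i j : 'I_n) : (i < j)%N -> x j < x i.
Proof.
move=> ij; rewrite ltNge; apply/negP => xij.
have : force m q q0 q1 x i <= force m q q0 q1 x j.
  have ji : j != i by apply: contraTneq ij => ->; rewrite ltnn.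
  apply: lerD; first apply: lerD; first apply: lerD; rewrite ?le_v_q //.
    by rewrite ler_pM2l // mulr_gt0 ?ltr0n.
  rewrite (bigD1 j) //= [leRHS](bigD1 i) 1?eq_sym //=; apply: lerD.
    by rewrite /pair_force [x i + x j]addrC lerD2l le_v_q // lerB.
  rewrite (eq_bigl (fun k => (k != j) && (k != i))) => [|k]; last by rewrite andbC.
  by apply: ler_sum => k _; apply: lerD; rewrite le_v_q // ?lerD2r.
rewrite !x_crit ler_pM2l ?mulr_gt0 ?pi_gt0 // ler_nat.
by have := lam_nonincr (ltnW ij); have := ltn_ord j; lia.
Qed.

Lemma crit_gt0 j : 0 < x j.
Proof.
rewrite ltNge; apply/negP => xj.
have : force m q q0 q1 x j <= 0.
  have v0 p : `|p| < 1 -> v_q p (x j) <= 0 by move=> hp; rewrite -(v_q0 hp) le_v_q.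
  have D0 a b : a <= 0 -> b <= 0 -> a + b <= 0 :> R by lra.
  apply: (D0) => [|].
    by rewrite !D0 ?v0 // mulr_ge0_le0 // mulr_ge0.
  apply: sumr_le0 => k _; rewrite /pair_force -[x j - x k]opprB (v_qN hq) subr_le0 le_v_q //.
  by rewrite addrC lerD2l; lra.
rewrite x_crit leNgt mulr_gt0 ?mulr_gt0 ?pi_gt0 // ltr0n.
by have := ltn_ord j; lia.
Qed.

Lemma crit_lt_pi j : x j < pi.
Proof.
rewrite ltNge; apply/negP => xj.
(* Beyond pi the linear term gives at least 2 pi (m + 1), each of the two single [v_q] terms pi, and
   each of the n - 1 pairs 2 pi by [v_q_piD]. The right-hand side is at most 2 pi (m + n). *)
have : 2 * pi * (m.+1 + 1 + n.-1)%:R <= force m q q0 q1 x j.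
  have v0 p : `|p| < 1 -> pi <= v_q p (x j) by move=> hp; rewrite -{1}(v_q_pi hp) le_v_q.
  have -> : 2 * pi * (m.+1 + 1 + n.-1)%:R =
    2 * m.+1%:R * pi + pi + pi + \sum_(k < n | k != j) 2 * pi :> R.
    by rewrite sumr_const cardC1 card_ord -[_ *+ n.-1]mulr_natr !natrD; ring.
  apply: lerD; first apply: lerD; first apply: lerD; rewrite ?v0 //.
    by rewrite ler_pM2l // mulr_gt0 ?ltr0n.
  apply: ler_sum => k _; rewrite -(v_q_piD hq (x k)).
  by apply: lerD; rewrite le_v_q // lerD2r.
rewrite x_crit ler_pM2l ?mulr_gt0 ?pi_gt0 // ler_nat.
by have := lam_le j; have := ltn_ord j; lia.
Qed.

Lemma crit_in_Ab : in_Ab x.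
Proof.
split=> [j _|]; first exact: crit_lt_pi.
by split=> [j k kj|j _]; [apply: crit_decr; rewrite kj|exact: crit_gt0].
Qed.

End NodeLocation.

Section Bethe.
Variables (R : realType) (n m : nat) (q q0 q1 : R).
Hypotheses (hq : `|q| < 1) (hq0 : `|q0| < 1) (hq1 : `|q1| < 1) (n_gt0 : (0 < n)%N).
Local Notation C := (R[i]).
Local Notation Zn := {ffun 'I_n -> int}.
Local Notation W := ('S_n * {ffun 'I_n -> bool})%type.
Local Notation force := (force m q q0 q1).
Local Notation first_ord := (first_ord n_gt0).
Implicit Types (k : Zn) (x y : 'I_n -> R) (w : W).

Definition bethe x := forall j, ei (force x j) = 1.

Lemma ei_2piM (N : nat) : ei (2 * pi * N%:R : R) = 1.
Proof.
elim: N => [|N IH]; first by rewrite mulr0 ei0.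
have epi : ei (pi : R) = -1 by apply/eqP; rewrite eq_complex /= cospi sinpi oppr0 !eqxx.
rewrite -[N.+1]addn1 natrD mulrDr eiD IH mul1r mulr1 mulr_natl mulr2n eiD epi.
by rewrite mulrNN mulr1.
Qed.

Lemma crit_bethe (lam : 'I_n -> nat) x :
  (forall j, force x j = 2 * pi * ((n - j)%N + lam j)%:R) -> bethe x.
Proof. by move=> xc j; rewrite xc ei_2piM. Qed.

(** All phase functions are odd, so the force is W-equivariant and the Bethe equations hold on whole
    orbits. *)
Lemma force_wact w x j : force (wact w x) j = sgn R (w.2 j) * force x (w.1 j).
Proof.
have vs p b t : `|p| < 1 -> v_q p (sgn R b * t) = sgn R b * v_q p t.
  by move=> hp; rewrite /sgn; case: b; rewrite ?expr1 ?expr0 ?mulN1r ?mul1r // (v_qN hp).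
have N1 a b : v_q q (- a - b) = - v_q q (a + b) by rewrite -opprD (v_qN hq).
have N2 a b : v_q q (- a + b) = - v_q q (a - b) by rewrite -(v_qN hq) opprB addrC.
have E : \sum_(k < n | k != j) pair_force q (wact w x) j k =
    sgn R (w.2 j) * \sum_(k < n | k != w.1 j) pair_force q x (w.1 j) k.
  rewrite [in RHS](reindex_inj (@perm_inj _ w.1)) mulr_sumr.
  apply: eq_big => [k|k _]; first by rewrite (inj_eq perm_inj).
  rewrite /pair_force /wact /sgn.
  case: (w.2 j); case: (w.2 k); rewrite ?expr1 ?expr0 ?mulN1r ?mul1r ?opprK //.
  - by rewrite N1 N2 opprD.
  - by rewrite N1 N2 opprD addrC.
  - by rewrite addrC.
rewrite /force E !vs // /wact; ring.
Qed.

Lemma bethe_wact w x : bethe x -> bethe (wact w x).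
Proof.
move=> bx j; rewrite force_wact /sgn.
by case: (w.2 j); rewrite ?expr1 ?expr0 ?mulN1r ?mul1r // eiN bx invr1.
Qed.

Lemma r_long_blaschke p t : r_long p t = - blaschke p t :> C.
Proof. by rewrite /r_long /blaschke -[RHS]mulNr opprB. Qed.

Definition bethe_term k x : C := Cb q q0 x * chr k x * (1 - q1%:C * ei (- x first_ord)).

Lemma wact_flip i x j : wact (flip i) x j = if j == i then - x j else x j.
Proof.
rewrite /wact /flip /= perm1 ffunE /sgn; case: eqP => _; by rewrite ?expr1 ?expr0 ?mulN1r ?mul1r.
Qed.

(* [c_long] and [c_short] pick up Blaschke factors under the flip; with the character and the [q1]-factor
   these multiply to minus the left-hand side of the Bethe equation. *)
Lemma bethe_term_flip k x : k first_ord = m.+1%:Z -> reg x -> bethe x -> bethe_term k (wact (flip first_ord) x) =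
  - bethe_term k x.
Proof.
move=> ki rx bx; set y := wact (flip first_ord) x; set z := x first_ord.
have yi0 : y first_ord = - z by rewrite /y wact_flip eqxx.
have yj j : j != first_ord -> y j = x j by rewrite /y wact_flip => /negbTE ->.
have hchr : chr k x = ei (2 * m.+1%:R * z) * chr k y.
  rewrite /chr -eiD; congr ei; rewrite (bigD1 first_ord) //= [in RHS](bigD1 first_ord) //= yi0 ki.
  rewrite addrA; congr (_ + _); first by rewrite -/z; ring.
  by apply: eq_bigr => j /yj ->.
(* Blaschke factors of the roots z + x_j and z - x_j, which carry the only pair factors that the
   flip changes. *)
pose B := \prod_(j < n | j != first_ord) (blaschke q (z + x j) * blaschke q (z - x j)).
have [r1 r2] := rx.
have hCb : Cb q q0 x = - ei z * blaschke q0 z * B * Cb q q0 y.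
  have i0j (j : 'I_n) : (first_ord < j)%N = (j != first_ord) by rewrite -val_eqE /=; lia.
  rewrite !CbE (bigD1 first_ord) //= [in RHS](bigD1 first_ord) //= yi0 -/z.
  rewrite [\prod_(j | _) \prod_(j0 | _) _](bigD1 first_ord) //= [X in _ = _ * (_ * X)](bigD1 first_ord) //=.
  rewrite (eq_bigr (fun j => c_short q0 (y j))) => [|j /yj ->//].
  set P1 := \prod_(i < n | i != first_ord) c_short _ _.
  set P2 := \prod_(i < n | i != first_ord) \prod_(k < n | _) _.
  set P3 := \prod_(i < n | i != first_ord) \prod_(k < n | _) _.
  have -> : P2 = P3.
    apply: eq_bigr => j j0; apply: eq_bigr => l jl; rewrite !yj //.
    by rewrite -i0j; apply: leq_ltn_trans jl.
  rewrite c_short_r_short //; last exact: r1.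
  rewrite -/z.
  have -> : \prod_(k0 < n | (first_ord < k0)%N) (c_long q (x first_ord - x k0) * c_long q (x first_ord + x k0)) =
      B * \prod_(k0 < n | (first_ord < k0)%N) (c_long q (y first_ord - y k0) * c_long q (y first_ord + y k0)).
    rewrite /B !(eq_bigl (fun j => j != first_ord) _ i0j) -big_split; apply: eq_bigr => j j0 /=.
    have [|h3 h4] := r2 first_ord j; first by rewrite eq_sym.
    rewrite (c_long_r_long hq h3) (c_long_r_long hq h4) yi0 yj // !r_long_blaschke -/z.
    have -> : - (z - x j) = - z + x j by rewrite opprB addrC.
    by rewrite opprD; ring.
  have -> : r_short q0 z = - ei z * blaschke q0 z.
    by rewrite /r_short /blaschke; ring.
  ring.
have z1 := one_sub_mul_ei_neq0 z hq1.
have zN := ei_neq0 z.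
have hq1E : 1 - q1%:C * ei (- z) = (ei z)^-1 * blaschke q1 z * (1 - q1%:C * ei z).
  by rewrite /blaschke eiN; field; rewrite zN z1.
have hb : ei (2 * m.+1%:R * z) * blaschke q0 z * blaschke q1 z * B = 1.
  rewrite -(bx first_ord) /force !eiD ei_sum !ei_v_q // -/z; congr (_ * _).
  by apply: eq_bigr => j _; rewrite /pair_force eiD !ei_v_q.
rewrite /bethe_term yi0 opprK -/z hchr hCb hq1E.
rewrite -[LHS]mul1r -hb; field.
exact: zN.
Qed.

Lemma bethe_comb_bethe (t : partn n m.+1) x : top n_gt0 t -> reg x -> bethe x -> bethe_comb q q0 n_gt0 q1 t x = 0.
Proof.
move=> /eqP tt rx bx.
have E : bethe_comb q q0 n_gt0 q1 t x = \sum_w bethe_term (part_wt t) (wact w x).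
  rewrite /bethe_comb /HL mulr_sumr -sumrB; apply: eq_bigr => w _.
  by rewrite /bethe_term chrD chrN chr_unit_wt eiN; ring.
have : bethe_comb q q0 n_gt0 q1 t x = - bethe_comb q q0 n_gt0 q1 t x.
  rewrite {1}E (reindex_inj (@wmul_injr _ (flip first_ord))) E -sumrN.
  by apply: eq_bigr => w _; rewrite -wactM bethe_term_flip //; [exact: reg_wact|exact: bethe_wact].
by move/eqP; rewrite -addr_eq0 -mulr2n mulrn_eq0 /= => /eqP.
Qed.

Lemma bethe_ideal_bethe K g x : bethe_ideal q q0 n_gt0 m q1 K g -> reg x -> bethe x -> g x = 0.
Proof.
move=> [b [t [_ tt ->]]] rx bx; by rewrite bethe_comb_bethe ?mul0r.
Qed.

End Bethe.

Lemma mulmx1C_fun (K : fieldType) (T : finType) (A B : T -> T -> K) :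
  (forall s t, \sum_r A s r * B r t = (s == t)%:R) ->
  forall s t, \sum_r B s r * A r t = (s == t)%:R.
Proof.
move=> AB; pose M (F : T -> T -> K) : 'M[K]_#|T| := \matrix_(i, j) F (enum_val i) (enum_val j).
have ME F G s t : (M F *m M G) (enum_rank s) (enum_rank t) = \sum_r F s r * G r t.
  rewrite mxE [RHS](reindex (@enum_val T predT)) /=; last exact/onW_bij/enum_val_bij.
  by apply: eq_bigr => i _; rewrite !mxE !enum_rankK.
have M1 : M A *m M B = 1%:M.
  apply/matrixP => i j; rewrite -(enum_valK i) -(enum_valK j) ME AB mxE.
  by rewrite (inj_eq (can_inj (@enum_rankK T))).
move=> s t; rewrite -ME (mulmx1C M1) mxE (inj_eq (can_inj (@enum_rankK T))).
by [].
Qed.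

(** * Interpolation and quadrature *)

Section SymmetricSpan.
Variables (R : realType) (n : nat) (q q0 : R).
Hypotheses (hq : `|q| < 1) (hq0 : `|q0| < 1) (n_gt0 : (0 < n)%N).
Local Notation C := (R[i]).
Local Notation Zn := {ffun 'I_n -> int}.
Local Notation W := ('S_n * {ffun 'I_n -> bool})%type.
Local Notation F := (('I_n -> R) -> C).
Local Notation HL := (HL q q0).
Local Notation partn := (partn n).
Local Notation Span := (@Span R n).
Implicit Types (k l b p : Zn) (x : 'I_n -> R) (w u : W) (f g h : F).

Definition orbit_fam (D : nat) : F -> Prop := fun g => exists2 b, wt_bnd D b & g = @orbit_sum R n b.

Lemma Span_orbit_fam_invariant D f : (forall w x, f (wact w x) = f x) -> trig_deg (fun=> D) f -> Span (orbit_fam D) f.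
Proof.
move=> fw [T [hT fE]].
apply: (@Span_ext _ _ _ (fun x => #|{: W}|%:R^-1 * \sum_(p <- T | p \in T) p.1 * orbit_sum p.2 x)) => [x _|].
  transitivity (#|{: W}|%:R^-1 * \sum_(w : W) f (wact w x)).
    congr (_ * _); under [RHS]eq_bigr do rewrite fE.
    rewrite -big_seq /trig exchange_big; apply: eq_bigr => p _.
    by rewrite mulr_sumr.
  under eq_bigr do rewrite fw.
  by rewrite sumr_const -[f x *+ _]mulr_natl mulrA mulVf ?card_W_neq0 // mul1r.
apply/SpanZ/Span_sum => p pT; apply/SpanZ/Span_mem; exists p.2 => //; exact: hT.
Qed.

Lemma Span_orbit_fam_weyl_den D f : Span (orbit_fam D) f -> Span (alt_bnd (D + n)) (fun x => f x * weyl_den x).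
Proof.
apply: Span_mul => _ [b bb ->].
by apply: (@Span_ext _ _ _ (fun x => weyl_den x * orbit_sum b x)) => [x _|]; [rewrite mulrC|exact:
  weyl_den_orbit_sum_Span].
Qed.

Lemma Span_HL_fam1 D : Span (HL_fam q q0 D) (fun=> 1).
Proof.
apply: Sym_HL_fam => //; apply: (@Span_ext _ _ _ (@weyl_den R n)) => [x _|]; first by rewrite mul1r.
apply: Span_trans (@weyl_den_Span R n) => _ [l bl ->]; apply: Span_mem; exists l => // i.
by apply: leq_trans (bl i) _; rewrite leq_addl.
Qed.

(** Within bound [n] the only partition left is 0, so the alternating sums are multiples of P_0
    times [weyl_den], and P_0 is a nonzero constant. *)
Lemma alt_sum_rho_weyl_den p : wt_bnd n p -> Span (eq (@weyl_den R n)) (@alt_sum R n p).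
Proof.
move=> bp; have [c hc] := Span_fin (Span_HL_fam1 0).
have tz0 (t : partn 0) : part_wt t = 0.
  by apply/ffunP => i; rewrite !ffunE; case: (val t i) => [[]].
pose a := \sum_t c t.
have aE x : reg x -> a * HL 0 x = 1.
  by move=> /hc ->; rewrite mulr_suml; apply: eq_bigr => t _; rewrite tz0.
apply: Span_trans (alt_sum_HL_fam hq hq0 n_gt0 (D := 0) bp) => _ [t ->]; rewrite tz0.
apply: (@Span_ext _ _ _ (fun x => a^-1 * weyl_den x)) => [x rx|]; last exact/SpanZ/Span_mem.
have a0 : a != 0 by apply: contra_eq_neq (aE x rx) => ->; rewrite mul0r eq_sym oner_eq0.
by rewrite -[a^-1]mulr1 -(aE x rx) mulKf.
Qed.

(** The poles cancel: after multiplication by [weyl_den], the case of degree 0 in [alt_sum_factor]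
    splits off alternating sums of bound [n], which are multiples of [weyl_den]. *)
Lemma HL_orbit_fam D k : wt_bnd D k -> Span (orbit_fam D) (HL k).
Proof.
move=> bk; apply: Span_div_weyl_den; apply: Span_trans (HL_weyl_den_Span q q0 bk) => _ [l bl ->].
apply: Span_trans (@alt_sum_factor R n q q0 hq hq0 n_gt0 0 D l bl) => _ [b [p [bb bp ->]]].
apply: Span_mul (alt_sum_rho_weyl_den bp) => _ <-.
apply: Span_mem; exists (orbit_sum b); first by exists b.
by apply/funext => x; rewrite mulrC.
Qed.

Lemma HL_orbit_fam_weyl_den_Span D K k f : wt_bnd D k -> Span (orbit_fam K) f ->
  Span (alt_bnd (D + K + n)) (fun x => HL k x * f x * weyl_den x).
Proof.
move=> bk Sf; apply: (@Span_ext _ _ _ (fun x => f x * (HL k x * weyl_den x))) => [x _|].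
  by rewrite mulrCA mulrA.
apply: Span_mul Sf => _ [b bb ->].
apply: (@Span_ext _ _ _ (fun x => HL k x * orbit_sum b x * weyl_den x)) => [x _|]; last exact:
  HL_orbit_sum_weyl_den_Span.
by rewrite [RHS]mulrCA mulrA.
Qed.

(* Degree one in each cosine; separates the nodes. *)
Definition sep (a : C) x : C := \prod_j (cos2 (x j) - a).

Lemma sep_orbit_fam a : Span (orbit_fam 1) (sep a).
Proof.
apply: Span_orbit_fam_invariant => [w x|].
  rewrite /sep [RHS](reindex_inj (@perm_inj _ w.1)); apply: eq_bigr => j _.
  by rewrite /wact cos2_sgn.
have h (j : 'I_n) : trig_deg (fun i : 'I_n => (i == j) : nat) (fun x : 'I_n -> R => cos2 (x j) - a).
  apply: (@trig_deg_ext _ _ _ (fun x => (1 * ei (x j) + 1 * ei (- x j)) + (- a))) => [x|].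
    by rewrite !mul1r.
  apply: trig_degD; last exact: trig_deg_cst.
  by apply: trig_degD; [apply: trig_deg_unit_wt|apply: trig_deg_unit_wtN]; rewrite eqxx.
have := trig_deg_prod (index_enum 'I_n) (P := predT) (fun j _ => h j).
apply: trig_deg_weak => i; rewrite (bigD1 i) //= eqxx big1 // => j /negbTE.
by rewrite eq_sym => ->.
Qed.

Lemma cos2_cos (t : R) : cos2 t = (2 * cos t)%:C.
Proof. exact: ei_addN. Qed.

(** If every x_j occurs among the y_k, the two strictly decreasing sequences coincide. Otherwise the
    cosine of a missing x_j separates, since cosine is injective on (0, pi). *)
Lemma sep_points x y : in_Ab x -> in_Ab y -> x <> y ->
  exists a, sep a x = 0 /\ sep a y != 0.
Proof.
move=> /in_Ab_bounds[xb xd] /in_Ab_bounds[yb yd] xy.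
have [/existsP[j /forallP hj]|] := boolP [exists j, forall k, y k != x j].
  exists (cos2 (x j)); split; first by rewrite /sep (bigD1 j) //= subrr mul0r.
  apply/prodf_neq0 => k _; apply: contra_neq (hj k) => /subr0_eq.
  rewrite !cos2_cos => /complexI /(mulfI (lt0r_neq0 (ltr0n _ 2))) h.
  apply: cos_inj h; rewrite in_itv /=.
    by have /andP[? ?] := yb k; rewrite !ltW.
  by have /andP[? ?] := xb j; rewrite !ltW.
rewrite negb_exists => /forallP H; case: xy.
pose sq (z : 'I_n -> R) := [seq z i | i <- enum 'I_n].
have srt z : (forall j k : 'I_n, (j < k)%N -> z k < z j) -> sorted >%R (sq z).
  move=> zd; rewrite sorted_map; apply: (@sub_sorted _ (relpre val ltn)); first by move=> j k; exact: zd.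
  by rewrite -sorted_map val_enum_ord iota_ltn_sorted.
have sx := srt _ xd; have sy := srt _ yd.
have unq z : sorted >%R (sq z) -> uniq (sq z).
  by apply: sorted_uniq => [a b c ab bc|a]; [exact: lt_trans bc ab|exact: ltxx].
have sub : {subset sq x <= sq y}.
  move=> _ /mapP[j _ ->]; have := H j; rewrite negb_forall => /existsP[k].
  by rewrite negbK => /eqP <-; apply: map_f; rewrite mem_enum.
have [_ eqi] := uniq_min_size (unq _ sx) sub (eq_leq (etrans (size_map _ _) (esym (size_map _ _)))).
have E : sq x = sq y.
  apply: (irr_sorted_eq _ _ sx sy eqi) => [a b c ab bc|a]; [exact: lt_trans bc ab|exact: ltxx].
have sqE z (i : 'I_n) : nth 0 (sq z) i = z i.
  rewrite (nth_map i) ?size_enum_ord //.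
  by congr z; rewrite nth_ord_enum.
by apply/funext => i; rewrite -!sqE E.
Qed.

End SymmetricSpan.

(** * The quadrature rule and its weights *)

Section Quadrature.
Variables (R : realType) (n m : nat) (q q0 q1 : R).
Hypotheses (hq : `|q| < 1) (hq0 : `|q0| < 1) (hq1 : `|q1| < 1) (n_gt0 : (0 < n)%N).
Local Notation C := (R[i]).
Local Notation T := (partn n m).
Local Notation F := (('I_n -> R) -> C).
Local Notation HL := (HL q q0).
Local Notation has_mean := (has_mean q q0).
Local Notation Span := (@Span R n).
Variable X : T -> 'I_n -> R.
Hypotheses (X_Ab : forall t, in_Ab (X t)) (X_bethe : forall t, bethe m q q0 q1 (X t))
  (X_inj : injective X).
Implicit Types (f g h : F).

Let X_reg t : reg (X t). Proof. exact: in_Ab_reg. Qed.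

Definition node_value (s t : T) : C := HL (part_wt s) (X t).

Definition nodal (v : T -> C) := exists c : T -> C, forall t, v t = \sum_s c s * node_value s t.

Lemma nodal_Span K f :
  Span (fun g => HL_fam q q0 m g \/ bethe_ideal q q0 n_gt0 m q1 K g) f -> nodal (fun t => f (X t)).
Proof.
elim=> {f}[f f0|c g h f gP _ [d hd] fE].
  exists (fun=> 0) => t; rewrite f0 // big1 // => s _; by rewrite mul0r.
case: gP => [[s gE]|hg].
  exists (fun r => (if r == s then c else 0) + d r) => t.
  rewrite fE // hd; under [RHS]eq_bigr do rewrite mulrDl.
  rewrite big_split; congr (_ + _).
  rewrite (bigD1 s) //= eqxx big1 ?addr0 ?gE // => r /negbTE ->.
  by rewrite mul0r.
exists d => t; rewrite fE // hd (bethe_ideal_bethe hq hq0 hq1 hg) ?mulr0 ?add0r //.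
Qed.

(** Multiplication by [sep] raises the degree by one, and [chain_reduce] with K = 1 brings it back
    modulo functions that vanish at the nodes. *)
Lemma nodal_sep a v : nodal v -> nodal (fun t => v t * sep a (X t)).
Proof.
move=> [c hc].
have [d hd] : nodal (fun t => (\sum_s c s * HL (part_wt s) (X t)) * sep a (X t)).
  apply: (@nodal_Span 1 (fun x => (\sum_s c s * HL (part_wt s) x) * sep a x)).
  apply: chain_reduce => //.
  apply: (@Span_ext _ _ _ (fun x => \sum_s c s * (HL (part_wt s) x * sep a x * weyl_den x))) => [x _|].
    by rewrite !mulr_suml; apply: eq_bigr => s _; rewrite !mulrA.
  apply: Span_sum => s _; apply: SpanZ; apply: HL_orbit_fam_weyl_den_Span => //; first exact: wt_bnd_part_wt.
  exact: sep_orbit_fam.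
by exists d => t; rewrite hc -hd.
Qed.

(** Lagrange interpolation: multiply 1 by one separating factor for each other node. The degree
    grows with the number of nodes, yet the values stay [nodal]. *)
Lemma nodal_delta s0 : nodal (fun t => (s0 == t)%:R).
Proof.
have : forall t : T, exists a, t != s0 -> sep a (X t) = 0 /\ sep a (X s0) != 0.
  move=> t; have [->|ts] := eqVneq t s0; first by exists 0.
  have [|a ha] := sep_points (X_Ab t) (X_Ab s0); first by move=> /X_inj/eqP; rewrite (negbTE ts).
  by exists a.
move=> /choice[a ha].
pose P (r : seq T) t := \prod_(s <- r | s != s0) sep (a s) (X t).
have nP r : nodal (P r).
  elim: r => [|s r [c hc]].
    have [c hc] := Span_fin (Span_HL_fam1 hq hq0 n_gt0 m).
    by exists c => t; rewrite /P big_nil; exact: hc.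
  have [ss|ss] := boolP (s != s0); last by exists c => t; rewrite /P big_cons (negbTE ss) -hc.
  have [d hd] : nodal (fun t => P r t * sep (a s) (X t)) by apply: nodal_sep; exists c.
  by exists d => t; rewrite /P big_cons ss mulrC hd.
have [c hc] := nP (index_enum T).
have p0 : P (index_enum T) s0 != 0 by apply/prodf_neq0 => t ts; have [] := ha t ts.
exists (fun s => (P (index_enum T) s0)^-1 * c s) => t.
under eq_bigr do rewrite -mulrA.
rewrite -mulr_sumr -hc; case: eqVneq => [<-|ts]; first by rewrite mulVf.
rewrite /P [X in _ * X](bigD1 t) 1?eq_sym //=.
have [|-> _] := ha t; first by rewrite eq_sym.
by rewrite mul0r mulr0.
Qed.

Definition exact_on (w : T -> C) f := has_mean f (\sum_t w t * f (X t)).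

Lemma exact_Span (Y : F -> Prop) w f : (forall g, Y g -> exact_on w g) -> Span Y f -> exact_on w f.
Proof.
move=> Yw; elim=> {f}[f f0|c g h f gY _ IH fE]; rewrite /exact_on.
  rewrite big1 => [|t _]; last by rewrite f0 // mulr0.
  by apply: has_mean_ext (@has_mean0 _ n q q0) => x rx; rewrite f0.
have -> : \sum_t w t * f (X t) = c * (\sum_t w t * g (X t)) + \sum_t w t * h (X t).
  rewrite mulr_sumr -big_split; apply: eq_bigr => t _ /=.
  by rewrite fE //; ring.
apply: (@has_mean_ext _ _ _ _ (fun x => c * g x + h x)) => [x rx|]; first by rewrite fE.
by apply: has_meanD => //; apply: has_meanZ; exact: Yw.
Qed.

Lemma exact_weights : exists w : T -> C, forall f,
  Span (alt_bnd (m + m + n)) (fun x => f x * weyl_den x) -> exact_on w f.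
Proof.
have /choice[E' HE'] := nodal_delta.
(* Interpolation gives E' E = 1; nodes and polynomials are indexed by the same partitions, so the
   matrices are square and E E' = 1 too. *)
have E'E : forall s t, \sum_r node_value s r * E' r t = (s == t)%:R.
  by apply: mulmx1C_fun => s t; rewrite HE'.
have /choice[l Hl] (s : T) : exists l : C, has_mean (HL (part_wt s)) l.
  have [c hc] := Span_fin (Span_HL_fam1 hq hq0 n_gt0 m).
  exists (c s * (HL_norm q (part_wt s))%:C).
  by apply: has_mean_ext (HL_fam_coef hq hq0 s hc) => x _; rewrite mul1r.
exists (fun t => \sum_s E' t s * l s) => f /(chain_reduce hq hq0 n_gt0 q1).
apply: exact_Span => g [[s ->]|hg]; rewrite /exact_on.
  have -> // : \sum_t (\sum_r E' t r * l r) * HL (part_wt s) (X t) = l s.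
  transitivity (\sum_r (\sum_t node_value s t * E' t r) * l r).
    under eq_bigr do rewrite mulr_suml; rewrite exchange_big; apply: eq_bigr => r _ /=.
    by rewrite mulr_suml; apply: eq_bigr => t _; rewrite /node_value; ring.
  rewrite (bigD1 s) //= E'E eqxx mul1r big1 ?addr0 // => r rs.
  by rewrite E'E eq_sym (negbTE rs) mul0r.
rewrite big1 => [|t _]; first exact: has_mean_bethe_ideal hg.
by rewrite (bethe_ideal_bethe hq hq0 hq1 hg) ?mulr0.
Qed.

Lemma christoffel_weights w : (forall f,
    Span (alt_bnd (m + m + n)) (fun x => f x * weyl_den x) -> exact_on w f) ->
  forall t, w t = (\sum_s node_value s t ^+ 2 / (HL_norm q (part_wt s))%:C)^-1.
Proof.
move=> wE t.
have orth r s : \sum_t (node_value r t) * (w t * node_value s t / (HL_norm q (part_wt s))%:C) = (r == s)%:R.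
  have h1 : exact_on w (fun x => HL (part_wt r) x * HL (part_wt s) x).
    apply: wE; apply: HL_orbit_fam_weyl_den_Span => //; first exact: wt_bnd_part_wt.
    by apply: HL_orbit_fam => //; exact: wt_bnd_part_wt.
  have h2 := has_mean_orthonormal hq hq0 r s.
  have := has_mean_uniq n_gt0 h1 h2 => h3.
  transitivity ((\sum_t w t * (HL (part_wt r) (X t) * HL (part_wt s) (X t))) / (HL_norm q (part_wt s))%:C).
    by rewrite mulr_suml; apply: eq_bigr => p _; rewrite /node_value; ring.
  rewrite h3; case: eqP => _; last by rewrite mul0r.
  by rewrite divff // HL_normC_neq0.
(* The diagonal entry of the reversed product has [w t] as a common factor. *)
have := @mulmx1C_fun _ _ node_value (fun p s => w p * node_value s p / (HL_norm q (part_wt s))%:C) orth t t.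
rewrite eqxx => h.
have {}h : w t * \sum_s node_value s t ^+ 2 / (HL_norm q (part_wt s))%:C = 1.
  by rewrite -[RHS]h mulr_sumr; apply: eq_bigr => s _; ring.
set S := \sum_s _ in h *.
have S0 : S != 0 by apply: contra_eq_neq h => ->; rewrite mulr0 eq_sym oner_eq0.
by rewrite -[RHS]mul1r -h mulfK.
Qed.

End Quadrature.

Section PolynomialSpace.
Variables (R : realType) (n : nat).
Local Notation C := (R[i]).
Local Notation Zn := {ffun 'I_n -> int}.
Local Notation W := ('S_n * {ffun 'I_n -> bool})%type.
Implicit Types (x : 'I_n -> R) (w u : W).

Lemma wt_act_inj w : injective (@wt_act n w).
Proof.
move=> k l /ffunP kl; apply/ffunP => i; have := kl (w.1 i); rewrite !ffunE permK.
by apply: mulfI; rewrite signr_eq0.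
Qed.

(** The exponents form a W-stable set without repetitions, so [Mb] is W-invariant. *)
Lemma Mb_orbit_fam D (mu : {ffun 'I_n -> 'I_D.+1}) : Span (orbit_fam D) (@Mb R n D mu).
Proof.
set s := [seq signed_perm mu s e | s <- enum [set: 'S_n], e <- enum [set: {ffun 'I_n -> bool}]].
have sP nu : reflect (exists u : W, nu = wt_act u (toZ mu)) (nu \in s).
  apply: (iffP allpairsP) => [[[p e] /= [_ _ ->]]|[u ->]].
    exists (p^-1, [ffun i => e ((p^-1)%g i)])%g; apply/ffunP => i.
    by rewrite !ffunE /= invgK permK.
  exists (u.1^-1, [ffun i => u.2 ((u.1^-1)%g i)])%g => /=.
  split; rewrite ?mem_enum ?inE //.
  by apply/ffunP => i; rewrite !ffunE.
have MbE x : Mb mu x = trig [seq (1, nu) | nu <- undup s] x.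
  by rewrite /trig big_map; apply: eq_bigr => nu _; rewrite mul1r.
apply: Span_orbit_fam_invariant => [w x|]; last first.
  exists [seq (1, nu) | nu <- undup s]; split=> // p /mapP[nu]; rewrite mem_undup.
  move=> /sP[u ->] -> /=; apply: wt_bnd_wt_act => i; rewrite ffunE absz_nat -ltnS; exact: ltn_ord.
rewrite /Mb -/s.
transitivity (\sum_(nu <- [seq wt_act w nu | nu <- undup s]) chr nu x).
  by rewrite big_map; apply: eq_bigr => nu _; rewrite -chr_wact.
apply: perm_big; have um : uniq [seq wt_act w nu | nu <- undup s].
  by rewrite map_inj_uniq ?undup_uniq //; exact: wt_act_inj.
apply: uniq_perm; rewrite ?undup_uniq //.
have sub : {subset [seq wt_act w nu | nu <- undup s] <= undup s}.
  move=> k /mapP[nu]; rewrite mem_undup => /sP[u ->] ->; rewrite mem_undup wt_actM.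
  by apply/sP; exists (wmul u w).
by have [] := uniq_min_size um sub; rewrite ?size_map.
Qed.

Lemma in_Pb_orbit_fam D f : in_Pb D f -> Span (@orbit_fam R n D) f.
Proof.
move=> [c fE]; apply: (@Span_ext _ _ _ (fun x => \sum_(mu | nonincr mu) c mu * Mb mu x)) => [x _|].
  by rewrite fE.
by apply: Span_sum => mu _; apply: SpanZ; exact: Mb_orbit_fam.
Qed.

Lemma PbE D (mu : {ffun 'I_n -> 'I_D.+1}) (q q0 : R) x : Pb mu q q0 x = HL q q0 (toZ mu) x.
Proof.
rewrite /Pb /HL pair_bigA; apply: eq_bigr => w _; congr (_ * ei _).
by apply: eq_bigr => j _; rewrite ffunE mulrC.
Qed.

(** P_k is real: its conjugate is its value at -x, which lies in the W-orbit of [x]. *)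
Lemma HL_sqnorm (q q0 : R) (k : Zn) x : (sqnorm (HL q q0 k x))%:C = HL q q0 k x ^+ 2.
Proof.
have cPP : cconj (HL q q0 k x) = HL q q0 k x.
  rewrite {1}/HL /cconj rmorph_sum /=.
  rewrite -(HL_wact q q0 k (w0 n) x); apply: eq_bigr => w _.
  rewrite -/(cconj _) cconjM Cb_conj; congr (Cb q q0 _ * _).
    by rewrite wact0; apply/funext => j; rewrite /opp /wact mulrN.
  rewrite /cconj /chr ei_conj -sumrN; congr ei; apply: eq_bigr => j _.
  by rewrite wact0 /wact !mulrN.
by rewrite expr2 -{3}cPP /sqnorm add_Re2_Im2 sqr_normc.
Qed.

Lemma deltab_HL_norm D (t : partn n D) (q : R) : deltab (val t) q = (HL_norm q (part_wt t))^-1.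
Proof.
rewrite /deltab /HL_norm -prodfV; apply: eq_bigr => a _; rewrite -prodfV.
apply: eq_big => [b|b _]; last by rewrite invf_div.
by rewrite !ffunE eqz_nat.
Qed.

Lemma sum_partn D (V : nmodType) (G : {ffun 'I_n -> 'I_D.+1} -> V) :
  \sum_(mu | nonincr mu) G mu = \sum_(t : partn n D) G (val t).
Proof.
rewrite (reindex_omap (val : partn n D -> _) insub) => [|mu nm]; last by rewrite insubT.
by apply: eq_bigl => t; rewrite (valP t) valK eqxx.
Qed.

End PolynomialSpace.

Theorem mainTheorem3 (R : realType) (n m : nat) (q q0 q1 : R)
  (hn : (1 <= n)%N) (hm : (0 < m)%N)
  (hq : -1 < q < 1) (hq0 : -1 < q0 < 1) (hq1 : -1 < q1 < 1)
  (node : {ffun 'I_n -> 'I_m.+1} -> ('I_n -> R))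
  (hnode : forall lam : {ffun 'I_n -> 'I_m.+1}, nonincr lam ->
     forall x : 'I_n -> R,
       Vb m (fun j => nat_of_ord (lam j)) q q0 q1 (node lam)
         <= Vb m (fun j => nat_of_ord (lam j)) q q0 q1 x)
  (f : ('I_n -> R) -> R[i]) (hf : in_Pb (2 * m) f) :
  ((2 * pi) ^- n)%:C *
    int_Ab (fun xi => f xi * ((sqnorm (Cb q q0 xi))^-1)%:C)
  = \sum_(lam : {ffun 'I_n -> 'I_m.+1} | nonincr lam)
      f (node lam) *
      ((\sum_(mu : {ffun 'I_n -> 'I_m.+1} | nonincr mu)
          sqnorm (Pb mu q q0 (node lam)) * deltab mu q)^-1)%:C.
Proof.
move: hq hq0 hq1; rewrite -!ltr_norml => nq nq0 nq1.
have crit (t : partn n m) := gradient_eq nq nq0 nq1 (hnode _ (valP t)).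
have XA (t : partn n m) : in_Ab (node (val t)).
  apply: (crit_in_Ab nq nq0 nq1 _ _ (crit t)); first exact: nonincrP (valP t).
  by move=> i; rewrite -ltnS.
have XB (t : partn n m) := crit_bethe (crit t).
(* The critical point equations recover lambda from its node. *)
have XI : injective (fun t : partn n m => node (val t)).
  move=> s t st; apply/val_inj/ffunP => j; apply/val_inj.
  have := crit s j; rewrite st crit => /(mulfI _) => h.
  have {}h := h (lt0r_neq0 (mulr_gt0 (ltr0n _ 2) (pi_gt0 R))).
  by move: h => /eqP; rewrite eqr_nat eqn_add2l => /eqP.
have [w wE] := exact_weights nq nq0 nq1 hn XA XB XI.
have := wE f; rewrite addnn -mul2n => /(_ (Span_orbit_fam_weyl_den (in_Pb_orbit_fam hf))).
move=> /(has_mean_int hn) ->.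
have p0 : ((2 * pi) ^+ n)%:C != 0 :> R[i].
  by have := exprn_gt0 n (mulr_gt0 (ltr0n _ 2) (pi_gt0 R)); rewrite -ltcR => /lt0r_neq0.
rewrite mulrA [X in X * _](_ : _ = 1) ?mul1r; last by rewrite fmorphV mulVf.
rewrite sum_partn; apply: eq_bigr => t _; rewrite mulrC; congr (_ * _).
rewrite (christoffel_weights nq nq0 hn wE) fmorphV; congr (_^-1).
rewrite sum_partn rmorph_sum; apply: eq_bigr => s _ /=.
by rewrite PbE deltab_HL_norm rmorphM fmorphV /= HL_sqnorm.
Qed.
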